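(* Let $k$ be a field of characteristic different from $2$ and $q\in k$ a root of unity with $\ell=\mathrm{ord}(q^2)>2$. Assume $\ell\neq6$ and $q^6\neq1$. Let $r\ge 1$, and let $N$ be the kernel of the surjective algebra homomorphism $BMW_r(q)\to E_q^r(2)$ sending $g_i$ to the $R$-matrix acting on the $i$-th and $(i+1)$-st tensor factors of $W^{\otimes r}$. Then the simple modules for $BMW_r(q)$ which are annihilated by $N$ (equivalently, killed by the element $\tilde\Phi_q$ generating $N$) are, up to isomorphism, $\{L_W^r(2m)\mid 0\le m\le r\}$. Their dimensions are given by $$\dim_k L_W^r(s)=\sum_{i=0}^r(-1)^i\binom{r}{i}c_{2(r-i),s},\qquad s=2m,$$ where $c_{a,s}=(V_q^{\otimes a}:T_q(s))$ is the multiplicity of $T_q(s)$ as a direct summand of $V_q^{\otimes a}$.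
   Context: $BMW_r(q)$ is the $k$-algebra with generators $g_i^{\pm1},e_i$ ($1\le i\le r-1$) and relations: $g_ig_j=g_jg_i$ if $|i-j|>1$; $g_ig_{i+1}g_i=g_{i+1}g_ig_{i+1}$ for $1\le i\le r-2$; $g_i-g_i^{-1}=(q^2-q^{-2})(1-e_i)$; $g_ie_i=e_ig_i=q^{-4}e_i$; $e_ig_{i+1}^{\pm1}e_i=q^{\pm4}e_i$ for $1\le i\le r-2$; $e_ig_{i-1}^{\pm1}e_i=q^{\pm4}e_i$ for $2\le i\le r-1$. (This is the specialization at $v\mapsto q$ of the algebra over $\mathbb{Z}[v,v^{-1}]$ given by the same presentation with $v$ in place of $q$.) $U_q=U_q(sl_2)$ is Lusztig's quantum group for $sl_2$ over $k$ (divided power form specialized at $q$; finite dimensional type 1 modules). $\Delta_q(m)$ is the Weyl module of highest weight $m\ge0$, $\nabla_q(m)=\Delta_q(m)^*$, $V_q=\Delta_q(1)$, $W=\Delta_q(2)$ (which is tilting here), and $T_q(m)$ is the indecomposable tilting module of highest weight $m$ (tilting: both the module and its dual have Weyl filtrations). $E_q^r(2)=\mathrm{End}_{U_q}(W^{\otimes r})$ is cellular with cell modules $C_W^r(s)=\mathrm{Hom}_{U_q}(\Delta_q(s),W^{\otimes r})$; $L_W^r(s)$ is the quotient of $C_W^r(s)$ by $\{f:h\circ f=0\text{ for all }h\in\mathrm{Hom}_{U_q}(W^{\otimes r},\nabla_q(s))\}$, which is the simple head of $C_W^r(s)$ when nonzero; the list of simple modules refers to the nonzero $L_W^r(2m)$.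 The homomorphism $BMW_r(q)\to E_q^r(2)$ is known to exist and, under the assumptions made, to be surjective, so $E_q^r(2)\simeq BMW_r(q)/N$ and $L_W^r(s)$ is regarded as a $BMW_r(q)$-module through it. It is known that $N$ is generated as a two-sided ideal by a specified element $\tilde\Phi_q\in BMW_4(q)$ (for $r\le3$, $N=0$ and the condition is empty). *)

(* Defs.v *)
From HB Require Import structures.
From mathcomp Require Import all_boot all_order all_algebra.
From mathcomp Require Import boolp.
From mathcomp Require Import mxtens monalg.

Set Implicit Arguments.
Unset Strict Implicit.
Unset Printing Implicit Defensive.

Import Order.TTheory GRing.Theory Num.Theory.
Local Open Scope quotient_scope.
Local Open Scope ring_scope.

Definition is_submodule (A : pzRingType) (M : lmodType A) (P : M -> Prop) :=
  [/\ P 0, forall x y, P x -> P y -> P (x + y) & forall a x, P x -> P (a *: x)].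

Definition simple_module (A : pzRingType) (M : lmodType A) : Prop :=
  (exists x : M, x != 0) /\
  forall P : M -> Prop, is_submodule P ->
    (forall x, P x -> x = 0) \/ (forall x, P x).

Definition module_iso (A : pzRingType) (M N : lmodType A) : Prop :=
  exists f : {linear M -> N}, bijective f.

(* [M] has dimension [n] over [k], where [k] acts through the algebra [A]. *)
Definition kdim (k : pzRingType) (A : lalgType k) (M : lmodType A) (n : nat) :=
  exists f : {additive M -> 'rV[k]_n},
    bijective f /\ forall (c : k) x, f (c%:A *: x) = c *: f x.

Definition annihilated (A : pzRingType) (N : A -> Prop) (M : lmodType A) :=
  forall a, N a -> forall x : M, a *: x = 0.

Section QuotientModule.
Variables (A : pzRingType) (M : lmodType A) (S : M -> Prop).
Hypothesis subS : is_submodule S.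

Definition submod_pred of is_submodule S : {pred M} := fun x => `[< S x >].

Lemma submod_predP x : reflect (S x) (x \in submod_pred subS).
Proof. exact: asboolP. Qed.

Lemma submod_pred_closed : zmod_closed (submod_pred subS).
Proof.
have [S0 SD SZ] := subS.
split=> [|x y /submod_predP Sx /submod_predP Sy]; apply/submod_predP => //.
by apply: SD => //; rewrite -scaleN1r; apply: SZ.
Qed.

HB.instance Definition _ :=
  GRing.isZmodClosed.Build M (submod_pred subS) submod_pred_closed.

Definition quotmod : Type := Quotient.quot (submod_pred subS).
Definition quotmod_class (x : M) : quotmod :=
  \pi_(Quotient.quot (submod_pred subS)) x.

HB.instance Definition _ := GRing.Zmodule.on quotmod.

Lemma quotmod_classP x y : quotmod_class x = quotmod_class y <-> S (x - y).
Proof.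
split=> [/eqP|/submod_predP Sxy].
  by rewrite -Quotient.idealrBE => /submod_predP.
by apply/eqP; rewrite -Quotient.idealrBE.
Qed.

Lemma quotmod_classK (x : quotmod) : quotmod_class (repr x) = x.
Proof. exact: reprK. Qed.

Lemma quotmod_class0 : quotmod_class 0 = 0.
Proof. exact: (raddf0 (\pi_(Quotient.quot (submod_pred subS)))). Qed.

Lemma quotmod_classD : {morph quotmod_class : x y / x + y}.
Proof. exact: (raddfD (\pi_(Quotient.quot (submod_pred subS)))). Qed.

Definition quotmod_scale (a : A) (x : quotmod) : quotmod :=
  quotmod_class (a *: repr x).

Lemma quotmod_classZ a x :
  quotmod_scale a (quotmod_class x) = quotmod_class (a *: x).
Proof.
have [_ _ SZ] := subS; apply/quotmod_classP; rewrite -scalerBr.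
by apply/SZ/quotmod_classP; rewrite quotmod_classK.
Qed.

Lemma quotmod_scaleA a b x :
  quotmod_scale a (quotmod_scale b x) = quotmod_scale (a * b) x.
Proof. by rewrite -[x]quotmod_classK !quotmod_classZ scalerA. Qed.

Lemma quotmod_scale1 : left_id 1 quotmod_scale.
Proof. by move=> x; rewrite -[x]quotmod_classK quotmod_classZ scale1r. Qed.

Lemma quotmod_scaleDr : right_distributive quotmod_scale +%R.
Proof.
move=> a x y; rewrite -[x]quotmod_classK -[y]quotmod_classK.
by rewrite -quotmod_classD !quotmod_classZ -quotmod_classD scalerDr.
Qed.

Lemma quotmod_scaleDl x : {morph quotmod_scale^~ x : a b / a + b}.
Proof.
move=> a b; rewrite -[x]quotmod_classK.
by rewrite !quotmod_classZ -quotmod_classD scalerDl.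
Qed.

HB.instance Definition _ := GRing.Zmodule_isLmodule.Build A quotmod
  quotmod_scaleA quotmod_scale1 quotmod_scaleDr quotmod_scaleDl.

End QuotientModule.

Section RestrictionOfScalars.
Variables (A B : pzRingType) (f : {rmorphism A -> B}) (M : lmodType B).

Definition restr of {rmorphism A -> B} : Type := M.

HB.instance Definition _ := GRing.Zmodule.on (restr f).

Definition restr_scale (a : A) (x : restr f) : restr f := f a *: (x : M).

Lemma restr_scaleA a b x :
  restr_scale a (restr_scale b x) = restr_scale (a * b) x.
Proof. by rewrite /restr_scale rmorphM scalerA. Qed.

Lemma restr_scale1 : left_id 1 restr_scale.
Proof. by move=> x; rewrite /restr_scale rmorph1 scale1r. Qed.

Lemma restr_scaleDr : right_distributive restr_scale +%R.
Proof. by move=> a x y; rewrite /restr_scale scalerDr. Qed.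

Lemma restr_scaleDl x : {morph restr_scale^~ x : a b / a + b}.
Proof. by move=> a b; rewrite /restr_scale rmorphD scalerDl. Qed.

HB.instance Definition _ := GRing.Zmodule_isLmodule.Build A (restr f)
  restr_scaleA restr_scale1 restr_scaleDr restr_scaleDl.

End RestrictionOfScalars.

Definition two_sided_ideal (A : pzRingType) (I : A -> Prop) : Prop :=
  [/\ I 0, forall x y, I x -> I y -> I (x - y),
      forall a x, I x -> I (a * x) & forall a x, I x -> I (x * a)].

Definition ideal_gen (A : pzRingType) (S : A -> Prop) (x : A) : Prop :=
  forall I : A -> Prop, two_sided_ideal I -> (forall s, S s -> I s) -> I x.

Lemma ideal_gen_ideal (A : pzRingType) (S : A -> Prop) :
  two_sided_ideal (ideal_gen S).
Proof.
split=> [I [] //|x y Ix Iy|a x Ix|a x Ix] I HI HS; have [_ IB Il Ir] := HI.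
- by apply: IB; [apply: Ix|apply: Iy].
- by apply: Il; apply: Ix.
- by apply: Ir; apply: Ix.
Qed.

Section QuotientAlgebra.
Variables (k : pzRingType) (A : algType k) (S : A -> Prop).

Lemma ideal_gen_submodule : is_submodule (ideal_gen S : A -> Prop).
Proof.
have [I0 IB Il _] := ideal_gen_ideal S; split=> [|x y Ix Iy|c x Ix].
- exact: I0.
- rewrite -[y]opprK -[- y]sub0r; apply: (IB _ _ Ix).
  exact: (IB _ _ I0 Iy).
- by rewrite -[x]mul1r scalerAl; apply: Il.
Qed.

Definition quotalg : Type := quotmod ideal_gen_submodule.
Definition quot_class : A -> quotalg := @quotmod_class k A _ ideal_gen_submodule.

HB.instance Definition _ := GRing.Lmodule.on quotalg.

Lemma quot_classP x y : quot_class x = quot_class y <-> ideal_gen S (x - y).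
Proof. exact: quotmod_classP. Qed.

Lemma quot_classK (x : quotalg) : quot_class (repr x) = x.
Proof. exact: quotmod_classK. Qed.

Definition quot_mul (x y : quotalg) : quotalg := quot_class (repr x * repr y).

Lemma quot_classM x y :
  quot_mul (quot_class x) (quot_class y) = quot_class (x * y).
Proof.
have repr_class z : ideal_gen S (repr (quot_class z) - z).
  by apply/quot_classP; rewrite quot_classK.
have [_ ID _] := ideal_gen_submodule; have [_ _ Il Ir] := ideal_gen_ideal S.
apply/quot_classP; set x' := repr _; set y' := repr _.
have -> : x' * y' - x * y = x' * (y' - y) + (x' - x) * y.
  by rewrite mulrBr mulrBl addrA subrK.
by apply: ID; [apply: Il|apply: Ir]; apply: repr_class.
Qed.

Lemma quot_mulA : associative quot_mul.
Proof.
move=> x y z; rewrite -[x]quot_classK -[y]quot_classK -[z]quot_classK.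
by rewrite !quot_classM mulrA.
Qed.

Lemma quot_mul1 : left_id (quot_class 1) quot_mul.
Proof. by move=> x; rewrite -[x]quot_classK quot_classM mul1r. Qed.

Lemma quot_mulr1 : right_id (quot_class 1) quot_mul.
Proof. by move=> x; rewrite -[x]quot_classK quot_classM mulr1. Qed.

Lemma quot_mulDl : left_distributive quot_mul +%R.
Proof.
move=> x y z; rewrite -[x]quot_classK -[y]quot_classK -[z]quot_classK.
by rewrite !(quot_classM, =^~ quotmod_classD) mulrDl.
Qed.

Lemma quot_mulDr : right_distributive quot_mul +%R.
Proof.
move=> x y z; rewrite -[x]quot_classK -[y]quot_classK -[z]quot_classK.
by rewrite !(quot_classM, =^~ quotmod_classD) mulrDr.
Qed.

HB.instance Definition _ := GRing.Zmodule_isPzRing.Build quotalg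
  quot_mulA quot_mul1 quot_mulr1 quot_mulDl quot_mulDr.

Lemma quot_class_mulr x y :
  quot_class x * quot_class y = quot_class (x * y).
Proof. exact: quot_classM. Qed.

Lemma quot_class_scale (c : k) x : c *: quot_class x = quot_class (c *: x).
Proof. exact: quotmod_classZ. Qed.

Lemma quot_scaleAl (c : k) (x y : quotalg) : c *: (x * y) = (c *: x) * y.
Proof.
rewrite -[x]quot_classK -[y]quot_classK.
by rewrite !(quot_class_mulr, quot_class_scale) scalerAl.
Qed.

Lemma quot_scaleAr (c : k) (x y : quotalg) : c *: (x * y) = x * (c *: y).
Proof.
rewrite -[x]quot_classK -[y]quot_classK.
by rewrite !(quot_class_mulr, quot_class_scale) scalerAr.
Qed.

End QuotientAlgebra.

Section FreeAlgebra.
Variables (k : fieldType) (I : choiceType).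

Definition freealg : Type := {malg k[{fmonom I}]}.

HB.instance Definition _ := GRing.Lalgebra.on freealg.

Lemma freealg_scaleAr (c : k) (x y : freealg) : c *: (x * y) = x * (c *: y).
Proof.
have cC (z : freealg) : z * c%:MP = c%:MP * z.
  rewrite !malgM_def fgmulgU fgmulUg; apply: eq_bigr => m _.
  by rewrite mulrC mulm1 mul1m.
by rewrite -!mul_malgC mulrA -cC mulrA.
Qed.

HB.instance Definition _ :=
  GRing.Lalgebra_isAlgebra.Build k freealg freealg_scaleAr.

Definition free_gen (i : I) : freealg := << fmu i >>.

Definition fmonom_eval (v : I -> k) (m : {fmonom I}) : k := \prod_(i <- m) v i.

Lemma fmonom_eval_morph v : mmorphism (fmonom_eval v).
Proof.
split=> [x y|]; rewrite /fmonom_eval; first by rewrite fmM big_cat.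
by rewrite fm1 big_nil.
Qed.

HB.instance Definition _ v :=
  isMultiplicative.Build {fmonom I} k (fmonom_eval v) (fmonom_eval_morph v).

Definition free_eval (v : I -> k) : {rmorphism {malg k[{fmonom I}]} -> k} :=
  mmap idfun (fmonom_eval v).

Lemma free_evalU v i : free_eval v (free_gen i) = v i.
Proof.
by rewrite /free_eval/= mmapU /= mul1r /fmonom_eval fmU big_seq1.
Qed.

Lemma free_evalZ v c (x : freealg) : free_eval v (c *: x) = c * free_eval v x.
Proof. by rewrite /free_eval/= mmapZ. Qed.

End FreeAlgebra.

Section BMW.
Variables (k : fieldType) (q : k) (r : nat).

(* Indices are shifted by one: the generators g_1, ..., g_(r-1) of the usual
   presentation are indexed here by 0, ..., r-2. *)
Definition bmw_letter : choiceType := ('I_r.-1 + 'I_r.-1 + 'I_r.-1)%type.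

Definition bmw_free : algType k := freealg k bmw_letter.

Definition free_g (i : 'I_r.-1) : bmw_free :=
  free_gen k (inl (inl i) : bmw_letter).
Definition free_gi (i : 'I_r.-1) : bmw_free :=
  free_gen k (inl (inr i) : bmw_letter).
Definition free_e (i : 'I_r.-1) : bmw_free := free_gen k (inr i : bmw_letter).

Local Notation G := free_g.
Local Notation G' := free_gi.
Local Notation E := free_e.

(* Each element listed is to be set equal to zero. *)
Inductive bmw_rel : bmw_free -> Prop :=
| Rel_inv_r (i : 'I_r.-1) : bmw_rel (G i * G' i - 1)
| Rel_inv_l (i : 'I_r.-1) : bmw_rel (G' i * G i - 1)
| Rel_far (i j : 'I_r.-1) : (i.+1 < j)%N || (j.+1 < i)%N ->
    bmw_rel (G i * G j - G j * G i)
| Rel_braid (i j : 'I_r.-1) : j = i.+1 :> nat ->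
    bmw_rel (G i * G j * G i - G j * G i * G j)
| Rel_skein (i : 'I_r.-1) : bmw_rel (G i - G' i - (q ^+ 2 - q ^- 2) *: (1 - E i))
| Rel_ge (i : 'I_r.-1) : bmw_rel (G i * E i - q ^- 4 *: E i)
| Rel_eg (i : 'I_r.-1) : bmw_rel (E i * G i - q ^- 4 *: E i)
| Rel_ege_up (i j : 'I_r.-1) : j = i.+1 :> nat ->
    bmw_rel (E i * G j * E i - q ^+ 4 *: E i)
| Rel_eg'e_up (i j : 'I_r.-1) : j = i.+1 :> nat ->
    bmw_rel (E i * G' j * E i - q ^- 4 *: E i)
| Rel_ege_dn (i j : 'I_r.-1) : i = j.+1 :> nat ->
    bmw_rel (E i * G j * E i - q ^+ 4 *: E i)
| Rel_eg'e_dn (i j : 'I_r.-1) : i = j.+1 :> nat ->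
    bmw_rel (E i * G' j * E i - q ^- 4 *: E i).

Definition BMW : Type := quotalg bmw_rel.

Definition bmw_g (i : 'I_r.-1) : BMW := quot_class bmw_rel (G i).
Definition bmw_gi (i : 'I_r.-1) : BMW := quot_class bmw_rel (G' i).
Definition bmw_e (i : 'I_r.-1) : BMW := quot_class bmw_rel (E i).

HB.instance Definition _ := GRing.PzRing.on BMW.
HB.instance Definition _ := GRing.Lmodule.on BMW.

(* The one-dimensional representation g_i |-> q^2, e_i |-> 0 shows that the
   algebra is nonzero; for q = 0, which is of no interest, the library
   convention 0^-1 = 0 calls for g_i |-> 1 instead. *)
Definition bmw_aug_g : k := if q == 0 then 1 else q ^+ 2.
Definition bmw_aug : {rmorphism {malg k[{fmonom bmw_letter}]} -> k} :=
  free_eval (fun x : bmw_letter => match x with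
    | inl (inl _) => bmw_aug_g | inl (inr _) => bmw_aug_g^-1 | inr _ => 0 end).

Lemma bmw_rel_aug x : bmw_rel x -> bmw_aug x = 0.
Proof.
have s0 : bmw_aug_g != 0.
  by rewrite /bmw_aug_g; case: (eqVneq q 0) => [_|q0]; rewrite ?oner_eq0 ?expf_neq0.
have sk : bmw_aug_g - bmw_aug_g^-1 = q ^+ 2 - q ^- 2.
  rewrite /bmw_aug_g; case: (eqVneq q 0) => [->|//].
  by rewrite expr0n invr1 invr0 !subrr.
case=> *; rewrite !(rmorphB bmw_aug, rmorphM bmw_aug, rmorph1 bmw_aug,
  free_evalZ, free_evalU) /= ?(mul0r, mulr0, subr0, subrr, mulr1) //.
- by rewrite divff ?subrr.
- by rewrite mulVf ?subrr.
- by rewrite sk subrr.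
Qed.

Lemma bmw_one_neq0 : (1 : BMW) != 0.
Proof.
have augI : two_sided_ideal (fun x : bmw_free => bmw_aug x = 0).
  split=> [|x y x0 y0|a x x0|a x x0].
  - exact: (rmorph0 bmw_aug).
  - by rewrite (rmorphB bmw_aug) x0 y0 subrr.
  - by rewrite (rmorphM bmw_aug) x0 mulr0.
  - by rewrite (rmorphM bmw_aug) x0 mul0r.
apply/eqP => one0.
have /quot_classP : quot_class bmw_rel 1 = quot_class bmw_rel 0.
  by rewrite [RHS]quotmod_class0.
rewrite subr0 => /(_ _ augI bmw_rel_aug) /eqP.
by rewrite (rmorph1 bmw_aug) oner_eq0.
Qed.

HB.instance Definition _ := GRing.PzSemiRing_isNonZero.Build BMW bmw_one_neq0.
HB.instance Definition _ := GRing.Lmodule_isLalgebra.Build k BMW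
  (@quot_scaleAl k bmw_free bmw_rel).
HB.instance Definition _ := GRing.Lalgebra_isAlgebra.Build k BMW
  (@quot_scaleAr k bmw_free bmw_rel).

End BMW.

(* Gaussian binomials symmetric under q <-> q^-1: the specialization at q of
   the Laurent polynomial [n choose t]_v, computed by its Pascal rule so that
   no division occurs. *)
Fixpoint qbin (k : fieldType) (q : k) (n t : nat) : k :=
  match n, t with
  | _, 0%N => 1
  | 0%N, _.+1 => 0
  | n'.+1, t'.+1 => q ^+ t'.+1 * qbin q n' t'.+1 + q ^- (n' - t') * qbin q n' t'
  end.

(* The same for an integer upper argument: [-n choose t] =
   (-1)^t [n+t-1 choose t]. *)
Definition qbinz (k : fieldType) (q : k) (m : int) (t : nat) : k :=
  match m with
  | Posz n => qbin q n t
  | Negz n => (-1) ^+ t * qbin q (n + t) t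
  end.

Definition qfact (k : fieldType) (q : k) (n : nat) : k :=
  \prod_(1 <= i < n.+1) qbin q i 1.

(* A finite dimensional U_q-module of type 1 is the direct sum of its weight
   spaces M_m (m an integer), on which K acts as q^m and the Lusztig binomial
   [K; c choose t] as [m + c choose t]_q.  Such a module is described here in a
   basis of weight vectors, by the weights of the basis vectors and the
   matrices, acting on column vectors, of the divided powers E^(n), F^(n).
   The record carries the operators only; [is_Uqmod] below states the defining
   relations of U_q. *)
Record Uqmod (k : fieldType) := MkUqmod {
  udim : nat;
  uwt : 'I_udim -> int;
  uE : nat -> 'M[k]_udim;
  uF : nat -> 'M[k]_udim
}.

Section QuantumSL2.
Variables (k : fieldType) (q : k).
Implicit Types M N P : Uqmod k.

Definition uK M (e : int) : 'M[k]_(udim M) :=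
  diag_mx (\row_i q ^ (e * uwt i)).

Definition uKbin M (c : int) (t : nat) : 'M[k]_(udim M) :=
  diag_mx (\row_i qbinz q (uwt i + c) t).

Definition is_Uqmod M : Prop :=
  [/\ uE M 0 = 1%:M /\ uF M 0 = 1%:M,
      forall n i j, (uE M n i j != 0 -> uwt i = uwt j + (n.*2)%:Z) /\
                    (uF M n i j != 0 -> uwt i = uwt j - (n.*2)%:Z),
      forall a b, uE M a *m uE M b = qbin q (a + b) a *: uE M (a + b),
      forall a b, uF M a *m uF M b = qbin q (a + b) a *: uF M (a + b) &
      forall a b, uE M a *m uF M b =
        \sum_(t < (minn a b).+1)
          uF M (b - t) *m uKbin M ((t.*2)%:Z - a%:Z - b%:Z) t *m uE M (a - t)].

(* [f] is the matrix of a map M -> N acting on column vectors; commutation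
   with all generators K^e, [K; c choose t], E^(n), F^(n) of U_q is asked. *)
Definition is_Uqhom M N (f : 'M[k]_(udim N, udim M)) : Prop :=
  [/\ forall e, f *m uK M e = uK N e *m f,
      forall c t, f *m uKbin M c t = uKbin N c t *m f,
      forall n, f *m uE M n = uE N n *m f &
      forall n, f *m uF M n = uF N n *m f].

Definition Uqiso M N : Prop :=
  exists (f : 'M[k]_(udim N, udim M)) (g : 'M[k]_(udim M, udim N)),
    [/\ is_Uqhom f, is_Uqhom g, g *m f = 1%:M & f *m g = 1%:M].

Definition Uqhom_pred M N : {pred 'M[k]_(udim N, udim M)} :=
  fun f => `[< is_Uqhom f >].
Arguments Uqhom_pred : clear implicits.

Lemma Uqhom_predP M N f : reflect (is_Uqhom f) (f \in Uqhom_pred M N).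
Proof. exact: asboolP. Qed.

Lemma Uqhom_pred_closed M N : subsemimod_closed (Uqhom_pred M N).
Proof.
split=> [|c f /Uqhom_predP[fK fb fE fF]]; last first.
  by apply/Uqhom_predP; split=> *;
    rewrite -scalemxAl -scalemxAr ?fK ?fb ?fE ?fF.
split=> [|f g /Uqhom_predP[fK fb fE fF] /Uqhom_predP[gK gb gE gF]];
  apply/Uqhom_predP; split=> *; rewrite ?mul0mx ?mulmx0 //;
  by rewrite mulmxDl mulmxDr ?fK ?fb ?fE ?fF ?gK ?gb ?gE ?gF.
Qed.

HB.instance Definition _ M N :=
  GRing.isSubmodClosed.Build k _ (Uqhom_pred M N) (@Uqhom_pred_closed M N).

Definition Uqhom M N : Type := {f : 'M[k]_(udim N, udim M) | f \in Uqhom_pred M N}.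

HB.instance Definition _ M N := SubType.on (Uqhom M N).
HB.instance Definition _ M N := [Choice of Uqhom M N by <:].
HB.instance Definition _ M N :=
  [SubChoice_isSubLmodule of Uqhom M N by <:].

Lemma Uqcomp_subproof M N P (g : Uqhom N P) (f : Uqhom M N) :
  val g *m val f \in Uqhom_pred M P.
Proof.
case: g f => [g /= /Uqhom_predP[gK gb gE gF]] [f /= /Uqhom_predP[fK fb fE fF]].
apply/Uqhom_predP; split=> *.
- by rewrite -mulmxA fK mulmxA gK mulmxA.
- by rewrite -mulmxA fb mulmxA gb mulmxA.
- by rewrite -mulmxA fE mulmxA gE mulmxA.
- by rewrite -mulmxA fF mulmxA gF mulmxA.
Qed.

Definition Uqcomp M N P (g : Uqhom N P) (f : Uqhom M N) : Uqhom M P :=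
  Sub (val g *m val f) (Uqcomp_subproof g f).

Lemma Uqid_subproof M : 1%:M \in Uqhom_pred M M.
Proof. by apply/Uqhom_predP; split=> *; rewrite mul1mx mulmx1. Qed.

Definition Uqid M : Uqhom M M := Sub 1%:M (Uqid_subproof M).

Lemma UqcompA M N P Q (h : Uqhom P Q) (g : Uqhom N P) (f : Uqhom M N) :
  Uqcomp h (Uqcomp g f) = Uqcomp (Uqcomp h g) f.
Proof. by apply: val_inj; rewrite /= mulmxA. Qed.

Lemma Uqcomp1f M N (f : Uqhom M N) : Uqcomp (Uqid N) f = f.
Proof. by apply: val_inj; rewrite /= mul1mx. Qed.

Lemma Uqcompf1 M N (f : Uqhom M N) : Uqcomp f (Uqid M) = f.
Proof. by apply: val_inj; rewrite /= mulmx1. Qed.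

Lemma UqcompDl M N P (g h : Uqhom N P) (f : Uqhom M N) :
  Uqcomp (g + h) f = Uqcomp g f + Uqcomp h f.
Proof. by apply: val_inj; rewrite /= mulmxDl. Qed.

Lemma UqcompDr M N P (g : Uqhom N P) (f h : Uqhom M N) :
  Uqcomp g (f + h) = Uqcomp g f + Uqcomp g h.
Proof. by apply: val_inj; rewrite /= mulmxDr. Qed.

Definition Uqend M : Type := Uqhom M M.

HB.instance Definition _ M := GRing.Lmodule.on (Uqend M).
HB.instance Definition _ M := GRing.Zmodule_isPzRing.Build (Uqend M)
  (@UqcompA M M M M) (@Uqcomp1f M M) (@Uqcompf1 M M)
  (fun f g h => UqcompDl f g h) (fun f g h => UqcompDr f g h).

(* Alias carrying the left action of End(N) by composition instead of k. *)
Definition Uqhoml M N : Type := Uqhom M N.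

HB.instance Definition _ M N := GRing.Zmodule.on (Uqhoml M N).
HB.instance Definition _ M N :=
  GRing.Zmodule_isLmodule.Build (Uqend N) (Uqhoml M N)
    (@UqcompA M N N N) (@Uqcomp1f M N) (fun f g h => UqcompDr f g h)
    (fun f g h => UqcompDl g h f).

(* Basis v_0, ..., v_m with v_i = F^(i) v_0 of weight m - 2i. *)
Definition weyl (m : nat) : Uqmod k := MkUqmod
  (fun i : 'I_m.+1 => m%:Z - (i.*2)%:Z)
  (fun n => \matrix_(i, j) if j == (i + n)%N :> nat then qbin q (m - i) n else 0)
  (fun n => \matrix_(i, j) if i == (j + n)%N :> nat then qbin q i n else 0).

(* Coproduct convention: K |-> K (x) K, E |-> E (x) 1 + K (x) E,
   F |-> F (x) K^-1 + 1 (x) F.  Hence the antipode sends E to - K^-1 E and F to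
   - F K, and the formulas below for divided powers. *)
Definition udual M : Uqmod k := MkUqmod
  (fun i => - @uwt k M i)
  (fun n => (((-1) ^+ n * q ^+ (n * n.-1)) *: (uK M (- n%:Z) *m uE M n))^T)
  (fun n => (((-1) ^+ n * q ^- (n * n.-1)) *: (uF M n *m uK M n%:Z))^T).

Definition utens M N : Uqmod k := MkUqmod
  (fun i => @uwt k M (mxtens_unindex i).1 + @uwt k N (mxtens_unindex i).2)
  (fun n => \sum_(i < n.+1) q ^+ (i * (n - i)) *:
     ((uE M (n - i) *m uK M i%:Z) *t uE N i))
  (fun n => \sum_(i < n.+1) q ^+ (i * (n - i)) *:
     (uF M i *t (uF N (n - i) *m uK N (- i%:Z)))).

Definition uzero : Uqmod k :=
  MkUqmod (fun _ : 'I_0 => 0) (fun _ => 0) (fun _ => 0).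

Definition usum M N : Uqmod k := MkUqmod
  (fun i => match split i with inl a => @uwt k M a | inr b => @uwt k N b end)
  (fun n => block_mx (uE M n) 0 0 (uE N n))
  (fun n => block_mx (uF M n) 0 0 (uF N n)).

Fixpoint utens_pow M (r : nat) : Uqmod k :=
  if r is r'.+1 then utens M (utens_pow M r') else weyl 0.

Fixpoint usum_pow M (c : nat) : Uqmod k :=
  if c is c'.+1 then usum M (usum_pow M c') else uzero.

Definition coweyl (m : nat) : Uqmod k := udual (weyl m).

(* Exact sequences 0 -> M' -> M -> Delta(m) -> 0 *)
Inductive weyl_filtered : Uqmod k -> Prop :=
| WeylFiltered0 M : is_Uqmod M -> udim M = 0 -> weyl_filtered M
| WeylFilteredS M' M m
    (f : 'M[k]_(udim M, udim M')) (g : 'M[k]_(udim (weyl m), udim M)) :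
    weyl_filtered M' -> is_Uqmod M -> is_Uqhom f -> is_Uqhom g ->
    \rank f = udim M' -> \rank g = udim (weyl m) ->
    g *m f = 0 -> udim M = (udim M' + udim (weyl m))%N ->
    weyl_filtered M.

Definition tilting M : Prop := weyl_filtered M /\ weyl_filtered (udual M).

Definition indecomposable M : Prop :=
  [/\ is_Uqmod M, (0 < udim M)%N &
      forall N P, is_Uqmod N -> is_Uqmod P -> Uqiso M (usum N P) ->
        udim N = 0 \/ udim P = 0].

Definition highest_weight M (m : nat) : Prop :=
  (exists i : 'I_(udim M), uwt i = m%:Z) /\
  (forall i : 'I_(udim M), uwt i <= m%:Z).

(* [T] is (isomorphic to) T_q(m). *)
Definition is_Tq (m : nat) (T : Uqmod k) : Prop :=
  [/\ indecomposable T, tilting T & highest_weight T m].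

(* The multiplicity of T as a direct summand of M: the largest c such that
   the direct sum of c copies of T is a direct summand of M (for T <> 0 one
   has c <= dim M, which bounds the search). *)
Definition summand_mult M T : nat :=
  \max_(c < (udim M).+1 |
    `[< exists X, is_Uqmod X /\ Uqiso M (usum (usum_pow T c) X) >]) c.

Definition Vq : Uqmod k := weyl 1.
Definition Wq : Uqmod k := weyl 2.
Definition Wpow (r : nat) : Uqmod k := utens_pow Wq r.

(* The R-matrix W (x) W -> W (x) W: the quasi-R-matrix
   sum_n q^(n(n-1)/2) (q - q^-1)^n [n]! F^(n) (x) E^(n), followed by
   q^(wt wt'/2) (the weights of W are even) and by the flip.  It is normalized
   by its eigenvalue q^2 on the tensor square of a highest weight vector. *)
Definition Rmat : 'M[k]_(udim Wq * udim Wq) :=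
  (\matrix_(i, j) ((mxtens_unindex i) ==
                   ((mxtens_unindex j).2, (mxtens_unindex j).1))%:R)
  *m diag_mx (\row_i q ^ ((@uwt k Wq (mxtens_unindex i).1 *
                           @uwt k Wq (mxtens_unindex i).2) %/ 2)%Z)
  *m \sum_(n < 3) (q ^+ 'C(n, 2) * (q - q^-1) ^+ n * qfact q n) *:
       (uF Wq n *t uE Wq n).

(* The R-matrix on the tensor factors i and i+1 of W^(x)r, the factors being
   numbered from 0. *)
Fixpoint Ract (r i : nat) : 'M[k]_(udim (Wpow r)) :=
  match r, i with
  | 0%N, _ => 1%:M
  | r'.+1, i'.+1 => (1%:M : 'M_(udim Wq)) *t Ract r' i'
  | r'.+1, 0%N =>
      match r' return 'M_(udim Wq * udim (Wpow r')) with
      | 0%N => 1%:M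
      | r''.+1 =>
          let e := esym (mulnA (udim Wq) (udim Wq) (udim (Wpow r''))) in
          castmx (e, e) (Rmat *t (1%:M : 'M_(udim (Wpow r''))))
      end
  end.

Definition Eq_W (r : nat) : Type := Uqend (Wpow r).
HB.instance Definition _ r := GRing.PzRing.on (Eq_W r).
HB.instance Definition _ r := GRing.Lmodule.on (Eq_W r).

Definition C_W (r s : nat) : lmodType (Eq_W r) := Uqhoml (weyl s) (Wpow r).

Definition C_W_rad (r s : nat) (f : C_W r s) : Prop :=
  forall h : Uqhom (Wpow r) (coweyl s), Uqcomp h f = 0.

Lemma C_W_rad_submodule r s : is_submodule (@C_W_rad r s).
Proof.
split=> [h|f g f0 g0 h|a f f0 h].
- by apply: val_inj; rewrite /= mulmx0.
- by rewrite UqcompDr f0 g0 addr0.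
- by rewrite [LHS]UqcompA f0.
Qed.

Definition L_W (r s : nat) : lmodType (Eq_W r) :=
  quotmod (@C_W_rad_submodule r s).

Definition L_BMW (r s : nat) (phi : {rmorphism BMW q r -> Eq_W r}) :
  lmodType (BMW q r) := restr (L_W r s) phi.

End QuantumSL2.

(* Main.v *)
Require Import Defs.
From HB Require Import structures.
From mathcomp Require Import all_boot all_order all_algebra.
From mathcomp Require Import boolp mxtens monalg.
From mathcomp Require Import zify ring.

Set Implicit Arguments.
Unset Strict Implicit.
Unset Printing Implicit Defensive.

Import Order.TTheory GRing.Theory Num.Theory.
Local Open Scope ring_scope.

(** Write V and W for the modules Delta(1) and Delta(2), V^s for a tensor
    power, and X for the r-th tensor power of W. The proof handles the modules
    X, their duals and the tilting modules through two properties of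
    homomorphisms from tensor powers of V: a highest weight vector of weight
    s >= 0 is the image of the highest weight vector of V^s under some
    homomorphism ([hwv_extend]), and a homomorphism from V^s that kills the
    highest weight vector is a sum of maps factoring through V^(s-2)
    ([kill_vtop_thru]).

    Both are proved by moving one factor V at a time to the target, V being
    its own dual. What has to be solved on the way is a system E^(n) y = x_n,
    n >= 1, for y of weight p >= -1, where the x_n satisfy the relations of
    the divided powers; the obstruction is a first cohomology group of the
    positive part. Its vanishing passes from a module to its tensor product
    with V ([H1_VX]): solve for the lower component, then for the upper one.
    The second step lowers p by one, but in weight -1 an explicit solution
    exists in every module ([H1_m1]). It passes to direct summands, hence to
    tensor powers of W, since V (x) V = W (+) 1 when [2] <> 0 ([bip_VV]), and
    it holds for modules whose dual has a Weyl filtration, hence for tilting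
    modules ([tilting_biunobstructed]).

    Dimensions. The module L_W^r(s) is the space of highest weight vectors of
    X of weight s modulo those orthogonal to all highest weight functionals,
    so its dimension is the rank of a pairing ([L_kdim]). The same rank counts
    the summands T_q(s) of X: vectors and functionals extend to maps T -> X
    and X -> T, and a composite T -> X -> T that does not kill the highest
    weight is invertible by Fitting's lemma, so that T splits off as long as
    the pairing is nonzero ([summand_mult_pairing_rank]). Finally
    V (x) V = W (+) 1 gives a recursion for the ranks of W^i (x) V^2j, solved
    by binomial inversion ([pairing_rank_Wpow]).

    Simple modules. Let f, g be in C_W^r(s), with f outside the radical.
    Extending a functional and the vector of g to maps X -> V^s -> X gives an
    endomorphism taking f to g ([transport]); hence L_W^r(s) is simple. Such
    an endomorphism kills L_W^r(s') for s' > s by weights, which separates the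
    L_W^r(s) from one another. Conversely let M be simple. As X is a retract
    of V^2r there is a least m such that some endomorphism X -> V^2m -> X, say
    g0 h0, acts on M as nonzero, say on u. Send f in C_W^r(2m) to d h0 u,
    where d : V^2m -> X extends the highest weight vector of f: this does not
    depend on d, because the difference of two choices factors through
    V^(2m-2) and acts as zero by minimality. It is a homomorphism from
    C_W^r(2m) onto M whose kernel is the radical ([complete]). *)

(** * Quantum binomials *)

Section QBinomials.
Variables (k : fieldType) (q : k).
Hypothesis q0 : q != 0.

Lemma qbin0 n : qbin q n 0 = 1. Proof. by case: n. Qed.

Lemma qbin_small n t : (n < t)%N -> qbin q n t = 0.
Proof.
elim: n t => [|n IHn] [|t] //= ltnt.
by rewrite !IHn ?mulr0 ?addr0 //; lia.
Qed.

Lemma qbinnn n : qbin q n n = 1.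
Proof.
by elim: n => //= n IHn; rewrite qbin_small // IHn subnn mulr0 add0r expr0 invr1 mul1r.
Qed.

Lemma qbin_pascal n t :
  qbin q n.+1 t.+1 = q ^ (t.+1)%:Z * qbin q n t.+1 + q ^ (t%:Z - n%:Z) * qbin q n t.
Proof.
rewrite /=; case: (leqP t n) => [le_tn|lt_nt].
  have -> : t%:Z - n%:Z = - (n - t)%:Z by lia.
  by rewrite -exprnP exprnN.
by rewrite !(@qbin_small n) ?mulr0 //; lia.
Qed.

#[local] Arguments qbin : simpl never.
#[local] Arguments qbinz : simpl never.

Lemma qexpD a b : q ^ (a + b) = q ^ a * q ^ b.
Proof. exact: expfzDr. Qed.

Lemma qexpN a : q ^ (- a) = (q ^ a)^-1.
Proof. by rewrite -invr_expz. Qed.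

Lemma qexp_neq0 a : q ^ a != 0. Proof. exact: expfz_neq0. Qed.

(** The Pascal rule and its mirror image under q <-> q^-1 differ by the
    absorption identity; the latter is then proved by induction with the help
    of the former two. *)
Lemma qbin_pascal_absorb n t :
  (q ^ (t.+1)%:Z - q ^ (- (t.+1)%:Z)) * qbin q n t.+1 =
  (q ^ (n%:Z - t%:Z) - q ^ (t%:Z - n%:Z)) * qbin q n t ->
  qbin q n.+1 t.+1 = q ^ (- (t.+1)%:Z) * qbin q n t.+1 + q ^ (n%:Z - t%:Z) * qbin q n t.
Proof.
rewrite !mulrBl => E; rewrite qbin_pascal; apply/eqP; rewrite -subr_eq0.
move/eqP: E; rewrite -subr_eq0 => /eqP E; apply/eqP; rewrite -[RHS]E; ring.
Qed.

Lemma qbin_absorb n t :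
  (q ^ (t.+1)%:Z - q ^ (- (t.+1)%:Z)) * qbin q n t.+1 =
  (q ^ (n%:Z - t%:Z) - q ^ (t%:Z - n%:Z)) * qbin q n t.
Proof.
elim: n t => [|n IHn] t.
  by case: t => [|t]; rewrite ?qbin0 ?subrr ?(@qbin_small 0) ?mulr0 ?mul0r.
have -> : (q ^ (t.+1)%:Z - q ^ (- t.+1%:Z)) * qbin q n.+1 t.+1 =
          (q ^ n.+1%:Z - q ^ (- n.+1%:Z)) * qbin q n t.
  rewrite qbin_pascal mulrDr mulrCA IHn !intS !(qexpD, qexpN) expr1z; field.
  by rewrite q0 !qexp_neq0.
case: t => [|t].
  by rewrite !qbin0 subr0 sub0r.
rewrite (qbin_pascal_absorb (IHn t)) mulrDr [in RHS]mulrCA.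
have -> : n.+1%:Z - t.+1%:Z = n%:Z - t%:Z by lia.
have -> : t.+1%:Z - n.+1%:Z = t%:Z - n%:Z by lia.
rewrite [X in _ = _ + X]mulrCA -IHn.
rewrite !intS !(qexpD, qexpN) expr1z; field.
by rewrite q0 !qexp_neq0.
Qed.

Lemma qbin_pascal2 n t :
  qbin q n.+1 t.+1 = q ^ (- (t.+1)%:Z) * qbin q n t.+1 + q ^ (n%:Z - t%:Z) * qbin q n t.
Proof. exact/qbin_pascal_absorb/qbin_absorb. Qed.

Lemma qbinz0 N : qbinz q N 0 = 1.
Proof. by case: N => n; rewrite /qbinz qbin0 ?mulr1. Qed.

Lemma qbinzN n t : qbinz q (Negz n) t = (-1) ^+ t * qbin q (n + t) t.
Proof. by []. Qed.

Lemma qbinz_pascal (N : int) t :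
  qbinz q (N + 1) t.+1 =
  q ^ t.+1%:Z * qbinz q N t.+1 + q ^ (t%:Z - N) * qbinz q N t.
Proof.
case: N => n.
  have -> : Posz n + 1 = n.+1 by lia.
  exact: qbin_pascal.
case: n => [|n].
  rewrite (_ : Negz 0 + 1 = 0) //.
  have -> : t%:Z - Negz 0 = t.+1%:Z by lia.
  by rewrite [LHS](_ : _ = 0) // !qbinzN !add0n !qbinnn exprS /=; ring.
have -> : Negz n.+1 + 1 = Negz n by lia.
rewrite !qbinzN.
rewrite addnS addSn [qbin q (n + t.+1).+1 _]qbin_pascal2 addnS.
have -> : t%:Z - Negz n.+1 = n.+1%:Z + t.+1%:Z by lia.
rewrite addSn [(n + t).+1%:Z]intS PoszD !intS !(qexpD, qexpN) expr1z exprS; field.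
by rewrite q0 !qexp_neq0.
Qed.

(** The number (-1)^t [-A choose t], that is the complete homogeneous
    symmetric polynomial of degree t at q^(A-1), q^(A-3), ..., q^(1-A). *)
Definition qhom A t := if A is A'.+1 then qbin q (A' + t) t else (t == 0%N)%:R.

#[local] Arguments qhom : simpl never.

Lemma qhomS A t :
  qhom A.+1 t.+1 = q ^ t.+1%:Z * qhom A t.+1 + q ^ (- A%:Z) * qhom A.+1 t.
Proof.
rewrite /qhom addnS qbin_pascal; case: A => [|A].
  by rewrite !add0n qbin_small // subrr oppr0 !mulr0.
rewrite -addSnnS.
congr (_ * _ + q ^ _ * _); lia.
Qed.

Lemma qhom0 A : qhom A 0 = 1. Proof. by case: A => // A; exact: qbin0. Qed.

(** The relation between elementary and complete homogeneous symmetric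
    polynomials, at q^(A-1), ..., q^(1-A). Peeling one variable off both at
    once leaves the sum unchanged up to a power of q. *)
Lemma qbin_convol A a : (0 < a)%N ->
  \sum_(t < a.+1) (-1) ^+ t * qhom A t * qbin q A (a - t) = 0.
Proof.
have sumS B b : \sum_(t < b.+2) (-1) ^+ t * qhom B.+1 t * qbin q B.+1 (b.+1 - t) =
  q ^ b.+1%:Z * \sum_(t < b.+2) (-1) ^+ t * qhom B t * qbin q B (b.+1 - t).
  have E : \sum_(t < b.+2) (-1) ^+ t * qhom B.+1 t * qbin q B.+1 (b.+1 - t) =
    \sum_(t < b.+2) (-1) ^+ t * qhom B.+1 t * (q ^ (b.+1 - t)%N%:Z * qbin q B (b.+1 - t)) +
    \sum_(t < b.+1) (-1) ^+ t * qhom B.+1 t * (q ^ ((b - t)%N%:Z - B%:Z) * qbin q B (b - t)).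
    rewrite [LHS]big_ord_recr [X in _ = X + _]big_ord_recr /= subnn !qbin0 expr0z mul1r [RHS]addrAC; congr (_ + _).
    rewrite -big_split /=; apply: eq_bigr => t _.
    have le_tb : (t <= b)%N by rewrite -ltnS.
    by rewrite subSn // qbin_pascal mulrDr.
  rewrite {}E big_ord_recl -addrA -big_split /= mulr_sumr [RHS]big_ord_recl /=.
  rewrite !qhom0 !mul1r subn0; congr (_ + _); apply: eq_bigr => t _.
  rewrite /bump /= add1n subSS exprS.
  have let_b : (t <= b)%N by rewrite -ltnS.
  rewrite qhomS.
  have -> : b.+1%:Z = t.+1%:Z + (b - t)%N%:Z by lia.
  by rewrite !(qexpD, qexpN); ring.
case: a => // a _; elim: A => [|A IHA].
  by rewrite big_ord_recl big1 => [|t _]; rewrite /= ?mul1r ?mulr0 ?mul0r ?addr0.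
by rewrite sumS IHA mulr0.
Qed.

End QBinomials.

(** * Weight vectors and the module axioms *)

#[local] Arguments qbin : simpl never.
#[local] Arguments qbinz : simpl never.

Section WeightVectors.
Variables (k : fieldType) (q : k).
Hypothesis q0 : q != 0.
Implicit Types M N P : Uqmod k.

(** Coordinates of weight other than p vanish; in particular the zero vector
    has every weight. *)
Definition wv M (p : int) (x : 'cV[k]_(udim M)) : Prop :=
  forall i, x i 0 != 0 -> @uwt k M i = p.
Arguments wv : clear implicits.

Lemma wv0 M p : wv M p 0.
Proof. by move=> i; rewrite mxE eqxx. Qed.

Lemma wvZ M p c x : wv M p x -> wv M p (c *: x).
Proof. by move=> wx i; rewrite mxE mulf_eq0 negb_or => /andP[_ /wx]. Qed.

Lemma wvD M p x y : wv M p x -> wv M p y -> wv M p (x + y).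
Proof.
move=> wx wy i; rewrite mxE => nz.
have [x0|/wx //] := eqVneq (x i 0) 0.
by apply: wy; rewrite x0 add0r in nz.
Qed.

Lemma wvN M p x : wv M p x -> wv M p (- x).
Proof. by rewrite -scaleN1r; apply: wvZ. Qed.

Lemma wvB M p x y : wv M p x -> wv M p y -> wv M p (x - y).
Proof. by move=> wx /wvN; apply: wvD. Qed.

Lemma wv_sum M p (I : Type) (r : seq I) (P : pred I) F :
  (forall i, P i -> wv M p (F i)) -> wv M p (\sum_(i <- r | P i) F i).
Proof. by move=> wF; apply: big_ind => //; [exact: wv0|exact: wvD]. Qed.

Lemma wv_delta M i : wv M (@uwt k M i) (delta_mx i 0).
Proof. by move=> j; rewrite mxE eqxx andbT; have [->//|_] := eqVneq j i; rewrite eqxx. Qed.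

Lemma wv_mx_eq M m (A B : 'M[k]_(m, udim M)) :
  (forall p x, wv M p x -> A *m x = B *m x) -> A = B.
Proof.
move=> AB; apply/matrixP => i j.
by have /colP/(_ i) := AB _ _ (@wv_delta M j); rewrite -!colE !mxE.
Qed.

Lemma wv_mulmx M N (A : 'M[k]_(udim N, udim M)) (d : int) :
  (forall i j, A i j != 0 -> @uwt k N i = @uwt k M j + d) <->
  (forall p x, wv M p x -> wv N (p + d) (A *m x)).
Proof.
split=> [wA p x wx i|wA i j nz].
  rewrite mxE => nz.
  have [j nzj] : exists j, A i j * x j 0 != 0.
    apply/existsP; rewrite -negb_forall; apply: contra nz => /forallP zero.
    by rewrite big1 // => j _; apply/eqP.
  move: nzj; rewrite mulf_eq0 negb_or => /andP[/wA -> /wx ->] //.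
by apply: (wA _ _ (@wv_delta M j)); rewrite -colE mxE.
Qed.

Lemma uK_wv M e p x : wv M p x -> uK q M e *m x = q ^ (e * p) *: x.
Proof.
move=> wx; apply/colP => i; rewrite /uK mul_diag_mx !mxE.
by have [->|/wx ->] := eqVneq (x i 0) 0; rewrite ?mulr0.
Qed.

Lemma uKbin_wv M c t p x : wv M p x -> uKbin q M c t *m x = qbinz q (p + c) t *: x.
Proof.
move=> wx; apply/colP => i; rewrite /uKbin mul_diag_mx !mxE.
by have [->|/wx ->] := eqVneq (x i 0) 0; rewrite ?mulr0.
Qed.

(** The right-hand side of the relation for E^(a) F^(b), on a vector of weight
    p, where [K; 2t-a-b choose t] acts by a scalar. *)
Definition EFsum M (p : int) a b (x : 'cV_(udim M)) : 'cV[k]_(udim M) :=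
  \sum_(t < (minn a b).+1)
     qbinz q (p + a%:Z - b%:Z) t *: (uF M (b - t) *m (uE M (a - t) *m x)).

Arguments EFsum : clear implicits.

(** The axioms of a module on weight vectors, where K and [K; c choose t] act by
    scalars and so drop out. *)
Record umod M : Prop := Umod {
  umod_E0 : forall x : 'cV_(udim M), uE M 0 *m x = x;
  umod_F0 : forall x : 'cV_(udim M), uF M 0 *m x = x;
  umod_wvE : forall n p x, wv M p x -> wv M (p + n.*2%:Z) (uE M n *m x);
  umod_wvF : forall n p x, wv M p x -> wv M (p - n.*2%:Z) (uF M n *m x);
  umod_EE : forall a b (x : 'cV_(udim M)),
    uE M a *m (uE M b *m x) = qbin q (a + b) a *: (uE M (a + b) *m x);
  umod_FF : forall a b (x : 'cV_(udim M)),
    uF M a *m (uF M b *m x) = qbin q (a + b) a *: (uF M (a + b) *m x);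
  umod_EF : forall a b p x, wv M p x -> uE M a *m (uF M b *m x) = EFsum M p a b x
}.

Lemma EFsum_wv M p a b x :
  (forall n p x, wv M p x -> wv M (p + n.*2%:Z) (uE M n *m x)) -> wv M p x ->
  (\sum_(t < (minn a b).+1)
    uF M (b - t) *m uKbin q M ((t.*2)%:Z - a%:Z - b%:Z) t *m uE M (a - t)) *m x =
  EFsum M p a b x.
Proof.
move=> wE wx; rewrite mulmx_suml; apply: eq_bigr => t _.
rewrite -!mulmxA (uKbin_wv _ _ (wE _ _ _ wx)) -scalemxAr.
by congr (qbinz _ _ _ *: _); have := ltn_ord t; lia.
Qed.

Lemma umodP M : is_Uqmod q M <-> umod M.
Proof.
split=> [[[E0 F0] wEF EE FF EF]|[E0 F0 wE wF EE FF EF]].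
  have wE n p x : wv M p x -> wv M (p + n.*2%:Z) (uE M n *m x).
    by move: p x; apply/wv_mulmx => i j; apply: (wEF n i j).1.
  split=> // [x|x|n p x|a b x|a b x|a b p x wx].
  - by rewrite E0 mul1mx.
  - by rewrite F0 mul1mx.
  - by move: p x; apply/wv_mulmx => i j; apply: (wEF n i j).2.
  - by rewrite mulmxA EE -scalemxAl.
  - by rewrite mulmxA FF -scalemxAl.
  - by rewrite mulmxA EF (EFsum_wv _ _ wE wx).
split=> [|n i j|a b|a b|a b].
- by split; apply: wv_mx_eq => p x _; rewrite ?E0 ?F0 mul1mx.
- by split; move: i j; apply/wv_mulmx => p x; [exact: wE|exact: wF].
- by apply: wv_mx_eq => p x _; rewrite -mulmxA EE scalemxAl.
- by apply: wv_mx_eq => p x _; rewrite -mulmxA FF scalemxAl.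
- by apply: wv_mx_eq => p x wx; rewrite -mulmxA (EF _ _ _ _ wx) (EFsum_wv _ _ wE wx).
Qed.

(** Module homomorphisms, with the conditions on K and [K; c choose t]
    replaced by the preservation of weights. *)
Record uhom M N (f : 'M[k]_(udim N, udim M)) : Prop := Uhom {
  uhom_wv : forall p x, wv M p x -> wv N p (f *m x);
  uhom_E : forall n, f *m uE M n = uE N n *m f;
  uhom_F : forall n, f *m uF M n = uF N n *m f
}.

Arguments uhom : clear implicits.

Lemma uhom_Ev M N f n m (x : 'M_(udim M, m)) : uhom M N f ->
  f *m (uE M n *m x) = uE N n *m (f *m x).
Proof. by case=> _ fE _; rewrite !mulmxA fE. Qed.

Lemma uhom_Fv M N f n m (x : 'M_(udim M, m)) : uhom M N f ->
  f *m (uF M n *m x) = uF N n *m (f *m x).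
Proof. by case=> _ _ fF; rewrite !mulmxA fF. Qed.

(** The operators K^e and [K; c choose t] separate the weights: for p < p'
    the scalar [K; -p choose p'-p] vanishes in weight p and is 1 in weight
    p'.  Hence a homomorphism preserves weights even at a root of unity. *)
Lemma uhomP M N f : @is_Uqhom k q M N f <-> uhom M N f.
Proof.
split=> [[fK fb fE fF]|[wf fE fF]]; split=> //.
- have sep (p p' : int) : (forall c t, qbinz q (p + c) t = qbinz q (p' + c) t) -> p = p'.
    wlog lt_pp' : p p' / (p < p')%R.
      move=> IH eqb; have [||->//] := ltgtP p p' => [lt|lt]; first exact: IH.
      by apply/esym/IH.
    have [n def] : exists n : nat, p' - p = n.+1 by exists `|p' - p|.-1%N; lia.
    move=> /(_ (- p) n.+1); rewrite subrr def /= (_ : qbinz q 0 _ = 0) //.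
    by rewrite (_ : qbinz q _ _ = 1) => [/eqP|]; rewrite ?(eq_sym 0) ?oner_eq0 //; apply: qbinnn.
  have wf : forall i j, f i j != 0 -> @uwt k N i = @uwt k M j + 0.
    move=> i j nz; rewrite addr0; apply: sep => c t; apply: (mulIf nz).
    have /matrixP/(_ i j) := fb c t.
    by rewrite mul_mx_diag mul_diag_mx !mxE mulrC => ->.
  by move=> p x /((wv_mulmx _ _).1 wf); rewrite addr0.
- move=> e; apply: wv_mx_eq => p x wx.
  by rewrite -!mulmxA !(uK_wv _ wx) (uK_wv _ (wf _ _ wx)) -scalemxAr.
- move=> c t; apply: wv_mx_eq => p x wx.
  by rewrite -!mulmxA !(uKbin_wv _ _ wx) (uKbin_wv _ _ (wf _ _ wx)) -scalemxAr.
Qed.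

Lemma uhom_id M : uhom M M 1%:M.
Proof. by split=> *; rewrite ?mul1mx ?mulmx1. Qed.

Lemma uhom_comp M N P (g : 'M_(udim P, udim N)) (f : 'M_(udim N, udim M)) :
  uhom N P g -> uhom M N f -> uhom M P (g *m f).
Proof.
move=> hg hf; split=> [p x wx|n|n].
- by rewrite -mulmxA; apply/(uhom_wv hg)/(uhom_wv hf).
- by rewrite -mulmxA (uhom_E hf) mulmxA (uhom_E hg) mulmxA.
- by rewrite -mulmxA (uhom_F hf) mulmxA (uhom_F hg) mulmxA.
Qed.

Lemma uhom0 M N : uhom M N 0.
Proof. by split=> *; rewrite ?mul0mx ?mulmx0 //; exact: wv0. Qed.

Lemma uhomZ M N c f : uhom M N f -> uhom M N (c *: f).
Proof.
move=> hf; split=> [p x wx|n|n]; rewrite -!scalemxAl -?scalemxAr.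
- exact/wvZ/(uhom_wv hf).
- by rewrite (uhom_E hf).
- by rewrite (uhom_F hf).
Qed.

Lemma uhomD M N f g : uhom M N f -> uhom M N g -> uhom M N (f + g).
Proof.
move=> hf hg; split=> [p x wx|n|n]; rewrite !mulmxDl ?mulmxDr.
- by apply: wvD; [exact: (uhom_wv hf)|exact: (uhom_wv hg)].
- by rewrite (uhom_E hf) (uhom_E hg).
- by rewrite (uhom_F hf) (uhom_F hg).
Qed.

Lemma uhomB M N f g : uhom M N f -> uhom M N g -> uhom M N (f - g).
Proof. by rewrite -scaleN1r => hf hg; apply: uhomD => //; apply: uhomZ. Qed.

End WeightVectors.

Arguments wv {k} M p x.
Arguments EFsum {k} q M p a b x.
Arguments uhom {k} M N f.

(** * Blocks of a tensor product *)

Section TensorBlocks.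
Variables (k : fieldType).

(** Inclusion of, and projection to, the i-th block of a tensor product whose
    left factor has dimension d. Both vanish for i out of range, so that
    formulas with shifted indices need no bounds. *)
Definition tin d n (i : nat) : 'M[k]_(d * n, n) :=
  \matrix_(r, c) (r == i * n + c :> nat)%:R.
Definition tpr d n (i : nat) : 'M[k]_(n, d * n) := (tin d n i)^T.

Lemma tinE d n i (r : 'I_d) (c c' : 'I_n) :
  tin d n i (mxtens_index (r, c)) c' = ((r == i :> nat) && (c == c'))%:R.
Proof.
rewrite mxE /=; congr (_ _)%:R; have [ltc ltc'] := (ltn_ord c, ltn_ord c').
by rewrite -val_eqE eq_addl_mul //= xpair_eqE.
Qed.

Lemma tprE d n i (r : 'I_d) (c c' : 'I_n) :
  tpr d n i c' (mxtens_index (r, c)) = ((r == i :> nat) && (c == c'))%:R.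
Proof. by rewrite mxE tinE. Qed.

Lemma sum_mxtens d n (F : 'I_(d * n) -> k) :
  \sum_x F x = \sum_(i < d) \sum_(j < n) F (mxtens_index (i, j)).
Proof.
rewrite pair_big; apply: reindex => //=.
by exists (@mxtens_unindex d n) => [[i j]|x] _; rewrite ?mxtens_indexK ?mxtens_unindexK.
Qed.

Lemma tpr_tin d n (i : nat) (j : 'I_d) :
  tpr d n i *m tin d n j = (i == j :> nat)%:R%:M.
Proof.
apply/matrixP => c c'; rewrite !mxE sum_mxtens.
rewrite (bigD1 j) //= [X in _ + X]big1 ?addr0 => [|l nlj]; last first.
  by rewrite big1 // => m _; rewrite tinE val_eqE (negPf nlj) mulr0.
rewrite (bigD1 c') //= big1 ?addr0 => [|m nm]; last first.
  by rewrite tinE (negPf nm) andbF mulr0.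
rewrite tprE tinE !eqxx mulr1 [(j : nat) == i]eq_sym [c' == c]eq_sym.
by case: (_ == _ :> nat); case: (_ == _).
Qed.

Lemma tensmx_tin a d b n (A : 'M[k]_(a, d)) (B : 'M[k]_(b, n)) (j : 'I_d) :
  (A *t B) *m tin d n j = \sum_(i < a) A i j *: (tin a b i *m B).
Proof.
apply/matrixP => r c; case: (mxtens_indexP r) => {r} i r.
rewrite mxE sum_mxtens summxE (bigD1 j) //= [X in _ + X]big1 ?addr0 => [|l nlj].
  rewrite (bigD1 c) //= big1 ?addr0 => [|m nmc].
    rewrite tensmxE tinE !eqxx mulr1 (bigD1 i) //= big1 ?addr0 => [|l nli].
      rewrite !mxE (bigD1 r) //= big1 ?addr0 => [|m nmr].
        by rewrite tinE !eqxx mul1r.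
      by rewrite tinE [r == m]eq_sym (negPf nmr) andbF mul0r.
    rewrite !mxE big1 ?mulr0 // => m _.
    by rewrite tinE val_eqE eq_sym (negPf nli) mul0r.
  by rewrite tinE (negPf nmc) andbF mulr0.
by rewrite big1 // => m _; rewrite tinE val_eqE (negPf nlj) mulr0.
Qed.

Lemma tin_big d n i : (d <= i)%N -> tin d n i = 0.
Proof.
move=> le_di; apply/matrixP => r c; case: (mxtens_indexP r) => {r} a r.
by rewrite tinE mxE; case: eqP => // e; have := ltn_ord a; rewrite e ltnNge le_di.
Qed.

Lemma tin_sum d n : \sum_(i < d) tin d n i *m tpr d n i = 1%:M.
Proof.
apply/matrixP => r c; case: (mxtens_indexP c) => {c} j c.
rewrite summxE (bigD1 j) //= big1 ?addr0 => [|l nlj].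
  case: (mxtens_indexP r) => {r} i r.
  rewrite !mxE (bigD1 c) //= big1 ?addr0 => [|m nmc].
    rewrite tinE tprE !eqxx mulr1 (inj_eq (can_inj (@mxtens_indexK _ _))).
    by rewrite xpair_eqE.
  by rewrite tprE eq_sym (negPf nmc) andbF mulr0.
by rewrite mxE big1 // => m _; rewrite tprE val_eqE eq_sym (negPf nlj) mulr0.
Qed.

End TensorBlocks.

Section TensorWeyl.
Variables (k : fieldType) (q : k).
Hypothesis q0 : q != 0.
Implicit Types M N X : Uqmod k.

Lemma uwt_tens M X i j :
  @uwt k (utens q M X) (mxtens_index (i, j)) = @uwt k M i + @uwt k X j.
Proof. by rewrite {1}/uwt /utens mxtens_indexK. Qed.

Lemma wv_tin M X p (i : 'I_(udim M)) (x : 'cV_(udim X)) :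
  wv X p x -> wv (utens q M X) (@uwt k M i + p) (tin k (udim M) (udim X) i *m x).
Proof.
move=> wx r; case: (mxtens_indexP r) => {r} a r.
rewrite uwt_tens mxE => nz.
have [a_i nzr] : a = i /\ x r 0 != 0.
  move: nz; have [->|nai] := eqVneq a i; last first.
    by rewrite big1 ?eqxx // => m _; rewrite tinE val_eqE (negPf nai) mul0r.
  rewrite (bigD1 r) //= big1 ?addr0 => [|m nmr].
    by rewrite tinE !eqxx mul1r.
  by rewrite tinE eq_sym (negPf nmr) andbF mul0r.
by rewrite a_i (wx _ nzr).
Qed.

Lemma wv_tpr M X p (i : 'I_(udim M)) (y : 'cV_(udim M * udim X)) :
  wv (utens q M X) p y -> wv X (p - @uwt k M i) (tpr k (udim M) (udim X) i *m y).
Proof.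
move=> wy r; rewrite mxE sum_mxtens (bigD1 i) //= [X in _ + X]big1 ?addr0 => [|l nli].
  rewrite (bigD1 r) //= big1 ?addr0 => [|m nmr].
    rewrite tprE !eqxx mul1r => /wy; rewrite uwt_tens => <-.
    by rewrite addrAC subrr add0r.
  by rewrite tprE (negPf nmr) andbF mul0r.
by rewrite big1 // => m _; rewrite tprE val_eqE (negPf nli) mul0r.
Qed.

Lemma tens_weyl_E m X n (j : nat) (x : 'cV[k]_(udim X)) : (j <= m)%N ->
  uE (utens q (weyl q m) X) n *m (tin k m.+1 (udim X) j *m x) =
  \sum_(t < n.+1 | (t <= j)%N)
    (q ^ ((n - t)%N%:Z * (t%:Z + m%:Z - j.*2%:Z)) * qbin q (m - (j - t)) t) *:
      (tin k m.+1 (udim X) (j - t) *m (uE X (n - t) *m x)).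
Proof.
move=> le_jm; rewrite mulmxA /= mulmx_suml.
have lt_jm : (j < m.+1)%N by [].
transitivity ((\sum_(i < n.+1) \sum_(a < m.+1) (q ^+ (i * (n - i)) *
   ((uE (weyl q m) (n - i) *m uK q (weyl q m) i) a (Ordinal lt_jm))) *:
     (tin k m.+1 (udim X) a *m uE X i)) *m x).
  congr (_ *m _); apply: eq_bigr => i _; rewrite -scalemxAl.
  have -> : tin k m.+1 (udim X) j = tin k m.+1 (udim X) (Ordinal lt_jm) by [].
  by rewrite tensmx_tin scaler_sumr; apply: eq_bigr => a _; rewrite scalerA.
rewrite (reindex_inj rev_ord_inj) /= mulmx_suml [RHS]big_mkcond; apply: eq_bigr => t _.
have le_tn : (t <= n)%N by rewrite -ltnS.
rewrite subSS subKn // /uK.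
case: leqP => [le_tj|lt_jt].
  have lt_a : (j - t < m.+1)%N by lia.
  rewrite (bigD1 (Ordinal lt_a)) //= big1 ?addr0 => [|a nea].
    rewrite mul_mx_diag !mxE /= subnK // eqxx -scalemxAl mulmxA; congr (_ *: _).
    rewrite mulrCA mulrC; congr (_ * _); rewrite exprnP -qexpD //; congr (q ^ _).
    lia.
  rewrite mul_mx_diag !mxE /=; case: eqP => [E|]; last by rewrite mul0r mulr0 scale0r.
  by case/eqP: nea; apply: val_inj => /=; lia.
rewrite big1 ?mul0mx // => a _.
rewrite mul_mx_diag !mxE /=; case: eqP => [E|]; last by rewrite mul0r mulr0 scale0r.
by exfalso; lia.
Qed.

Lemma tens_weyl_F m X n (j : nat) p (x : 'cV[k]_(udim X)) : (j <= m)%N -> wv X p x ->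
  uF (utens q (weyl q m) X) n *m (tin k m.+1 (udim X) j *m x) =
  \sum_(t < n.+1)
    (q ^ (t%:Z * ((n - t)%N%:Z - p)) * qbin q (j + t) t) *:
      (tin k m.+1 (udim X) (j + t) *m (uF X (n - t) *m x)).
Proof.
move=> le_jm wx; rewrite mulmxA /= mulmx_suml.
have lt_jm : (j < m.+1)%N by [].
rewrite mulmx_suml; apply: eq_bigr => t _.
have le_tn : (t <= n)%N by rewrite -ltnS.
rewrite -scalemxAl (_ : tin k m.+1 (udim X) j = tin k m.+1 (udim X) (Ordinal lt_jm)) //.
rewrite tensmx_tin scaler_sumr mulmx_suml.
have entry (a : 'I_m.+1) : (q ^+ (t * (n - t)) *:
    (uF (weyl q m) t a (Ordinal lt_jm) *:
      (tin k m.+1 (udim X) a *m (uF X (n - t) *m uK q X (- t%:Z))))) *m x =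
  if a == (j + t)%N :> nat then (q ^ (t%:Z * ((n - t)%N%:Z - p)) * qbin q (j + t) t) *:
      (tin k m.+1 (udim X) a *m (uF X (n - t) *m x)) else 0.
  rewrite mxE /=; case: eqP => [E|_]; last by rewrite scale0r scaler0 mul0mx.
  rewrite scalerA -scalemxAl -!mulmxA (uK_wv _ _ wx) -!scalemxAr scalerA E.
  congr (_ *: _); rewrite mulrAC; congr (_ * _).
  by rewrite exprnP -qexpD //; congr (q ^ _); lia.
rewrite (eq_bigr _ (fun a _ => entry a)) -big_mkcond /=.
case: (leqP (j + t) m) => [le_m|lt_m].
  have lt_a : (j + t < m.+1)%N by [].
  rewrite (big_pred1 (Ordinal lt_a)) // => a; exact: val_eqE.
rewrite tin_big // mul0mx scaler0 big1 // => a /eqP E.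
by have := ltn_ord a; rewrite E; lia.
Qed.

End TensorWeyl.

(** * Tensoring with the natural module *)

Section TensorV.
Variables (k : fieldType) (q : k).
Hypothesis q0 : q != 0.
Implicit Types M N X : Uqmod k.

Definition VX X : Uqmod k := utens q (Vq q) X.

Notation "'i0' X" := (tin k 2 (udim X) 0) (at level 10, X at level 9).
Notation "'i1' X" := (tin k 2 (udim X) 1) (at level 10, X at level 9).
Notation "'p0' X" := (tpr k 2 (udim X) 0) (at level 10, X at level 9).
Notation "'p1' X" := (tpr k 2 (udim X) 1) (at level 10, X at level 9).

Lemma VX_sum X m (y : 'M[k]_(2 * udim X, m)) :
  y = i0 X *m (p0 X *m y) + i1 X *m (p1 X *m y).
Proof.
rewrite -[LHS]mul1mx -tin_sum mulmx_suml big_ord_recl big_ord1.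
by rewrite -!mulmxA.
Qed.

Lemma pr00 X : p0 X *m i0 X = 1%:M. Proof. by rewrite (tpr_tin k _ 0 (0 : 'I_2)). Qed.
Lemma pr11 X : p1 X *m i1 X = 1%:M. Proof. by rewrite (tpr_tin k _ 1 (1 : 'I_2)). Qed.
Lemma pr01 X : p0 X *m i1 X = 0.
Proof. by rewrite (tpr_tin k _ 0 (1 : 'I_2)) /= raddf0. Qed.
Lemma pr10 X : p1 X *m i0 X = 0.
Proof. by rewrite (tpr_tin k _ 1 (0 : 'I_2)) /= raddf0. Qed.
Definition prE X m (x : 'M[k]_(udim X, m)) :
  (p0 X *m (i0 X *m x) = x) * (p1 X *m (i1 X *m x) = x) *
  (p0 X *m (i1 X *m x) = 0) * (p1 X *m (i0 X *m x) = 0).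
Proof. by rewrite !mulmxA pr00 pr11 pr01 pr10 !mul1mx !mul0mx. Qed.

Lemma wv_i0 X p x : wv X (p - 1) x -> wv (VX X) p (i0 X *m x).
Proof.
by move=> /(@wv_tin _ q (Vq q) X _ (0 : 'I_2)) /=; congr wv; rewrite addrC subr0 subrK.
Qed.

Lemma wv_i1 X p x : wv X (p + 1) x -> wv (VX X) p (i1 X *m x).
Proof.
move=> /(@wv_tin _ q (Vq q) X _ (1 : 'I_2)) /=; congr wv; lia.
Qed.

Lemma wv_p0 X p x : wv (VX X) p x -> wv X (p - 1) (p0 X *m x).
Proof. by move=> /(@wv_tpr _ q (Vq q) X _ (0 : 'I_2)) /=; congr wv; lia. Qed.

Lemma wv_p1 X p x : wv (VX X) p x -> wv X (p + 1) (p1 X *m x).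
Proof. by move=> /(@wv_tpr _ q (Vq q) X _ (1 : 'I_2)) /=; congr wv; lia. Qed.

Lemma VX_E0 X n (x : 'cV_(udim X)) :
  uE (VX X) n *m (i0 X *m x) = q ^ n%:Z *: (i0 X *m (uE X n *m x)).
Proof.
rewrite (tens_weyl_E q0) // (big_pred1 ord0) => [|t]; last by rewrite leqn0.
by rewrite !subn0 qbin0 mulr1 add0r subr0 mulr1.
Qed.

(** E^(n-1) and F^(n-1), read as 0 for n = 0. On V (x) X the coproducts of
    E^(n) and F^(n) reach down to these only, since E^(2) and F^(2) vanish on
    V. *)
Definition uE' X n := if n is n'.+1 then uE X n' else 0.
Definition uF' X n := if n is n'.+1 then uF X n' else 0.

Lemma VX_E1 X n (x : 'cV_(udim X)) :
  uE (VX X) n *m (i1 X *m x) =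
  q ^ (- n%:Z) *: (i1 X *m (uE X n *m x)) + i0 X *m (uE' X n *m x).
Proof.
rewrite (tens_weyl_E q0) //.
rewrite big_mkcond big_ord_recl /= !subn0 qbin0 mulr1 add0r.
rewrite (_ : n%:Z * _ = - n%:Z); last by lia.
congr (_ + _); case: n => [|n]; first by rewrite big_ord0 mul0mx mulmx0.
rewrite big_ord_recl big1 ?addr0 => [|t _]; last by [].
rewrite /bump /= addn0 subnn subSS subn0 (qbinnn q0) mulr1.
by rewrite (_ : _ * _ = 0) ?expr0z ?scale1r //; lia.
Qed.

Lemma VX_F0 X n p (x : 'cV_(udim X)) : wv X p x ->
  uF (VX X) n *m (i0 X *m x) =
  i0 X *m (uF X n *m x) + q ^ (n%:Z - 1 - p) *: (i1 X *m (uF' X n *m x)).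
Proof.
move=> wx; rewrite (tens_weyl_F q0 _ _ wx) //.
rewrite big_ord_recl /= subn0 qbin0 mulr1 mul0r expr0z scale1r.
congr (_ + _); case: n => [|n]; first by rewrite big_ord0 mul0mx mulmx0 scaler0.
rewrite big_ord_recl big1 ?addr0 => [|t _].
  rewrite /bump /= !addn0 subSS subn0 add0n (qbinnn q0) mulr1.
  by congr (q ^ _ *: _); lia.
by rewrite tin_big // mul0mx scaler0.
Qed.

Lemma VX_F1 X n (x : 'cV_(udim X)) :
  uF (VX X) n *m (i1 X *m x) = i1 X *m (uF X n *m x).
Proof.
apply/eqP; rewrite -subr_eq0 !mulmxA -mulmxBl; apply/eqP.
set A := _ - _; suff -> : A = 0 by rewrite mul0mx.
apply: (@wv_mx_eq _ X) => p {}x wx.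
rewrite mul0mx mulmxBl -!mulmxA (tens_weyl_F q0 _ _ wx) //.
rewrite big_ord_recl /= big1 ?addr0 => [|t _].
  by rewrite subn0 qbin0 mulr1 mul0r expr0z scale1r subrr.
by rewrite tin_big // mul0mx scaler0.
Qed.

Lemma VX_eq X m (A B : 'M[k]_(m, 2 * udim X)) :
  (forall p x, wv X p x -> A *m (i0 X *m x) = B *m (i0 X *m x)) ->
  (forall p x, wv X p x -> A *m (i1 X *m x) = B *m (i1 X *m x)) -> A = B.
Proof.
move=> AB0 AB1; apply: (@wv_mx_eq _ (VX X)) => p y wy.
by rewrite [y]VX_sum !mulmxDr (AB0 _ _ (wv_p0 wy)) (AB1 _ _ (wv_p1 wy)).
Qed.

Lemma EFsum_widen X T p a b (x : 'cV_(udim X)) : (minn a b < T)%N ->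
  EFsum q X p a b x =
  \sum_(t < T) if (t <= a)%N && (t <= b)%N then
     qbinz q (p + a%:Z - b%:Z) t *: (uF X (b - t) *m (uE X (a - t) *m x)) else 0.
Proof.
move=> ltT; rewrite /EFsum (big_ord_widen T (fun t => qbinz q (p + a%:Z - b%:Z) t *:
  (uF X (b - t) *m (uE X (a - t) *m x)))) // -big_mkcond.
by apply: eq_bigl => t; rewrite ltnS leq_min.
Qed.

Section Module.
Variable X : Uqmod k.
Hypothesis modX : umod q X.
Let E0 := umod_E0 modX.
Let F0 := umod_F0 modX.
Let wvE := umod_wvE modX.
Let wvF := umod_wvF modX.
Let EE := umod_EE modX.
Let FF := umod_FF modX.
Let EF := umod_EF modX.

Lemma VX_EE a b (y : 'cV_(2 * udim X)) :
  uE (VX X) a *m (uE (VX X) b *m y) = qbin q (a + b) a *: (uE (VX X) (a + b) *m y).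
Proof.
rewrite mulmxA scalemxAl; congr (_ *m y); apply: VX_eq => p x _.
  rewrite -mulmxA -!scalemxAl VX_E0 -scalemxAr VX_E0 EE VX_E0.
  by rewrite -scalemxAr !scalerA; congr (_ *: _); rewrite PoszD (qexpD q0); ring.
rewrite -mulmxA -!scalemxAl VX_E1 mulmxDr -scalemxAr VX_E1 VX_E0 VX_E1 !scalerDr.
rewrite !scalerA EE -[in LHS]scalemxAr scalerA -addrA; congr (_ + _).
  by congr (_ *: _); rewrite PoszD opprD (qexpD q0); ring.
case: a b => [|a] [|b]; rewrite /= ?addn0 ?mul0mx ?mulmx0 ?scaler0 ?addr0 //.
- by rewrite add0r E0 expr0z !scale1r.
- by rewrite E0 oppr0 expr0z scale1r (qbinnn q0) scale1r.
rewrite !EE -!scalemxAr !scalerA (addSnnS a b) -scalerDl; congr (_ *: _).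
rewrite (addSn a) qbin_pascal // addrC; congr (_ + q ^ _ * _); lia.
Qed.

Lemma VX_FF a b (y : 'cV_(2 * udim X)) :
  uF (VX X) a *m (uF (VX X) b *m y) = qbin q (a + b) a *: (uF (VX X) (a + b) *m y).
Proof.
rewrite mulmxA scalemxAl; congr (_ *m y); apply: VX_eq => p x wx; last first.
  by rewrite -mulmxA -!scalemxAl !VX_F1 FF -scalemxAr.
rewrite -mulmxA -!scalemxAl (VX_F0 _ wx) mulmxDr (VX_F0 _ (@wvF b _ _ wx)) -scalemxAr VX_F1.
rewrite (VX_F0 _ wx) !scalerDr FF -[in LHS]scalemxAr -addrA; congr (_ + _).
case: a b => [|a] [|b]; rewrite /= ?addn0 ?mul0mx ?mulmx0 ?scaler0 ?addr0 //.
- by rewrite add0r F0 ?qbin0 ?scale1r.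
- by rewrite F0 (qbinnn q0) scale1r; congr (q ^ _ *: _); lia.
rewrite !FF -!scalemxAr !scalerA (addSnnS a b) -scalerDl; congr (_ *: _).
rewrite (addSn a) qbin_pascal2 // [RHS]mulrC mulrDr addrC !mulrA -!(qexpD q0).
congr (q ^ _ * _ + q ^ _ * _); lia.
Qed.

(** Both sides split into a v_+ and a v_- component. One of them is the
    relation in X, the other one needs in addition the Pascal rule for the
    scalars [K; c choose t]; in [VX_EF1] their roles are exchanged. *)
Lemma VX_EF0 a b p x : wv X p x ->
  uE (VX X) a.+1 *m (uF (VX X) b.+1 *m (i0 X *m x)) =
  EFsum q (VX X) (p + 1) a.+1 b.+1 (i0 X *m x).
Proof.
move=> wx; rewrite (VX_F0 _ wx) /uF' mulmxDr -scalemxAr VX_E0 VX_E1 /uE'.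
rewrite !(@EF _ _ _ _ wx) scalerDr scalerA.
rewrite [RHS](_ : _ = \sum_(t < (minn a b).+2)
  (i0 X *m (q ^ (a.+1 - t)%N%:Z * qbinz q (p + a%:Z - b%:Z + 1) t *:
     (uF X (b.+1 - t) *m (uE X (a.+1 - t) *m x))) +
   i1 X *m (if (t <= a.+1)%N && (t <= b)%N then
      q ^ (b%:Z - p - a.+1%:Z) * qbinz q (p + a%:Z - b%:Z + 1) t *:
     (uF X (b - t) *m (uE X (a.+1 - t) *m x)) else 0))); last first.
  rewrite /EFsum minnSS; apply: eq_bigr => t _.
  have /andP[le_ta le_tb] : (t <= a.+1)%N && (t <= b.+1)%N.
    by have := ltn_ord t; lia.
  rewrite VX_E0 -scalemxAr (VX_F0 _ (@wvE _ _ _ wx)) scalerA mulrC !scalerDr.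
  have -> : p + 1 + a.+1%:Z - b.+1%:Z = p + a%:Z - b%:Z + 1 by lia.
  rewrite -scalemxAr; congr (_ + _).
  rewrite le_ta /=; case: (leqP t b) => [le_tb'|lt_bt].
    rewrite (subSn le_tb') /= -scalemxAr !scalerA; congr (_ *: _).
    rewrite mulrAC -(qexpD q0); congr (q ^ _ * _); lia.
  have -> : (b.+1 - t)%N = 0%N by lia.
  by rewrite /= mul0mx mulmx0 !scaler0.
rewrite big_split /= -!mulmx_sumr addrCA [RHS]addrC; congr (_ + _).
  rewrite (@EFsum_widen _ (minn a b).+2); last by lia.
  rewrite scalemxAr scaler_sumr; congr (_ *m _); apply: eq_bigr => t _.
  case: ifP => _; last by rewrite scaler0.
  by rewrite !scalerA -(qexpD q0); congr (q ^ _ * qbinz q _ _ *: _); lia.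
rewrite !scalemxAr -mulmxDr; congr (_ *m _).
rewrite /EFsum minnSS big_ord_recl [RHS]big_ord_recl !qbinz0 !subn0 !mulr1 scale1r.
rewrite scalerDr -addrA; congr (_ + _).
rewrite !scaler_sumr -big_split /=; apply: eq_bigr => t _.
have /andP[le_ta le_tb] : (t <= a)%N && (t <= b)%N by have := ltn_ord t; lia.
rewrite /bump !add1n !subSS !scalerA -scalerDl qbinz_pascal //; congr (_ *: _).
have -> : p + a.+1%:Z - b.+1%:Z = p + a%:Z - b%:Z by lia.
rewrite mulrDr !mulrA -!(qexpD q0); congr (q ^ _ * _ + q ^ _ * _); lia.
Qed.

Lemma VX_EF1 a b p x : wv X p x ->
  uE (VX X) a.+1 *m (uF (VX X) b.+1 *m (i1 X *m x)) =
  EFsum q (VX X) (p - 1) a.+1 b.+1 (i1 X *m x).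
Proof.
move=> wx; rewrite VX_F1 VX_E1 /uE' !(@EF _ _ _ _ wx).
rewrite [RHS](_ : _ = \sum_(t < (minn a b).+2)
  (i0 X *m (if (t <= a)%N && (t <= b.+1)%N then qbinz q (p + a%:Z - b%:Z - 1) t *:
     (uF X (b.+1 - t) *m (uE X (a - t) *m x)) else 0) +
   i1 X *m (q ^ (t%:Z - a.+1%:Z) * qbinz q (p + a%:Z - b%:Z - 1) t *:
     (uF X (b.+1 - t) *m (uE X (a.+1 - t) *m x)) +
     if (t <= a)%N && (t <= b)%N then
      q ^ (b%:Z + t%:Z - p - (a.*2)%:Z) * qbinz q (p + a%:Z - b%:Z - 1) t *:
     (uF X (b - t) *m (uE X (a - t) *m x)) else 0))); last first.
  rewrite /EFsum minnSS; apply: eq_bigr => t _.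
  have /andP[le_ta le_tb] : (t <= a.+1)%N && (t <= b.+1)%N.
    by have := ltn_ord t; lia.
  have -> : p - 1 + a.+1%:Z - b.+1%:Z = p + a%:Z - b%:Z - 1 by lia.
  rewrite VX_E1 mulmxDr -scalemxAr VX_F1 scalerDr scalerA mulmxDr addrCA le_tb andbT.
  rewrite (_ : - (a.+1 - t)%N%:Z = t%:Z - a.+1%:Z); last by lia.
  rewrite mulrC -scalemxAr; congr (_ + _).
  case: (leqP t a) => [le_ta'|lt_at]; last first.
    have -> : (a.+1 - t)%N = 0%N by lia.
    by rewrite /= mul0mx !mulmx0 scaler0 addr0.
  rewrite (subSn le_ta') /= (VX_F0 _ (@wvE _ _ _ wx)) scalerDr -scalemxAr; congr (_ + _).
  case: (leqP t b) => [le_tb'|lt_bt].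
    rewrite (subSn le_tb') /= -scalemxAr !scalerA mulrC; congr (q ^ _ * _ *: _); lia.
  have -> : (b.+1 - t)%N = 0%N by lia.
  by rewrite /= mul0mx !mulmx0 !scaler0.
rewrite big_split /= -!mulmx_sumr [RHS]addrC; congr (_ + _); last first.
  rewrite (@EFsum_widen _ (minn a b).+2); last by lia.
  congr (_ *m _); apply: eq_bigr => t _.
  by case: ifP => _ //; congr (qbinz q _ _ *: _); lia.
rewrite scalemxAr; congr (_ *m _).
rewrite big_split /= [X in _ = _ + X]big_ord_recr /= [X in _ = _ + (_ + X)]ifN ?addr0; last by lia.
rewrite /EFsum minnSS big_ord_recl [X in _ = X + _]big_ord_recl !qbinz0 !subn0 !mulr1 scale1r.
rewrite scalerDr sub0r -[RHS]addrA; congr (_ + _).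
rewrite !scaler_sumr -big_split /=; apply: eq_bigr => t _.
have /andP[le_ta le_tb] : (t <= a)%N && (t <= b)%N by have := ltn_ord t; lia.
rewrite le_ta le_tb /bump !add1n !subSS !scalerA -scalerDl; congr (_ *: _).
have -> : p + a.+1%:Z - b.+1%:Z = p + a%:Z - b%:Z - 1 + 1 by lia.
rewrite qbinz_pascal // mulrDr !mulrA -!(qexpD q0); congr (q ^ _ * _ + q ^ _ * _); lia.
Qed.

(** With divided powers, the relations on V (x) X come down to the Pascal rules
    for quantum binomials, block by block. *)
Lemma umod_VX : umod q (VX X).
Proof.
have Ez y : uE (VX X) 0 *m y = y.
  rewrite -[RHS]mul1mx; congr (_ *m y); apply: VX_eq => p x _; rewrite mul1mx.
    by rewrite VX_E0 E0 expr0z scale1r.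
  by rewrite VX_E1 E0 oppr0 expr0z scale1r mul0mx mulmx0 addr0.
have Fz y : uF (VX X) 0 *m y = y.
  rewrite -[RHS]mul1mx; congr (_ *m y); apply: VX_eq => p x wx; rewrite mul1mx.
    by rewrite (VX_F0 _ wx) F0 mul0mx mulmx0 scaler0 addr0.
  by rewrite VX_F1 F0.
have wE n p y : wv (VX X) p y -> wv (VX X) (p + n.*2%:Z) (uE (VX X) n *m y).
  move=> wy; rewrite [y]VX_sum mulmxDr VX_E0 VX_E1; apply: wvD.
    by apply/wvZ/wv_i0; have := @wvE n _ _ (wv_p0 wy); congr wv; lia.
  apply: wvD.
    by apply/wvZ/wv_i1; have := @wvE n _ _ (wv_p1 wy); congr wv; lia.
  apply: wv_i0; case: n => [|n] /=; first by rewrite mul0mx; apply: wv0.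
  by have := @wvE n _ _ (wv_p1 wy); congr wv; lia.
have wF n p y : wv (VX X) p y -> wv (VX X) (p - n.*2%:Z) (uF (VX X) n *m y).
  move=> wy; rewrite [y]VX_sum mulmxDr (VX_F0 _ (wv_p0 wy)) VX_F1.
  apply: wvD; last first.
    by apply/wv_i1; have := @wvF n _ _ (wv_p1 wy); congr wv; lia.
  apply: wvD; first by apply/wv_i0; have := @wvF n _ _ (wv_p0 wy); congr wv; lia.
  apply/wvZ/wv_i1; case: n => [|n] /=; first by rewrite mul0mx; apply: wv0.
  by have := @wvF n _ _ (wv_p0 wy); congr wv; lia.
split=> //; [exact: VX_EE|exact: VX_FF|].
move=> [|a] [|b] p y wy.
- by rewrite Ez /EFsum big_ord1 qbinz0 scale1r Ez.
- by rewrite Ez /EFsum big_ord1 qbinz0 scale1r Ez.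
- by rewrite Fz /EFsum minn0 big_ord1 qbinz0 scale1r Fz.
rewrite [y]VX_sum !mulmxDr (VX_EF0 _ _ (wv_p0 wy)) (VX_EF1 _ _ (wv_p1 wy)).
rewrite subrK addrK /EFsum -big_split; apply: eq_bigr => t _ /=.
by rewrite -scalerDr !mulmxDr.
Qed.

End Module.
End TensorV.

(** * Lowering operators and the obstruction to solving for raising operators *)

#[local] Arguments qhom : simpl never.

Section HighestWeight.
Variables (k : fieldType) (q : k).
Hypothesis q0 : q != 0.
Implicit Types M N X : Uqmod k.

Lemma uEF_bound M : umod q M ->
  exists B, forall n (x : 'cV_(udim M)), (B <= n)%N -> uE M n *m x = 0 /\ uF M n *m x = 0.
Proof.
move=> modM; pose S := (\sum_i absz (@uwt k M i))%N; exists S.+1 => n x ltSn.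
have far i j : @uwt k M i != @uwt k M j + n.*2%:Z.
  apply/eqP => E; have wt_le l : (absz (@uwt k M l) <= S)%N by rewrite /S (bigD1 l) //= leq_addr.
  by have [] := (wt_le i, wt_le j); lia.
suff [-> ->] : uE M n = 0 /\ uF M n = 0 by rewrite !mul0mx.
split; apply/matrixP => i j; rewrite !mxE; apply/eqP/negPn/negP => nz.
  have /wv_mulmx/(_ _ _ nz)/eqP := @umod_wvE _ _ _ modM n.
  by rewrite (negPf (far _ _)).
have /wv_mulmx/(_ _ _ nz) E := @umod_wvF _ _ _ modM n.
by case/eqP: (far j i); rewrite E subrK.
Qed.

Definition hwv M p (x : 'cV[k]_(udim M)) := wv M p x /\ forall n, uE M n.+1 *m x = 0.
Arguments hwv : clear implicits.

(** As F kills u, the relation for E^(a) F^(a) u = 0 expresses F^(a) E^(a) u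
    through the F^(b) E^(b) u with b < a; [qbin_convol] solves the recursion. *)
Lemma lowest_FE M t u : umod q M -> wv M (- t.+1%:Z) u ->
  (forall n, uF M n.+1 *m u = 0) ->
  forall a, uF M a *m (uE M a *m u) = qbin q t.+1 a *: u.
Proof.
move=> modM wu Fu a; elim/ltn_ind: a => [[|a] IH].
  by rewrite (umod_E0 modM) (umod_F0 modM) qbin0 scale1r.
have := @umod_EF _ _ _ modM a.+1 a.+1 _ _ wu; rewrite Fu mulmx0 /EFsum minnn.
have -> : - t.+1%:Z + a.+1%:Z - a.+1%:Z = Negz t by lia.
have := qbin_convol q0 t.+1 (isT : (0 < a.+1)%N).
rewrite big_ord_recl [X in _ -> _ = X -> _]big_ord_recl.
rewrite qhom0 qbinz0 !subn0 mulr1 mul1r scale1r => /(canRL (addrK _)) -> /esym/(canRL (addrK _)) ->.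
rewrite !sub0r scaleNr; congr (- _); rewrite scaler_suml; apply: eq_bigr => i _.
rewrite lift0 subSS IH ?scalerA; last by rewrite ltnS leq_subr.
by rewrite qbinzN; congr (_ *: _).
Qed.

(** Otherwise let F^(m) x be the last nonzero one. It is killed by all F^(b),
    b > 0, and has weight p - 2m = - (t + 1) with m < t + 1; so
    F^(t+1) E^(t+1) fixes it, but E^(t+1) F^(m) x = 0 by the commutation
    relation. *)
Lemma hwv_F M p x n : umod q M -> hwv M p x -> p < n%:Z -> uF M n *m x = 0.
Proof.
move=> modM [wx Ex] ltpn; apply/eqP; apply: contraT => nz.
have [B bd] := uEF_bound modM.
pose P m := (p < m%:Z) && (uF M m *m x != 0).
have exP : exists m, P m by exists n; rewrite /P ltpn.
have bdP m : P m -> (m <= B)%N.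
  by case/andP=> _ nzm; rewrite leqNgt; apply: contra nzm => /ltnW/(bd m x)[_ ->].
case: (ex_maxnP exP bdP) => m /andP[ltpm nzm] maxm.
have Fu b : uF M b.+1 *m (uF M m *m x) = 0.
  rewrite (umod_FF modM); have [->|nz'] := eqVneq (uF M (b.+1 + m) *m x) 0.
    by rewrite scaler0.
  have /maxm : P (b.+1 + m)%N by rewrite /P nz' andbT; lia.
  lia.
have [t def_t] : exists t : nat, p - m.*2%:Z = - t.+1%:Z by exists (`|m.*2%:Z - p|.-1)%N; lia.
have wu := @umod_wvF _ _ _ modM m _ _ wx; rewrite def_t in wu.
have := lowest_FE modM wu Fu t.+1.
rewrite (@umod_EF _ _ _ modM _ _ _ _ wx) /EFsum big1 ?mulmx0 => [|j _].
  by rewrite (qbinnn q0) scale1r => /esym E; rewrite E eqxx in nzm.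
have -> : (t.+1 - j = (t - j).+1)%N by have := ltn_ord j; lia.
by rewrite Ex mulmx0 scaler0.
Qed.

Lemma hwv_neg M p x : umod q M -> hwv M p x -> p < 0 -> x = 0.
Proof. by move=> modM hx p0; rewrite -(umod_F0 modM x) (hwv_F (n := 0) modM hx). Qed.

(** The right-hand sides of the systems E^(n) w = x_n, n >= 1, with w of weight
    p, that are compatible with the relations between divided powers; and
    those for which a solution exists. *)
Definition cocycle M (p : int) (x : nat -> 'cV[k]_(udim M)) :=
  (forall n, wv M (p + n.+1.*2%:Z) (x n.+1)) /\
  (forall a n, uE M a *m x n.+1 = qbin q (a + n.+1) a *: x (a + n.+1)%N).
Arguments cocycle : clear implicits.

Definition coboundary M (p : int) (x : nat -> 'cV[k]_(udim M)) :=
  exists2 w, wv M p w & forall n, uE M n.+1 *m w = x n.+1.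
Arguments coboundary : clear implicits.

Definition H1_at M p := forall x, cocycle M p x -> coboundary M p x.
Definition H1 M := forall p, -1 <= p -> H1_at M p.

Lemma wv_bound M p : exists B, forall n (x : 'cV_(udim M)), (B <= n)%N ->
  wv M (p + n.*2%:Z) x -> x = 0.
Proof.
pose S := (absz p + \sum_i absz (@uwt k M i))%N; exists S.+1 => n x ltSn wx.
apply/colP => i; rewrite mxE; apply/eqP/negPn/negP => /wx E.
have : (absz (@uwt k M i) <= S)%N by rewrite /S (bigD1 i) //=; lia.
lia.
Qed.

(** In weight -1 every module admits the solution
    w = - \sum_(n >= 1) (-1)^n F^(n) x_n. Indeed, reorder
    \sum_(n >= 0) (-1)^n E^(a) F^(n) x_n: the term n = 0 is x_a, and the total
    coefficient of each F^(j) x_(a+j) vanishes by [qbin_convol]. *)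
Lemma H1_m1 M : umod q M -> H1_at M (-1).
Proof.
move=> modM x [wx Ex].
have [B0 bd] := wv_bound M (-1).
pose B := B0.+1.
have x0 n : (B <= n)%N -> x n = 0.
  by case: n => // n ltBn; apply: (bd n.+1) => //; exact: ltnW.
exists (- \sum_(n < B) (-1) ^+ n.+1 *: (uF M n.+1 *m x n.+1)) => [|a].
  apply/wvN/wv_sum => n _; apply: wvZ.
  by have := @umod_wvF _ _ _ modM n.+1 _ _ (wx n); rewrite addrK.
rewrite mulmxN mulmx_sumr; apply/eqP; rewrite eqr_oppLR -addr_eq0; apply/eqP.
pose f n t : 'cV[k]_(udim M) := if (t <= n)%N then
  ((-1) ^+ n * qbin q (n + a) t * qbin q (a.+1 - t + n) (a.+1 - t)) *:
   (uF M (n - t) *m x (a.+1 - t + n)%N) else 0.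
have EF n : uE M a.+1 *m ((-1) ^+ n.+1 *: (uF M n.+1 *m x n.+1)) = \sum_(t < a.+2) f n.+1 t.
  rewrite -scalemxAr (@umod_EF _ _ _ modM _ _ _ _ (wx n)) (@EFsum_widen _ _ _ a.+2) ?geq_minl //; last by lia.
  rewrite scaler_sumr; apply: eq_bigr => t _; rewrite /f.
  rewrite -ltnS ltn_ord /=; case: leqP => le_tn; last by rewrite scaler0.
  have -> : -1 + n.+1.*2%:Z + a.+1%:Z - n.+1%:Z = (n.+1 + a)%N%:Z by lia.
  by rewrite Ex -scalemxAr !scalerA.
under eq_bigr do rewrite EF.
have f0 : \sum_(t < a.+2) f 0%N t = x a.+1.
  rewrite big_ord_recl /f /= big1 ?addr0 // subn0 !mul1r addn0 qbin0 (qbinnn q0).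
  by rewrite mul1r scale1r (umod_F0 modM).
rewrite -f0 addrC -(big_ord_recl B (fun n : 'I_B.+1 => \sum_(t < a.+2) f n t)).
rewrite exchange_big /=.
pose h j : 'cV[k]_(udim M) := (-1) ^+ j *: (uF M j *m x (a.+1 + j)%N).
(* Put n = t + j: the t-th term of E^(a+1) F^(n) x_n is then a multiple of
   F^(j) x_(a+1+j). *)
have sumf (t : 'I_a.+2) : \sum_(n < B.+1) f n t =
  \sum_(j < B.+1) ((-1) ^+ t * qhom q (a.+1 + j) t * qbin q (a.+1 + j) (a.+1 - t)) *: h j.
  have le_t : (t <= a.+1)%N by rewrite -ltnS.
  rewrite (big_ord_widen (t + B.+1) (fun n => f n t)) ?leq_addl // big_mkcond.
  rewrite (eq_bigr (fun n : 'I_(t + B.+1) => f n t)) => [|n _]; last first.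
    case: ltnP => // ltBn; rewrite /f; case: leqP => // le_tn.
    by rewrite x0 ?mulmx0 ?scaler0 //; lia.
  rewrite big_split_ord /= big1 ?add0r => [|n _]; last by rewrite /f leqNgt ltn_ord.
  apply: eq_bigr => j _; rewrite /f leq_addr addKn scalerA addnA subnK //.
  rewrite /h; congr (_ *: _); rewrite /qhom addSn.
  have -> : (t + j + a = a + j + t)%N by lia.
  by rewrite exprD; ring.
rewrite (eq_bigr _ (fun t _ => sumf t)) exchange_big big1 //= => j _.
by rewrite -scaler_suml (qbin_convol q0) // scale0r.
Qed.

(** Solve first for the component along v_-, in weight p + 1, then, after
    subtracting, for the one along v_+, in weight p - 1. The second step needs
    p >= 0, and the remaining case p = -1 is [H1_m1]. *)
Lemma H1_VX X : umod q X -> H1 X -> H1 (VX q X).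
Proof.
move=> modX HX p; case: (eqVneq p (-1)) => [-> _|pn1 lep].
  exact/H1_m1/umod_VX.
move=> y [wy Ey]; have modV := umod_VX q0 modX.
pose z n := tpr k 2 (udim X) 1 *m y n.
have Ez a n : uE X a *m z n.+1 = (q ^ a%:Z * qbin q (a + n.+1) a) *: z (a + n.+1)%N.
  have := congr1 (mulmx (tpr k 2 (udim X) 1)) (Ey a n).
  rewrite [y n.+1]VX_sum mulmxDr (VX_E0 q0) (VX_E1 q0) !mulmxDr -!scalemxAr !prE.
  rewrite scaler0 add0r addr0 -/(z n.+1) -/(z (a + n.+1)%N) -scalerA => <-.
  by rewrite scalerA -(qexpD q0) addrN expr0z scale1r.
have [z0 wz0 Ez0] : coboundary X (p + 1) (fun n => q ^ n%:Z *: z n).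
  apply: HX => [|]; first lia.
  split=> [n|a n].
    by apply: wvZ; have := wv_p1 (wy n); congr wv; lia.
  rewrite -scalemxAr Ez !scalerA PoszD (qexpD q0); congr (_ *: _); ring.
pose y' n := y n - uE (VX q X) n *m (tin k 2 (udim X) 1 *m z0).
pose x n := tpr k 2 (udim X) 0 *m y' n.
have wy' n : wv (VX q X) (p + n.+1.*2%:Z) (y' n.+1).
  by apply: wvB => //; apply: (umod_wvE modV); apply: wv_i1.
have y'E n : y' n.+1 = tin k 2 (udim X) 0 *m x n.+1.
  rewrite [LHS]VX_sum /x (_ : tpr k 2 _ 1 *m y' n.+1 = 0) ?mulmx0 ?addr0 //.
  rewrite /y' mulmxBr (VX_E1 q0) Ez0 mulmxDr -!scalemxAr !prE scalerA -(qexpD q0).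
  by rewrite addNr expr0z scale1r addr0 subrr.
have Ey' a n : uE (VX q X) a *m y' n.+1 = qbin q (a + n.+1) a *: y' (a + n.+1)%N.
  by rewrite /y' mulmxBr Ey (umod_EE modV) -scalerBr.
have [x0 wx0 Ex0] : coboundary X (p - 1) (fun n => q ^ (- n%:Z) *: x n).
  apply: HX => [|]; first lia.
  split=> [n|a n].
    by apply: wvZ; have := wv_p0 (wy' n); congr wv; lia.
  have := congr1 (mulmx (tpr k 2 (udim X) 0)) (Ey' a n).
  rewrite y'E (VX_E0 q0) -!scalemxAr prE -/(x _) => /(canRL (scalerK (qexp_neq0 q0 _))) ->.
  rewrite !scalerA; congr (_ *: _).
  by rewrite PoszD opprD (qexpD q0) -[_^-1]qexpN; ring.
exists (tin k 2 (udim X) 0 *m x0 + tin k 2 (udim X) 1 *m z0) => [|n].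
  by apply: wvD; [apply: wv_i0|apply: wv_i1].
rewrite mulmxDr (VX_E0 q0) Ex0 -scalemxAr scalerA -(qexpD q0) addrN expr0z scale1r.
by rewrite -y'E subrK.
Qed.

End HighestWeight.

(** * Self-duality of the natural module *)

Section Adjunction.
Variables (k : fieldType) (q : k).
Hypothesis q0 : q != 0.
Implicit Types M N X P : Uqmod k.

Notation "'i0' X" := (tin k 2 (udim X) 0) (at level 10, X at level 9).
Notation "'i1' X" := (tin k 2 (udim X) 1) (at level 10, X at level 9).
Notation "'p0' X" := (tpr k 2 (udim X) 0) (at level 10, X at level 9).
Notation "'p1' X" := (tpr k 2 (udim X) 1) (at level 10, X at level 9).
Notation VX := (VX q).

Lemma VX_E X n (y : 'cV_(2 * udim X)) :
  uE (VX X) n *m y =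
  i0 X *m (q ^ n%:Z *: (uE X n *m (p0 X *m y)) + uE' X n *m (p1 X *m y)) +
  i1 X *m (q ^ (- n%:Z) *: (uE X n *m (p1 X *m y))).
Proof.
rewrite {1}[y]VX_sum mulmxDr (VX_E0 q0) (VX_E1 q0) mulmxDr !scalemxAr.
by rewrite -addrA [i1 _ *m _ + _]addrC addrA.
Qed.

Lemma VX_F X n p (y : 'cV_(2 * udim X)) : wv (VX X) p y ->
  uF (VX X) n *m y =
  i0 X *m (uF X n *m (p0 X *m y)) +
  i1 X *m (q ^ (n%:Z - p) *: (uF' X n *m (p0 X *m y)) + uF X n *m (p1 X *m y)).
Proof.
move=> wy; rewrite {1}[y]VX_sum mulmxDr (VX_F0 q0 _ (wv_p0 wy)) (VX_F1 q0).
by rewrite [in RHS]mulmxDr -[in RHS]scalemxAr addrA (_ : n%:Z - 1 - (p - 1) = n%:Z - p); last lia.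
Qed.

(** The invariant form V (x) V -> 1, tensored with P. *)
Definition cap P := p1 P *m p0 (VX P) - q *: (p0 P *m p1 (VX P)).

(** V is its own dual: the adjoint of f : P -> V (x) X is the contraction of
    id (x) f : V (x) P -> V (x) V (x) X with the invariant form on V. *)
Definition adj P X (f : 'M[k]_(2 * udim X, udim P)) : 'M[k]_(udim X, 2 * udim P) :=
  p1 X *m f *m p0 P - q *: (p0 X *m f *m p1 P).

Definition coadj P X (f : 'M[k]_(udim X, 2 * udim P)) : 'M[k]_(2 * udim X, udim P) :=
  i1 X *m (f *m i0 P) - q^-1 *: (i0 X *m (f *m i1 P)).

Lemma uhom_adj P X f : uhom P (VX X) f -> uhom (VX P) X (adj f).
Proof.
move=> hf; have fw := uhom_wv hf.
have fE n (x : 'cV_(udim P)) := uhom_Ev n x hf.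
have fF n (x : 'cV_(udim P)) := uhom_Fv n x hf.
have adj0 (x : 'cV_(udim P)) : adj f *m (i0 P *m x) = p1 X *m (f *m x).
  by rewrite mulmxBl -scalemxAl -!mulmxA !prE !mulmx0 scaler0 subr0.
have adj1 (x : 'cV_(udim P)) : adj f *m (i1 P *m x) = - q *: (p0 X *m (f *m x)).
  by rewrite mulmxBl -scalemxAl -!mulmxA !prE !mulmx0 sub0r scaleNr.
split=> [p y wy|n|n].
- rewrite [y]VX_sum mulmxDr adj0 adj1; apply: wvD.
    by have := wv_p1 (fw _ _ (wv_p0 wy)); congr wv; lia.
  by apply: wvZ; have := wv_p0 (fw _ _ (wv_p1 wy)); congr wv; lia.
- apply: (@VX_eq _ q) => p x wx; rewrite -!mulmxA.
    rewrite (VX_E0 q0) -scalemxAr !adj0 fE VX_E mulmxDr !prE add0r scalerA.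
    by rewrite -(qexpD q0) addrN expr0z scale1r.
  rewrite (VX_E1 q0) mulmxDr -scalemxAr adj0 !adj1 fE VX_E mulmxDr !prE addr0.
  rewrite -scalemxAr; case: n => [|n] /=.
    by rewrite !mul0mx !mulmx0 addr0 oppr0 !expr0z !scale1r addr0.
  rewrite fE VX_E mulmxDr !prE add0r !scalerDr !scalerA -addrA -scalerDl.
  rewrite -[RHS]addr0; congr (_ *: _ + _).
    by rewrite mulrAC -(qexpD q0) addNr expr0z mul1r.
  rewrite -[in - q](expr1z q) mulrN -(qexpD q0) addrC (_ : - n%:Z = - n.+1%:Z + 1) ?subrr ?scale0r //.
  by lia.
- apply: (@VX_eq _ q) => p x wx; rewrite -!mulmxA; last first.
    rewrite (VX_F1 q0) !adj1 fF (VX_F _ (fw _ _ wx)) mulmxDr !prE addr0.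
    by rewrite -scalemxAr.
  rewrite (VX_F0 q0 _ wx) mulmxDr -scalemxAr !adj0 adj1 fF.
  rewrite (VX_F _ (fw _ _ wx)) mulmxDr !prE add0r.
  case: n => [|n] /=; first by rewrite !mul0mx !mulmx0 !scaler0 add0r addr0.
  rewrite fF (VX_F _ (fw _ _ wx)) mulmxDr !prE addr0 scalerA addrAC -scalerDl.
  rewrite (_ : q ^ _ + _ = 0) ?scale0r ?add0r //.
  rewrite mulrN -[in X in _ - X](expr1z q) -(qexpD q0); apply/eqP.
  by rewrite subr_eq0; apply/eqP; congr (q ^ _); lia.
Qed.

Lemma uhom_coadj P X f : uhom (VX P) X f -> uhom P (VX X) (coadj f).
Proof.
move=> hf; have fw := uhom_wv hf.
have fE n (x : 'cV_(2 * udim P)) := @uhom_Ev _ (VX P) X f n 1 x hf.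
have fF n (x : 'cV_(2 * udim P)) := @uhom_Fv _ (VX P) X f n 1 x hf.
have coadjE (x : 'cV_(udim P)) :
    coadj f *m x = i0 X *m (- q^-1 *: (f *m (i1 P *m x))) + i1 X *m (f *m (i0 P *m x)).
  by rewrite mulmxBl -scalemxAl -!mulmxA addrC -scaleNr scalemxAr.
split=> [p x wx|n|n].
- rewrite coadjE; apply: wvD.
    by apply: wv_i0; apply: wvZ; apply: fw; apply: (wv_i1 q0); rewrite subrK.
  by apply: (wv_i1 q0); apply: fw; apply: wv_i0; rewrite addrK.
- apply: wv_mx_eq => p x wx; rewrite -!mulmxA !coadjE mulmxDr (VX_E0 q0) (VX_E1 q0).
  rewrite -!scalemxAr -!fE (VX_E0 q0) (VX_E1 q0) !mulmxDr -!scalemxAr.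
  rewrite !scalerA -(qexpD q0) addNr expr0z scale1r addrA; apply/esym.
  rewrite addrAC; congr (_ + _); rewrite scalerDr !scalerA.
  case: n => [|n] /=.
    rewrite !mul0mx !mulmx0 !scaler0 !addr0; congr (_ *: _).
    by rewrite oppr0 !expr0z mul1r mulr1.
  rewrite -fE (VX_E0 q0) -!scalemxAr -addrA -scalerDl.
  rewrite (_ : q ^ _ * _ + _ = 0) ?scale0r ?addr0.
    by rewrite mulrAC -(qexpD q0) addrN expr0z mul1r.
  by rewrite mulrN intS (qexpD q0) expr1z mulrAC divff // mul1r addNr.
- apply: wv_mx_eq => p x wx; rewrite -!mulmxA !coadjE mulmxDr (VX_F1 q0).
  have w1 : wv X (p - 1) (- q^-1 *: (f *m (i1 P *m x))).
    by apply: wvZ; apply: fw; apply: (wv_i1 q0); rewrite subrK.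
  rewrite (VX_F0 q0 _ w1) -!scalemxAr -!fF (VX_F0 q0 _ wx) (VX_F1 q0) !mulmxDr.
  rewrite -!scalemxAr -addrA; congr (_ + _).
  rewrite addrCA -[LHS]addr0; congr (_ + _); apply/esym.
  case: n => [|n] /=; first by rewrite !mul0mx !mulmx0 !scaler0 addr0.
  rewrite -fF (VX_F1 q0) scalerA -scalerDl.
  have -> : n.+1%:Z - 1 - (p - 1) = n.+1%:Z - 1 - p + 1 by lia.
  by rewrite (qexpD q0) expr1z mulrN -mulrA divff // mulr1 addNr scale0r.
Qed.

Lemma coadjK P X (f : 'M[k]_(udim X, 2 * udim P)) : adj (coadj f) = f.
Proof.
apply: (@VX_eq _ q) => p x _; rewrite /adj /coadj mulmxBl.
  rewrite -scalemxAl -!mulmxA !prE !mulmx0 scaler0 subr0 mulmxBl -scalemxAl mulmxBr.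
  by rewrite -scalemxAr -!mulmxA !prE scaler0 subr0.
rewrite -scalemxAl -!mulmxA !prE !mulmx0 sub0r mulmxBl -scalemxAl mulmxBr.
by rewrite -scalemxAr -!mulmxA !prE sub0r scalerN opprK scalerA divff // scale1r.
Qed.

Lemma adjD P X (f g : 'M[k]_(2 * udim X, udim P)) : adj (f + g) = adj f + adj g.
Proof.
by rewrite /adj !mulmxDr !mulmxDl scalerDr opprD addrACA.
Qed.

Lemma adj0 P X : @adj P X 0 = 0.
Proof. by rewrite /adj !mulmx0 !mul0mx scaler0 subr0. Qed.

Definition idV M N (g : 'M[k]_(udim N, udim M)) : 'M[k]_(2 * udim N, 2 * udim M) :=
  i0 N *m g *m p0 M + i1 N *m g *m p1 M.

Lemma idVE M N (g : 'M[k]_(udim N, udim M)) m (x : 'M_(udim M, m)) :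
  (idV g *m (i0 M *m x) = i0 N *m (g *m x)) *
  (idV g *m (i1 M *m x) = i1 N *m (g *m x)).
Proof. by rewrite !mulmxDl -!mulmxA !prE !mulmx0 addr0 add0r. Qed.

Lemma uhom_idV M N g : uhom M N g -> uhom (VX M) (VX N) (idV g).
Proof.
move=> hg; have gw := uhom_wv hg.
have gE n (x : 'cV_(udim M)) := uhom_Ev n x hg.
have gF n (x : 'cV_(udim M)) := uhom_Fv n x hg.
split=> [p y wy|n|n].
- rewrite [y]VX_sum mulmxDr !idVE; apply: wvD.
    by apply: wv_i0; apply: gw; apply: wv_p0.
  by apply: (wv_i1 q0); apply: gw; apply: wv_p1.
- apply: (@VX_eq _ q) => p x wx; rewrite -!mulmxA !idVE.
    by rewrite !(VX_E0 q0) -scalemxAr idVE gE.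
  rewrite !(VX_E1 q0) mulmxDr -scalemxAr !idVE gE; congr (_ + _ *m _).
  by case: n => [|n] /=; rewrite ?mul0mx ?mulmx0 ?gE.
- apply: (@VX_eq _ q) => p x wx; rewrite -!mulmxA !idVE; last first.
    by rewrite !(VX_F1 q0) idVE gF.
  rewrite (VX_F0 q0 _ wx) (VX_F0 q0 _ (gw _ _ wx)) mulmxDr -scalemxAr !idVE gF.
  congr (_ + _ *: (_ *m _)).
  by case: n => [|n] /=; rewrite ?mul0mx ?mulmx0 ?gF.
Qed.

Lemma adj_idV P X M (b : 'M[k]_(2 * udim X, udim P)) (c : 'M[k]_(udim P, udim M)) :
  adj (b *m c) = adj b *m idV c.
Proof.
apply: (@VX_eq _ q) => p x _; rewrite -[in RHS]mulmxA !idVE /adj.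
  by rewrite !mulmxBl -!scalemxAl -!mulmxA !prE !mulmx0.
by rewrite !mulmxBl -!scalemxAl -!mulmxA !prE !mulmx0.
Qed.

Lemma adj_id P X (g : 'M[k]_(udim X, udim P)) : @adj (VX P) X (idV g) = g *m cap P.
Proof.
rewrite /adj /cap mulmxBr -scalemxAr !mulmxA; congr (_ - _ *: _); congr (_ *m _).
  by rewrite mulmxDr !mulmxA pr10 pr11 !mul0mx mul1mx add0r.
by rewrite mulmxDr !mulmxA pr01 pr00 !mul0mx mul1mx addr0.
Qed.

Lemma uhom_cap P : uhom (VX (VX P)) P (cap P).
Proof.
have := uhom_adj (uhom_id (VX P)); congr uhom.
by rewrite /adj /cap !mulmx1.
Qed.

End Adjunction.

(** * Homomorphisms from tensor powers of the natural module *)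

Arguments hwv {k} M p x.

Section Good.
Variables (k : fieldType) (q : k).
Hypothesis q0 : q != 0.
Implicit Types M N X P Y : Uqmod k.

Notation "'i0' X" := (tin k 2 (udim X) 0) (at level 10, X at level 9).
Notation "'i1' X" := (tin k 2 (udim X) 1) (at level 10, X at level 9).
Notation "'p0' X" := (tpr k 2 (udim X) 0) (at level 10, X at level 9).
Notation "'p1' X" := (tpr k 2 (udim X) 1) (at level 10, X at level 9).
Notation VX := (VX q).

(** What [hwv_extend] and [kill_vtop_thru] require of the target. *)
Definition unobstructed X := umod q X /\ H1 q X.

Lemma unobstructed_VX X : unobstructed X -> unobstructed (VX X).
Proof. by case=> modX HX; split; [exact: umod_VX|exact: H1_VX]. Qed.

Lemma umod_retract X Y (i : 'M[k]_(udim X, udim Y)) (p : 'M[k]_(udim Y, udim X)) :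
  uhom Y X i -> uhom X Y p -> p *m i = 1%:M -> umod q X -> umod q Y.
Proof.
move=> hi hp pi1 modX; have [iw pw] := (uhom_wv hi, uhom_wv hp).
have iinj (x y : 'cV_(udim Y)) : i *m x = i *m y -> x = y.
  by move=> /(congr1 (mulmx p)); rewrite !mulmxA pi1 !mul1mx.
have iE n (x : 'cV_(udim Y)) := uhom_Ev n x hi.
have iF n (x : 'cV_(udim Y)) := uhom_Fv n x hi.
have [E0 F0 wE wF EE FF EF] := modX.
have piK (x : 'cV_(udim Y)) : p *m (i *m x) = x by rewrite mulmxA pi1 mul1mx.
split=> [x|x|n a x wx|n a x wx|a b x|a b x|a b r x wx].
- by apply: iinj; rewrite iE E0.
- by apply: iinj; rewrite iF F0.
- by rewrite -(piK (uE Y n *m x)) iE; apply/pw/wE/iw.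
- by rewrite -(piK (uF Y n *m x)) iF; apply/pw/wF/iw.
- by apply: iinj; rewrite -scalemxAr !iE EE.
- by apply: iinj; rewrite -scalemxAr !iF FF.
apply: iinj; rewrite iE iF (EF _ _ _ _ (iw _ _ wx)) mulmx_sumr; apply: eq_bigr => t _.
by rewrite -scalemxAr iF iE.
Qed.

Lemma H1_retract X Y (i : 'M[k]_(udim X, udim Y)) (p : 'M[k]_(udim Y, udim X)) :
  uhom Y X i -> uhom X Y p -> p *m i = 1%:M -> H1 q X -> H1 q Y.
Proof.
move=> hi hp pi1 HX r ler x [wx Ex].
have [|w ww Ew] := HX r ler (fun n => i *m x n).
  split=> [n|a n]; first exact/(uhom_wv hi)/wx.
  by rewrite -(uhom_Ev _ _ hi) Ex scalemxAr.
exists (p *m w) => [|n]; first exact: (uhom_wv hp).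
by rewrite -(uhom_Ev _ _ hp) Ew mulmxA pi1 mul1mx.
Qed.

Lemma unobstructed_retract X Y (i : 'M[k]_(udim X, udim Y)) (p : 'M[k]_(udim Y, udim X)) :
  uhom Y X i -> uhom X Y p -> p *m i = 1%:M -> unobstructed X -> unobstructed Y.
Proof.
by move=> hi hp pi1 [mX hX]; split; [apply: umod_retract pi1 mX|apply: H1_retract pi1 hX].
Qed.

Lemma weyl0_E n : uE (weyl q 0) n = if n is 0%N then 1%:M else 0.
Proof.
by apply/matrixP => i j; case: n => [|n]; rewrite !ord1 !mxE /= ?qbin0.
Qed.

Lemma weyl0_F n : uF (weyl q 0) n = if n is 0%N then 1%:M else 0.
Proof.
by apply/matrixP => i j; case: n => [|n]; rewrite !ord1 !mxE /= ?qbin0.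
Qed.

Lemma wv_weyl0 p x : wv (weyl q 0) p x -> x = 0 \/ p = 0.
Proof.
move=> wx; have [x0|/wx] := eqVneq (x 0 0) 0; last by right.
by left; apply/colP => i; rewrite ord1 x0 mxE.
Qed.

Lemma unobstructed_weyl0 : unobstructed (weyl q 0).
Proof.
have wEF n (p p' : int) x : wv (weyl q 0) p x -> (n = 0%N -> p = p') ->
    wv (weyl q 0) p' ((if n is 0%N then 1%:M else 0) *m x).
  case: n => [|n] wx pp'; first by rewrite mul1mx -pp'.
  by rewrite mul0mx; apply: wv0.
split; last first.
  move=> p lep x [wx _]; exists 0 => [|n]; first exact: wv0.
  by rewrite mulmx0; have [->//|] := wv_weyl0 (wx n); lia.
split=> [x|x|n p x wx|n p x wx|a b x|a b x|a b p x wx].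
- by rewrite weyl0_E mul1mx.
- by rewrite weyl0_F mul1mx.
- by rewrite weyl0_E; apply: (wEF _ _ _ _ wx) => ->; rewrite addr0.
- by rewrite weyl0_F; apply: (wEF _ _ _ _ wx) => ->; rewrite subr0.
- rewrite !weyl0_E; case: a b => [|a] [|b];
    by rewrite ?addn0 ?add0n ?qbin0 ?scale1r ?mul1mx ?mul0mx ?mulmx0 ?scaler0.
- rewrite !weyl0_F; case: a b => [|a] [|b];
    by rewrite ?addn0 ?add0n ?qbin0 ?scale1r ?mul1mx ?mul0mx ?mulmx0 ?scaler0.
rewrite /EFsum !weyl0_E !weyl0_F; case: a b => [|a] [|b].
- by rewrite minn0 big_ord1 qbinz0 scale1r weyl0_E weyl0_F.
- by rewrite min0n big_ord1 qbinz0 scale1r weyl0_E weyl0_F !subn0 /= !(mul0mx, mul1mx, mulmx0).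
- by rewrite minn0 big_ord1 qbinz0 scale1r weyl0_E weyl0_F !subn0 /= !(mul0mx, mul1mx, mulmx0).
rewrite !mul0mx big1 // => t _; rewrite weyl0_E weyl0_F.
have [ta|ta] := eqVneq (t : nat) a.+1; last first.
  have -> : (a.+1 - t = (a - t).+1)%N by have := ltn_ord t; lia.
  by rewrite /= !(mul0mx, mulmx0) scaler0.
have [tb|tb] := eqVneq (t : nat) b.+1; last first.
  have -> : (b.+1 - t = (b - t).+1)%N by have := ltn_ord t; lia.
  by rewrite /= !(mul0mx, mulmx0) scaler0.
have [->|->] := wv_weyl0 wx; first by rewrite !mulmx0 scaler0.
rewrite (_ : 0 + a.+1%:Z - b.+1%:Z = 0); last by rewrite -ta tb add0r subrr.
rewrite (_ : qbinz q 0 t = 0) ?scale0r //.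
by apply: (qbin_small q0); rewrite ta.
Qed.

Definition Vpow s := utens_pow q (Vq q) s.

Lemma unobstructed_Vpow s : unobstructed (Vpow s).
Proof. by elim: s => [|s IHs]; [exact: unobstructed_weyl0|exact: unobstructed_VX]. Qed.

Fixpoint vtop s : 'cV[k]_(udim (Vpow s)) :=
  if s is s'.+1 return 'cV[k]_(udim (Vpow s)) then i0 (Vpow s') *m vtop s'
  else const_mx 1.

Lemma wv_vtop s : wv (Vpow s) s%:Z (vtop s).
Proof.
elim: s => [|s IHs] /=; first by move=> i _; rewrite ord1.
by apply: wv_i0; move: IHs; congr wv; lia.
Qed.

Lemma Vpow_wt s p y : wv (Vpow s) p y -> s%:Z < p -> y = 0.
Proof.
elim: s p y => [|s IHs] p y wy ltsp.
  by have [//|pz] := wv_weyl0 wy; move: ltsp; rewrite pz.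
rewrite [y]VX_sum (IHs _ _ (wv_p0 wy)) ?(IHs _ _ (wv_p1 wy)) ?mulmx0 ?addr0 //; lia.
Qed.

Lemma Vpow_top s y : wv (Vpow s) s%:Z y -> exists c, y = c *: vtop s.
Proof.
elim: s y => [|s IHs] y wy.
  by exists (y 0 0); apply/colP => i; rewrite ord1 !mxE mulr1.
have [|c Ec] := IHs (p0 (Vpow s) *m y).
  by have := wv_p0 wy; congr wv; lia.
exists c; rewrite [y]VX_sum Ec (Vpow_wt (wv_p1 wy)) ?mulmx0 ?addr0 -?scalemxAr //; lia.
Qed.

Lemma vtopT s : (vtop s)^T *m vtop s = 1%:M.
Proof.
elim: s => [|s IHs] /=; first by apply/matrixP => i j; rewrite !ord1 !mxE big_ord1 !mxE mulr1.
by rewrite trmx_mul -mulmxA prE.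
Qed.

Lemma hwv_vtop s : hwv (Vpow s) s%:Z (vtop s).
Proof.
split; first exact: wv_vtop.
have [modV _] := unobstructed_Vpow s.
by move=> n; apply: (Vpow_wt (@umod_wvE _ _ _ modV n.+1 _ _ (@wv_vtop s))); lia.
Qed.

(** Every highest weight vector of weight s in a module without obstruction
    is the image of the highest weight vector of V^s.  By adjunction one
    factor V is moved to the target at a time; the vector is then completed
    to a highest weight vector v_+ (x) y + v_- (x) x, where y is found by
    solving E y = - q^-1 x, E^(n) y = 0 for n > 1, in weight s - 1 >= -1. *)
Lemma hwv_extend s X x : unobstructed X -> hwv X s%:Z x ->
  exists2 f, uhom (Vpow s) X f & f *m vtop s = x.
Proof.
elim: s X x => [|s IHs] X x [modX HX] hx.
  have [wx Ex] := hx.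
  have E0 := umod_E0 modX; have F0 := umod_F0 modX.
  have Fx n : uF X n.+1 *m x = 0 by apply: (hwv_F q0 modX hx).
  exists x; last first.
    apply/colP => i; rewrite mxE big_ord1 mxE mulr1; congr (x _ _); exact: ord1.
  have xs (y : 'cV_1) : x *m y = y 0 0 *: x.
    by apply/colP => i; rewrite mxE big_ord1 mxE mulrC.
  split=> [p y wy|n|n]; first rewrite xs.
  - have [->|->] := wv_weyl0 wy; last exact: wvZ.
    by rewrite mxE scale0r; apply: wv0.
  - by rewrite weyl0_E; case: n => [|n]; rewrite ?mulmx1 ?E0 // mulmx0 Ex.
  - by rewrite weyl0_F; case: n => [|n]; rewrite ?mulmx1 ?F0 // mulmx0 Fx.
have [wx Ex] := hx.
have [||y wy Ey] := HX (s%:Z - 1) _ (fun n => if n is 1%N then - q^-1 *: x else 0).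
- lia.
- split=> [n|a n].
    case: n => [|n]; last exact: wv0.
    by apply: wvZ; move: wx; congr wv; lia.
  case: n => [|n]; last by rewrite mulmx0 !addnS scaler0.
  case: a => [|a]; first by rewrite (umod_E0 modX) qbin0 scale1r.
  by rewrite addn1 scaler0 -scalemxAr Ex scaler0.
have hx' : hwv (VX X) s%:Z (i0 X *m y + i1 X *m x).
  split=> [|n].
    apply: wvD; first by apply: wv_i0.
    by apply: (wv_i1 q0); move: wx; congr wv; lia.
  rewrite mulmxDr (VX_E0 q0) (VX_E1 q0) Ex Ey mulmx0 scaler0 add0r /=.
  case: n => [|n] /=; last by rewrite Ex !mulmx0 scaler0 addr0.
  rewrite (umod_E0 modX) -scalemxAr scalerA expr1z mulrN divff // scaleN1r.
  by rewrite addNr.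
have [f' hf' Ef'] := IHs _ _ (unobstructed_VX (conj modX HX)) hx'.
exists (adj q f'); first exact: uhom_adj.
rewrite /= mulmxBl -scalemxAl -!mulmxA !prE !mulmx0 scaler0 subr0 Ef'.
by rewrite mulmxDr !prE add0r.
Qed.

(** The maps M -> N in the ideal generated by the object P. *)
Inductive thru P M N : 'M[k]_(udim N, udim M) -> Prop :=
| thru0 : thru P 0
| thruD b c f : uhom P N b -> uhom M P c -> thru P f -> thru P (b *m c + f).

Arguments thru : clear implicits.

Lemma thru1 P M N b c : uhom P N b -> uhom M P c -> thru P M N (b *m c).
Proof. by move=> hb hc; rewrite -[_ *m _]addr0; apply: thruD => //; apply: thru0. Qed.

Lemma thru_add P M N f g : thru P M N f -> thru P M N g -> thru P M N (f + g).
Proof.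
move=> + tg; elim=> [|b c {}f hb hc _ IH]; first by rewrite add0r.
by rewrite -addrA; apply: thruD.
Qed.

Lemma thru_comp P M N M' N' f a d : thru P M N f -> uhom N N' a -> uhom M' M d ->
  thru P M' N' (a *m f *m d).
Proof.
move=> + ha hd; elim=> [|b c {}f hb hc _ IH].
  by rewrite mulmx0 mul0mx; apply: thru0.
rewrite mulmxDr mulmxDl mulmxA -[X in X + _]mulmxA.
by apply: thruD => //; apply: uhom_comp.
Qed.

Lemma thru_adj P M X f : thru P M (VX X) f -> thru (VX P) (VX M) X (adj q f).
Proof.
elim=> [|b c {}f hb hc _ IH]; first by rewrite adj0; apply: thru0.
by rewrite adjD adj_idV; apply: thruD => //; [exact: uhom_adj|exact: uhom_idV].
Qed.

(** The adjoint f' : V^(s-1) -> V (x) X of f takes the highest weight vector to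
    v_+ (x) y with y a highest weight vector again. Extend y to g on V^(s-2).
    The adjoint of id (x) g factors through the contraction V^s -> V^(s-2),
    and f' - id (x) g kills the highest weight vector, so that induction
    applies to it. *)
Lemma kill_vtop_thru s X f : unobstructed X -> uhom (Vpow s) X f -> f *m vtop s = 0 ->
  if s is s'.+2 then thru (Vpow s') (Vpow s) X f else f = 0.
Proof.
elim: s X f => [|s IHs] X f gX hf f0.
  apply/matrixP => i j; have /colP/(_ i) := f0.
  by rewrite !mxE big_ord1 !mxE mulr1 (ord1 j).
have [modX HX] := gX; pose f' := coadj q f.
have hf' : uhom (Vpow s) (VX X) f' by apply: uhom_coadj.
pose y := - q^-1 *: (f *m (i1 (Vpow s) *m vtop s)).
have Ef' : f' *m vtop s = i0 X *m y.
  rewrite /f' /coadj mulmxBl -scalemxAl -!mulmxA f0 mulmx0 sub0r -scaleNr.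
  by rewrite scalemxAr.
have hy : hwv X (s%:Z - 1) y.
  split=> [|n].
    by have := wv_p0 (uhom_wv hf' (@wv_vtop s)); rewrite Ef' prE.
  have [_ /(_ n) Et] := hwv_vtop s.
  have := uhom_Ev n.+1 (vtop s) hf'; rewrite Et mulmx0 Ef' (VX_E0 q0).
  move=> /esym/eqP; rewrite scaler_eq0 (negPf (qexp_neq0 q0 _)) /= => /eqP.
  by move=> /(congr1 (mulmx (p0 X))); rewrite prE mulmx0.
have -> : f = adj q f' by rewrite coadjK.
case: s => [|s] in f f' hf f0 IHs hf' y Ef' hy *.
  rewrite (IHs _ _ (unobstructed_VX gX) hf') ?adj0 // Ef'.
  by rewrite (hwv_neg q0 modX hy) ?mulmx0.
have [g hg Eg] : exists2 g, uhom (Vpow s) X g & g *m vtop s = y.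
  by apply: hwv_extend => //; move: hy; congr hwv; lia.
have hG : uhom (Vpow s.+1) (VX X) (idV g) by apply: uhom_idV.
have G0 : (f' - idV g) *m vtop s.+1 = 0.
  by rewrite mulmxBl Ef' /= idVE Eg subrr.
rewrite -[f'](subrK (idV g)) adjD adj_id; apply: thru_add; last first.
  by apply: thru1 => //; apply: uhom_cap.
have := IHs _ _ (unobstructed_VX gX) (uhomB hf' hG) G0.
move: (f' - idV g) => d; clear -q0; case: s d => [d ->|s d /thru_adj td]; last exact: td.
by rewrite adj0; apply: thru0.
Qed.

End Good.

(** * Duality *)

Section Duality.
Variables (k : fieldType) (q : k).
Hypothesis q0 : q != 0.
Implicit Types M N X P Y : Uqmod k.

Notation "'i0' X" := (tin k 2 (udim X) 0) (at level 10, X at level 9).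
Notation "'i1' X" := (tin k 2 (udim X) 1) (at level 10, X at level 9).
Notation "'p0' X" := (tpr k 2 (udim X) 0) (at level 10, X at level 9).
Notation "'p1' X" := (tpr k 2 (udim X) 1) (at level 10, X at level 9).
Notation VX := (VX q).
Notation unobstructed := (unobstructed q).
Notation Vpow := (Vpow q).

Lemma qbin_sym a b : qbin q (a + b) a = qbin q (a + b) b.
Proof.
have [n] := ubnP (a + b); elim: n a b => // n IHn [|a] [|b] lt_n.
- by [].
- by rewrite add0n qbin0 (qbinnn q0).
- by rewrite addn0 qbin0 (qbinnn q0).
rewrite addSn qbin_pascal // [RHS]qbin_pascal2 // addrC.
rewrite (IHn a b.+1) -?addSnnS ?(IHn a.+1 b) //; [|lia|lia].
congr (q ^ _ * _ + q ^ _ * _); lia.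
Qed.

(** The dual of a module for the antiautomorphism E |-> q K F, F |-> q K^-1 E,
    K |-> K. Unlike the antipode it is compatible with the coproduct without
    a flip of the tensor factors, and the tensor powers of V, in their
    standard bases, are their own duals. *)
Definition rho M : Uqmod k := MkUqmod (@uwt k M)
  (fun n => (q ^+ (n * n) *: (uK q M n%:Z *m uF M n))^T)
  (fun n => (q ^+ (n * n) *: (uK q M (- n%:Z) *m uE M n))^T).

Lemma rho_E M n p (x : 'cV_(udim M)) : wv M p x ->
  uE (rho M) n *m x = q ^ (n%:Z * (n%:Z + p)) *: ((uF M n)^T *m x).
Proof.
move=> wx; rewrite /= linearZ /= trmx_mul tr_diag_mx -/(uK q M n%:Z) -scalemxAl.
rewrite -mulmxA (uK_wv _ _ wx) -scalemxAr scalerA exprnP -(qexpD q0).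
by congr (q ^ _ *: _); rewrite mulrDr.
Qed.

Lemma rho_F M n p (x : 'cV_(udim M)) : wv M p x ->
  uF (rho M) n *m x = q ^ (n%:Z * (n%:Z - p)) *: ((uE M n)^T *m x).
Proof.
move=> wx; rewrite /= linearZ /= trmx_mul tr_diag_mx -/(uK q M _) -scalemxAl.
rewrite -mulmxA (uK_wv _ _ wx) -scalemxAr scalerA exprnP -(qexpD q0).
by congr (q ^ _ *: _); rewrite mulrBr mulNr.
Qed.

Lemma wv_trmx M N (A : 'M[k]_(udim N, udim M)) (d : int) :
  (forall p x, wv M p x -> wv N (p + d) (A *m x)) ->
  (forall p x, wv N p x -> wv M (p - d) (A^T *m x)).
Proof.
move=> /wv_mulmx wA; apply/wv_mulmx => i j; rewrite mxE => /wA ->.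
by rewrite addrK.
Qed.

Lemma umod_wvET M n : umod q M ->
  forall p x, wv M p x -> wv M (p - n.*2%:Z) ((uE M n)^T *m x).
Proof. by move=> modM; apply: wv_trmx; apply: (@umod_wvE _ _ _ modM n). Qed.

Lemma umod_wvFT M n : umod q M ->
  forall p x, wv M p x -> wv M (p + n.*2%:Z) ((uF M n)^T *m x).
Proof.
move=> modM p x wx; rewrite -[_ + _]/(p + n.*2%:Z) -[n.*2%:Z]opprK.
by move: p x wx; apply: wv_trmx; apply: (@umod_wvF _ _ _ modM n).
Qed.

Lemma umod_rho M : umod q M -> umod q (rho M).
Proof.
move=> modM; have [[E0 F0] _ EE FF EF] := (umodP q0 M).2 modM.
have wE n := @umod_wvFT M n modM; have wF n := @umod_wvET M n modM.
have EEr a b : uE (rho M) a *m uE (rho M) b = qbin q (a + b) a *: uE (rho M) (a + b).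
  apply: (@wv_mx_eq _ (rho M)) => p x wx; rewrite -mulmxA (@rho_E M b _ _ wx).
  rewrite -scalemxAr (@rho_E M a _ _ (wE _ _ _ wx)) -scalemxAl (@rho_E M _ _ _ wx) !scalerA mulmxA.
  rewrite -trmx_mul FF addnC linearZ /= -scalemxAl scalerA -qbin_sym addnC.
  rewrite -(qexpD q0) mulrC; congr (_ * q ^ _ *: _); lia.
have FFr a b : uF (rho M) a *m uF (rho M) b = qbin q (a + b) a *: uF (rho M) (a + b).
  apply: (@wv_mx_eq _ (rho M)) => p x wx; rewrite -mulmxA (@rho_F M b _ _ wx).
  rewrite -scalemxAr (@rho_F M a _ _ (wF _ _ _ wx)) -scalemxAl (@rho_F M _ _ _ wx) !scalerA mulmxA.
  rewrite -trmx_mul EE addnC linearZ /= -scalemxAl scalerA -qbin_sym addnC.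
  rewrite -(qexpD q0) mulrC; congr (_ * q ^ _ *: _); lia.
have zero (A : 'M[k]_(udim M)) e (x : 'cV_(udim M)) : A = 1%:M ->
    q ^ (0%:Z * e) *: (A^T *m x) = x.
  by move=> ->; rewrite mul0r expr0z trmx1 mul1mx scale1r.
have id0 (A : 'M[k]_(udim M)) (x : 'cV_(udim M)) :
    (forall p x, wv M p x -> A *m x = x) -> A *m x = x.
  move=> Ax; rewrite -[RHS]mul1mx; congr (_ *m x).
  by apply: wv_mx_eq => p y wy; rewrite mul1mx (Ax _ _ wy).
split=> [x|x|n p x wx|n p x wx|a b x|a b x|a b p x wx].
- by apply: id0 => p {}x wx; rewrite (@rho_E M _ _ _ wx) zero.
- by apply: id0 => p {}x wx; rewrite (@rho_F M _ _ _ wx) zero.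
- by rewrite (@rho_E M _ _ _ wx); apply/wvZ/wE.
- by rewrite (@rho_F M _ _ _ wx); apply/wvZ/wF.
- by rewrite mulmxA EEr scalemxAl.
- by rewrite mulmxA FFr scalemxAl.
rewrite (@rho_F M b _ _ wx) -scalemxAr (@rho_E M a _ _ (wF _ _ _ wx)) scalerA mulmxA -trmx_mul EF.
rewrite /EFsum linear_sum /= mulmx_suml scaler_sumr minnC; apply: eq_bigr => t _.
have /andP[le_ta le_tb] : (t <= a)%N && (t <= b)%N by have := ltn_ord t; lia.
rewrite (@rho_E M _ _ _ wx) -scalemxAr (@rho_F M _ _ _ (wE _ _ _ wx)) !trmx_mul tr_diag_mx.
rewrite -/(uKbin q M _ _) -!mulmxA (uKbin_wv _ _ _ (wE _ _ _ wx)) -scalemxAr !scalerA.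
congr (_ *: _); rewrite -[in RHS]mulrA -!(qexpD q0) [RHS]mulrC.
congr (q ^ _ * qbinz _ _ _); last by lia.
by rewrite -!muln2 !PoszM -!subzn //; ring.
Qed.

Lemma uhom_trmx M N f : uhom M N f -> uhom (rho N) (rho M) f^T.
Proof.
move=> hf; have [fK _ _ _] := (uhomP q0 f).2 hf.
have fT : forall p x, wv N p x -> wv M (p - 0) (f^T *m x).
  by apply: wv_trmx => p x wx; rewrite addr0; apply: (uhom_wv hf).
split=> [p x /fT|n|n]; first by rewrite subr0.
  rewrite /= -!trmx_mul -!scalemxAl -!scalemxAr; congr (_ *: _)^T.
  by rewrite -mulmxA -(uhom_F hf) !mulmxA fK.
rewrite /= -!trmx_mul -!scalemxAl -!scalemxAr; congr (_ *: _)^T.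
by rewrite -mulmxA -(uhom_E hf) !mulmxA fK.
Qed.

Lemma rho_rho_E M n : umod q M -> uE (rho (rho M)) n = uE M n.
Proof.
move=> modM; apply: (@wv_mx_eq _ M) => p x wx.
rewrite (@rho_E (rho M) _ _ _ wx) /= trmxK -scalemxAl -mulmxA.
rewrite (uK_wv _ _ (@umod_wvE _ _ _ modM n _ _ wx)) !scalerA exprnP -!(qexpD q0).
rewrite (_ : _ + _ = 0) ?expr0z ?scale1r // -muln2 !PoszM; ring.
Qed.

Lemma rho_rho_F M n : umod q M -> uF (rho (rho M)) n = uF M n.
Proof.
move=> modM; apply: (@wv_mx_eq _ M) => p x wx.
rewrite (@rho_F (rho M) _ _ _ wx) /= trmxK -scalemxAl -mulmxA.
rewrite (uK_wv _ _ (@umod_wvF _ _ _ modM n _ _ wx)) !scalerA exprnP -!(qexpD q0).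
rewrite (_ : _ + _ = 0) ?expr0z ?scale1r // -muln2 !PoszM; ring.
Qed.

Lemma uhom_rho_rho M : umod q M -> uhom (rho (rho M)) M 1%:M /\ uhom M (rho (rho M)) 1%:M.
Proof.
move=> modM; split; split=> [p x|n|n]; rewrite !mul1mx // mulmx1.
- exact: rho_rho_E.
- exact: rho_rho_F.
- exact/esym/rho_rho_E.
- exact/esym/rho_rho_F.
Qed.

Lemma VX_E_mx X n : uE (VX X) n =
  i0 X *m (q ^ n%:Z *: uE X n *m p0 X + uE' X n *m p1 X) +
  i1 X *m (q ^ (- n%:Z) *: uE X n *m p1 X).
Proof.
apply: (@VX_eq _ q) => p x _; rewrite VX_E // !mulmxDl -!mulmxA !mulmxDl;
  by rewrite -!scalemxAl -!mulmxA.
Qed.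

Lemma VX_F_mx X n : umod q X -> uF (VX X) n =
  i0 X *m (uF X n *m p0 X) +
  i1 X *m (q ^ (n%:Z - 1) *: uF' X n *m uK q X (-1) *m p0 X + uF X n *m p1 X).
Proof.
move=> modX; apply: (@VX_eq _ q) => p x wx.
  rewrite (VX_F0 q0 _ wx) !mulmxDl -!mulmxA !mulmxDl -!mulmxA !prE !mulmx0 addr0.
  rewrite (uK_wv _ _ wx) -!scalemxAr -!scalemxAl -!scalemxAr scalerA -(qexpD q0).
  by congr (_ + q ^ _ *: _); lia.
rewrite (VX_F1 q0) !mulmxDl -!mulmxA !mulmxDl -!mulmxA !prE !mulmx0.
by rewrite !add0r.
Qed.

Lemma trmx_D m n (A B : 'M[k]_(m, n)) : (A + B)^T = A^T + B^T.
Proof. exact: linearD. Qed.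

Lemma trmx_Z m n c (A : 'M[k]_(m, n)) : (c *: A)^T = c *: A^T.
Proof. exact: linearZ. Qed.

(** As [rho] respects the coproduct without a flip, the operators on both sides
    are the same matrices. *)
Lemma rho_VX X : umod q X ->
  (forall n, uE (rho (VX X)) n = uE (VX (rho X)) n) /\
  (forall n, uF (rho (VX X)) n = uF (VX (rho X)) n).
Proof.
move=> modX.
have trE n : (uE (VX X) n)^T = (i0 X *m (q ^ n%:Z *: (uE X n)^T) + i1 X *m (uE' X n)^T) *m p0 X
   + i1 X *m (q ^ (- n%:Z) *: (uE X n)^T) *m p1 X.
  by rewrite VX_E_mx !(trmx_D, trmx_mul, trmx_Z, trmxK).
have trF n : (uF (VX X) n)^T = i0 X *m (uF X n)^T *m p0 X +
   (i0 X *m (q ^ (n%:Z - 1) *: (uK q X (-1) *m (uF' X n)^T)) + i1 X *m (uF X n)^T) *m p1 X.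
  rewrite VX_F_mx // !(trmx_D, trmx_mul, trmx_Z, trmxK) tr_diag_mx.
  by rewrite -scalemxAr.
have w0 p x : wv X p x -> wv (VX X) (p + 1) (i0 X *m x).
  by move=> wx; apply: wv_i0; rewrite addrK.
have w1 p x : wv X p x -> wv (VX X) (p - 1) (i1 X *m x).
  by move=> wx; apply: (wv_i1 q0); rewrite subrK.
split=> n; apply: (@VX_eq _ q X) => p x wx.
- rewrite (@rho_E (VX X) _ _ _ (w0 _ _ wx)) trF (@VX_E0 _ _ q0 (rho X)) (@rho_E X _ _ _ wx).
  rewrite !mulmxDl -!mulmxA !prE !mulmx0 !addr0 -scalemxAr scalerA -(qexpD q0).
  by congr (q ^ _ *: _); ring.
- rewrite (@rho_E (VX X) _ _ _ (w1 _ _ wx)) trF (@VX_E1 _ _ q0 (rho X)) (@rho_E X _ _ _ wx).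
  rewrite !mulmxDl -!mulmxA !prE !mulmx0 add0r scalerDr addrC; congr (_ + _).
    by rewrite -scalemxAr scalerA -(qexpD q0); congr (q ^ _ *: _); ring.
  case: n => [|n] /=; first by rewrite trmx0 !mulmx0 scaler0 !mul0mx mulmx0 scaler0.
  rewrite -[X in _ = _ *m X]/(uE (rho X) n *m x) (@rho_E X _ _ _ wx) -!scalemxAl -mulmxA.
  rewrite (uK_wv _ _ (@umod_wvFT _ n modX _ _ wx)) -!scalemxAr !scalerA -!(qexpD q0).
  by congr (q ^ _ *: _); rewrite -muln2 PoszM intS; ring.
- rewrite (@rho_F (VX X) _ _ _ (w0 _ _ wx)) trE (@VX_F0 _ _ q0 (rho X) _ _ _ wx) (@rho_F X _ _ _ wx).
  rewrite !mulmxDl -!mulmxA !prE !mulmx0 addr0 scalerDr; congr (_ + _).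
    by rewrite -scalemxAl -!scalemxAr scalerA -(qexpD q0); congr (q ^ _ *: _); ring.
  case: n => [|n] /=; first by rewrite trmx0 !mul0mx !mulmx0 !scaler0.
  rewrite -[X in _ = _ *: (_ *m X)]/(uF (rho X) n *m x) (@rho_F X _ _ _ wx) -!scalemxAr.
  by rewrite scalerA -(qexpD q0); congr (q ^ _ *: _); rewrite intS; ring.
- rewrite (@rho_F (VX X) _ _ _ (w1 _ _ wx)) trE (@VX_F1 _ _ q0 (rho X)) (@rho_F X _ _ _ wx).
  rewrite !mulmxDl -!mulmxA !prE !mulmx0 !add0r -scalemxAl -!scalemxAr scalerA -(qexpD q0).
  by congr (q ^ _ *: _); ring.
Qed.

Lemma uhom_rho_VX X : umod q X ->
  uhom (rho (VX X)) (VX (rho X)) 1%:M /\ uhom (VX (rho X)) (rho (VX X)) 1%:M.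
Proof.
move=> modX; have [EE FF] := rho_VX modX.
by split; split=> [p x|n|n]; rewrite ?EE ?FF !mul1mx ?mulmx1.
Qed.

(** Modules that are unobstructed together with their duals; all tilting
    modules turn out to be of this kind. *)
Definition biunobstructed X := unobstructed X /\ unobstructed (rho X).

Lemma biunobstructed_VX X : biunobstructed X -> biunobstructed (VX X).
Proof.
move=> [gX gr]; split; first exact: unobstructed_VX.
have [h1 h2] := uhom_rho_VX gX.1.
by apply: (unobstructed_retract h1 h2 _ (unobstructed_VX q0 gr)); rewrite mulmx1.
Qed.

Lemma biunobstructed_retract X Y (i : 'M[k]_(udim X, udim Y)) (p : 'M[k]_(udim Y, udim X)) :
  uhom Y X i -> uhom X Y p -> p *m i = 1%:M -> biunobstructed X -> biunobstructed Y.
Proof.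
move=> hi hp pi1 [gX gr]; split; first exact: unobstructed_retract pi1 gX.
apply: (unobstructed_retract (uhom_trmx hp) (uhom_trmx hi) _ gr).
by rewrite -trmx_mul pi1 trmx1.
Qed.

Lemma rho_weyl0 : (forall n, uE (rho (weyl q 0)) n = uE (weyl q 0) n) /\
  (forall n, uF (rho (weyl q 0)) n = uF (weyl q 0) n).
Proof.
have K1 (e : int) : uK q (weyl q 0) e = 1%:M.
  by apply/matrixP => i j; rewrite !ord1 !mxE /= mulr0 expr0z.
have rE n : uE (rho (weyl q 0)) n =
  (q ^+ (n * n) *: (uK q (weyl q 0) n%:Z *m uF (weyl q 0) n))^T by [].
have rF n : uF (rho (weyl q 0)) n =
  (q ^+ (n * n) *: (uK q (weyl q 0) (- n%:Z) *m uE (weyl q 0) n))^T by [].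
by split=> -[|n]; rewrite ?rE ?rF K1 mul1mx !(weyl0_E, weyl0_F)
  ?expr0 ?scale1r ?trmx1 ?scaler0 ?trmx0.
Qed.

Lemma uhom_rho_weyl0 :
  uhom (rho (weyl q 0)) (weyl q 0) 1%:M /\ uhom (weyl q 0) (rho (weyl q 0)) 1%:M.
Proof.
have [EE FF] := rho_weyl0.
by split; split=> [p x|n|n]; rewrite ?EE ?FF !mul1mx ?mulmx1.
Qed.

Lemma uhom_rho_Vpow s :
  uhom (rho (Vpow s)) (Vpow s) 1%:M /\ uhom (Vpow s) (rho (Vpow s)) 1%:M.
Proof.
elim: s => [|s [IH1 IH2]]; first exact: uhom_rho_weyl0.
have [h1 h2] := uhom_rho_VX (unobstructed_Vpow q0 s).1.
have id1 : idV (1%:M : 'M[k]_(udim (Vpow s))) = 1%:M.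
  by rewrite /idV !mulmx1 -tin_sum big_ord_recl big_ord1.
split.
  by rewrite -[1%:M]mulmx1 -{1}id1; apply: uhom_comp h1; apply: (uhom_idV q0 IH1).
by rewrite -[1%:M]mulmx1 -{2}id1; apply: (uhom_comp h2); apply: (uhom_idV q0 IH2).
Qed.

Lemma biunobstructed_Vpow s : biunobstructed (Vpow s).
Proof.
elim: s => [|s IHs]; last exact: biunobstructed_VX.
have [h1 h2] := uhom_rho_weyl0; split; first exact: unobstructed_weyl0.
by apply: (unobstructed_retract h1 h2 _ (unobstructed_weyl0 q0)); rewrite mulmx1.
Qed.

(** Apply [hwv_extend] to the dual of X; the powers of V are their own duals. *)
Lemma hwf_extend s X (xi : 'rV_(udim X)) : biunobstructed X -> hwv (rho X) s%:Z xi^T ->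
  exists2 h, uhom X (Vpow s) h & (vtop q s)^T *m h = xi.
Proof.
move=> [[modX _] gr] hxi; have [f hf Ef] := hwv_extend q0 gr hxi.
exists f^T; last by rewrite -trmx_mul Ef trmxK.
rewrite -[f^T]mul1mx -[_ *m _]mulmx1.
apply: uhom_comp (uhom_rho_rho modX).2.
by apply: uhom_comp (uhom_trmx hf); apply: (uhom_rho_Vpow s).1.
Qed.

End Duality.

(** * Splitting V (x) V *)

Section Biproducts.
Variables (k : fieldType) (q : k).
Hypothesis q0 : q != 0.
Implicit Types M N X P Y A B : Uqmod k.

Variant biproduct X A B : Prop :=
  Biproduct i p j r of uhom A X i & uhom X A p & uhom B X j & uhom X B r &
    p *m i = 1%:M & r *m j = 1%:M & i *m p + j *m r = 1%:M.

Lemma uhom_tensr P M N f : uhom M N f ->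
  uhom (utens q P M) (utens q P N) ((1%:M : 'M_(udim P)) *t f).
Proof.
move=> hf; have [fK _ _ _] := (uhomP q0 f).2 hf.
split=> [|n|n].
- have wf : forall i j, f i j != 0 -> @uwt k N i = @uwt k M j + 0.
    by apply/wv_mulmx => p x wx; rewrite addr0; apply: (uhom_wv hf).
  suff H : forall p x, wv (utens q P M) p x ->
      wv (utens q P N) (p + 0) ((1%:M *t f) *m x) by move=> p x /H; rewrite addr0.
  apply/wv_mulmx => i j; case: (mxtens_indexP i) => {i} a i.
  case: (mxtens_indexP j) => {j} b j.
  rewrite tensmxE !mxE mulf_eq0 negb_or => /andP[ab /wf].
  rewrite !uwt_tens !addr0 => ->; move: ab.
  by have [->|_] := eqVneq a b; rewrite ?eqxx.
- rewrite /= mulmx_sumr mulmx_suml; apply: eq_bigr => i _.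
  by rewrite -scalemxAr -scalemxAl !tensmx_mul mul1mx mulmx1 (uhom_E hf).
- rewrite /= mulmx_sumr mulmx_suml; apply: eq_bigr => i _.
  rewrite -scalemxAr -scalemxAl !tensmx_mul mul1mx mulmx1 mulmxA (uhom_F hf).
  by rewrite -!mulmxA fK.
Qed.

Lemma bip_tensr P X A B : biproduct X A B -> biproduct (utens q P X) (utens q P A) (utens q P B).
Proof.
case=> i p j r hi hp hj hr pi1 rj1 sum1.
have one n m : (1%:M : 'M[k]_n) *t (1%:M : 'M[k]_m) = 1%:M.
  apply/matrixP => x y; case: (mxtens_indexP x) => {x} x x'.
  case: (mxtens_indexP y) => {y} y y'; rewrite tensmxE !mxE -natrM mulnb.
  by rewrite -xpair_eqE (inj_eq (can_inj (@mxtens_indexK _ _))).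
apply: (Biproduct (uhom_tensr P hi) (uhom_tensr P hp) (uhom_tensr P hj) (uhom_tensr P hr)).
- by rewrite tensmx_mul mul1mx pi1 one.
- by rewrite tensmx_mul mul1mx rj1 one.
rewrite !tensmx_mul mul1mx -[RHS]one -sum1.
by apply/matrixP => x y; rewrite !mxE mulrDr.
Qed.

Notation VX := (VX q).
Notation WX := (utens q (Wq q)).

Section WV.
Variable Y : Uqmod k.

Notation i0 X := (tin k 2 (udim X) 0).
Notation i1 X := (tin k 2 (udim X) 1).
Notation p0 X := (tpr k 2 (udim X) 0).
Notation p1 X := (tpr k 2 (udim X) 1).
Notation j0 := (tin k 3 (udim Y) 0).
Notation j1 := (tin k 3 (udim Y) 1).
Notation j2 := (tin k 3 (udim Y) 2).
Notation r0 := (tpr k 3 (udim Y) 0).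
Notation r1 := (tpr k 3 (udim Y) 1).
Notation r2 := (tpr k 3 (udim Y) 2).

(** E^(n-2) and F^(n-2), read as 0 for n < 2. *)
Definition uE'' n := if n is n'.+2 then uE Y n' else 0.
Definition uF'' n := if n is n'.+2 then uF Y n' else 0.

Lemma WX_eq m (A B : 'M[k]_(m, 3 * udim Y)) :
  (forall p x, wv Y p x -> A *m (j0 *m x) = B *m (j0 *m x)) ->
  (forall p x, wv Y p x -> A *m (j1 *m x) = B *m (j1 *m x)) ->
  (forall p x, wv Y p x -> A *m (j2 *m x) = B *m (j2 *m x)) -> A = B.
Proof.
move=> AB0 AB1 AB2; apply: (@wv_mx_eq _ (WX Y)) => p y wy.
rewrite -[y]mul1mx -tin_sum mulmx_suml !big_ord_recl big_ord0 addr0 !mulmxDr.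
rewrite -!mulmxA.
rewrite (AB0 _ _ (@wv_tpr _ q (Wq q) Y _ (0 : 'I_3) _ wy)).
rewrite (AB1 _ _ (@wv_tpr _ q (Wq q) Y _ (1 : 'I_3) _ wy)).
by rewrite (AB2 _ _ (@wv_tpr _ q (Wq q) Y _ (lift ord0 (1 : 'I_2)) _ wy)).
Qed.

Lemma qbin21 : qbin q 2 1 = q + q^-1.
Proof.
by rewrite qbin_pascal // qbin0 (qbinnn q0) !mulr1 sub0r qexpN !expr1z.
Qed.

Lemma WX_E0 n (x : 'cV_(udim Y)) :
  uE (WX Y) n *m (j0 *m x) = q ^ n.*2%:Z *: (j0 *m (uE Y n *m x)).
Proof.
rewrite (tens_weyl_E q0) // (big_pred1 ord0) => [|t]; last by rewrite leqn0.
by rewrite /= !subn0 qbin0 mulr1; congr (q ^ _ *: _); lia.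
Qed.

Lemma WX_E1 n (x : 'cV_(udim Y)) :
  uE (WX Y) n *m (j1 *m x) = j1 *m (uE Y n *m x) +
    (q ^ (n%:Z - 1) * (q + q^-1)) *: (j0 *m (uE' Y n *m x)).
Proof.
rewrite (tens_weyl_E q0) // big_mkcond big_ord_recl /= !subn0 qbin0 mulr1.
rewrite (_ : _ * _ = 0) ?expr0z ?scale1r; last by lia.
congr (_ + _); case: n => [|n]; first by rewrite big_ord0 mul0mx mulmx0 scaler0.
rewrite big_ord_recl big1 ?addr0 => [|t _]; last by [].
rewrite /bump /= addn0 subnn subSS !subn0 qbin21.
by congr (q ^ _ * _ *: _); lia.
Qed.

Lemma WX_E2 n (x : 'cV_(udim Y)) :
  uE (WX Y) n *m (j2 *m x) = q ^ (- n.*2%:Z) *: (j2 *m (uE Y n *m x)) +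
    q ^ (1 - n%:Z) *: (j1 *m (uE' Y n *m x)) + j0 *m (uE'' n *m x).
Proof.
rewrite (tens_weyl_E q0) // big_mkcond big_ord_recl /= !subn0 qbin0 mulr1 -[RHS]addrA.
congr (_ + _); first by congr (q ^ _ *: _); lia.
case: n => [|n]; first by rewrite big_ord0 !mul0mx !mulmx0 scaler0 addr0.
rewrite big_ord_recl /bump /= addn0 subSS subn0 (qbinnn q0) mulr1.
congr (_ + _); first by congr (q ^ _ *: _); lia.
case: n => [|n]; first by rewrite big_ord0 !mul0mx mulmx0.
rewrite big_ord_recl big1 ?addr0 => [|t _]; last by [].
rewrite /bump /= !addn0 subSS subnn !subn0 (qbinnn q0) mulr1 subSS subn0.
by rewrite (_ : _ * _ = 0) ?expr0z ?scale1r //; lia.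
Qed.

Lemma WX_F0 n p (x : 'cV_(udim Y)) : wv Y p x ->
  uF (WX Y) n *m (j0 *m x) = j0 *m (uF Y n *m x) +
    q ^ (n%:Z - 1 - p) *: (j1 *m (uF' Y n *m x)) +
    q ^ (2 * (n%:Z - 2 - p)) *: (j2 *m (uF'' n *m x)).
Proof.
move=> wx; rewrite (tens_weyl_F q0 _ _ wx) // big_ord_recl /= subn0 qbin0 mulr1 mul0r.
rewrite expr0z scale1r -[RHS]addrA; congr (_ + _).
case: n => [|n]; first by rewrite big_ord0 !mul0mx !mulmx0 !scaler0 addr0.
rewrite big_ord_recl /bump /= !addn0 add0n subSS subn0 (qbinnn q0) mulr1.
congr (_ + _); first by congr (q ^ _ *: _); lia.
case: n => [|n]; first by rewrite big_ord0 !mul0mx mulmx0 scaler0.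
rewrite big_ord_recl big1 ?addr0 => [|t _]; last by rewrite tin_big ?mul0mx ?scaler0.
rewrite /bump /= !addn0 add0n !subSS subn0 (qbinnn q0) mulr1.
by congr (q ^ _ *: _); lia.
Qed.

Lemma WX_F1 n p (x : 'cV_(udim Y)) : wv Y p x ->
  uF (WX Y) n *m (j1 *m x) = j1 *m (uF Y n *m x) +
    (q ^ (n%:Z - 1 - p) * (q + q^-1)) *: (j2 *m (uF' Y n *m x)).
Proof.
move=> wx; rewrite (tens_weyl_F q0 _ _ wx) // big_ord_recl /= subn0 qbin0 mulr1 mul0r.
rewrite expr0z scale1r; congr (_ + _).
case: n => [|n]; first by rewrite big_ord0 !mul0mx !mulmx0 !scaler0.
rewrite big_ord_recl big1 ?addr0 => [|t _]; last by rewrite tin_big ?mul0mx ?scaler0.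
rewrite /bump /= !addn0 subSS subn0 qbin21.
by congr (q ^ _ * _ *: _); lia.
Qed.

Lemma WX_F2 n p (x : 'cV_(udim Y)) : wv Y p x ->
  uF (WX Y) n *m (j2 *m x) = j2 *m (uF Y n *m x).
Proof.
move=> wx; rewrite (tens_weyl_F q0 _ _ wx) // big_ord_recl /= subn0 qbin0 mulr1 mul0r.
rewrite expr0z scale1r big1 ?addr0 // => t _.
by rewrite tin_big ?mul0mx ?scaler0.
Qed.

(** The basis v_0, v_1, v_2 of W goes to v_+ v_+, F (v_+ v_+), F^(2) (v_+ v_+). *)
Definition incl_WVV : 'M[k]_(2 * (2 * udim Y), 3 * udim Y) :=
  i0 (VX Y) *m (i0 Y *m r0) +
  (i0 (VX Y) *m (i1 Y *m r1) + q^-1 *: (i1 (VX Y) *m (i0 Y *m r1))) +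
  i1 (VX Y) *m (i1 Y *m r2).

Lemma rjE m (x : 'M[k]_(udim Y, m)) :
  (r0 *m (j0 *m x) = x) * (r0 *m (j1 *m x) = 0) * (r0 *m (j2 *m x) = 0) *
  (r1 *m (j0 *m x) = 0) * (r1 *m (j1 *m x) = x) * (r1 *m (j2 *m x) = 0) *
  (r2 *m (j0 *m x) = 0) * (r2 *m (j1 *m x) = 0) * (r2 *m (j2 *m x) = x).
Proof.
have H a (b : 'I_3) : tpr k 3 (udim Y) a *m (tin k 3 (udim Y) b *m x) =
    if a == b :> nat then x else 0.
  by rewrite mulmxA tpr_tin; case: eqP; rewrite ?mul1mx // raddf0 mul0mx.
do !split.
- exact: (H _ (0 : 'I_3)). - exact: (H _ (1 : 'I_3)). - exact: (H _ (lift ord0 (1 : 'I_2))).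
- exact: (H _ (0 : 'I_3)). - exact: (H _ (1 : 'I_3)). - exact: (H _ (lift ord0 (1 : 'I_2))).
- exact: (H _ (0 : 'I_3)). - exact: (H _ (1 : 'I_3)). - exact: (H _ (lift ord0 (1 : 'I_2))).
Qed.

Lemma inclE (x : 'cV_(udim Y)) :
  (incl_WVV *m (j0 *m x) = i0 (VX Y) *m (i0 Y *m x)) *
  (incl_WVV *m (j1 *m x) =
     i0 (VX Y) *m (i1 Y *m x) + q^-1 *: (i1 (VX Y) *m (i0 Y *m x))) *
  (incl_WVV *m (j2 *m x) = i1 (VX Y) *m (i1 Y *m x)).
Proof.
by rewrite !mulmxDl -!scalemxAl -!mulmxA !rjE !mulmx0 scaler0 !(addr0, add0r).
Qed.

Lemma WX_wv p y : wv (WX Y) p y ->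
  [/\ wv Y (p - 2) (r0 *m y), wv Y p (r1 *m y) & wv Y (p + 2) (r2 *m y)].
Proof.
move=> wy; split.
- by have := @wv_tpr _ q (Wq q) Y _ (0 : 'I_3) _ wy; congr wv; rewrite /=; lia.
- by have := @wv_tpr _ q (Wq q) Y _ (1 : 'I_3) _ wy; congr wv; rewrite /=; lia.
- by have := @wv_tpr _ q (Wq q) Y _ (lift ord0 (1 : 'I_2)) _ wy; congr wv; rewrite /=; lia.
Qed.

Lemma WX_sum m (y : 'M[k]_(3 * udim Y, m)) :
  y = j0 *m (r0 *m y) + j1 *m (r1 *m y) + j2 *m (r2 *m y).
Proof.
rewrite -[LHS]mul1mx -tin_sum mulmx_suml !big_ord_recl big_ord0 addr0 addrA.
by rewrite -!mulmxA.
Qed.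

Definition predE := ((fun X => erefl : uE' X 0 = 0), (fun X => erefl : uF' X 0 = 0),
  (fun X n => erefl : uE' X n.+1 = uE X n), (fun X n => erefl : uF' X n.+1 = uF X n),
  (erefl : uE'' 0 = 0), (erefl : uF'' 0 = 0),
  (fun n => erefl : uE'' n.+1 = uE' Y n), (fun n => erefl : uF'' n.+1 = uF' Y n)).

Lemma uhom_incl : uhom (WX Y) (VX (VX Y)) incl_WVV.
Proof.
have w0 X p p' x : wv X p x -> p' = p + 1 -> wv (VX X) p' (i0 X *m x).
  by move=> wx ->; apply: wv_i0; rewrite addrK.
have w1 X p p' x : wv X p x -> p' = p - 1 -> wv (VX X) p' (i1 X *m x).
  by move=> wx ->; apply: (wv_i1 q0); rewrite subrK.
split=> [p y wy|n|n].
- have [y0 y1 y2] := WX_wv wy; rewrite [y]WX_sum !mulmxDr !inclE.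
  apply: wvD; last by apply: (w1 _ _ _ _ (w1 _ _ _ _ y2 erefl)); lia.
  apply: wvD; first by apply: (w0 _ _ _ _ (w0 _ _ _ _ y0 erefl)); lia.
  apply: wvD; first by apply: (w0 _ _ _ _ (w1 _ _ _ _ y1 erefl)); lia.
  by apply: wvZ; apply: (w1 _ _ _ _ (w0 _ _ _ _ y1 erefl)); lia.
- apply: WX_eq => p x wx; rewrite -!mulmxA inclE.
  + rewrite WX_E0 !(VX_E0 q0) -!scalemxAr inclE scalerA -(qexpD q0).
    by congr (q ^ _ *: _); lia.
  + rewrite WX_E1 !mulmxDr -!scalemxAr !inclE !(VX_E0 q0) !(VX_E1 q0) !mulmxDr -!scalemxAr.
    rewrite !(VX_E0 q0) !scalerDr !scalerA -(qexpD q0) addrN expr0z scale1r.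
    rewrite -[LHS]addrA -[RHS]addrA; congr (_ + _).
    rewrite [RHS]addrCA; congr (_ + _).
      by rewrite -scalemxAr scalerA -mulrA -(qexpD q0) addNr expr0z mulr1.
    case: n => [|n]; rewrite !predE; first by rewrite !(mul0mx, mulmx0, scaler0, addr0).
    rewrite (VX_E0 q0) -scalemxAr scalerA -scalerDl; congr (_ *: _).
    by rewrite (_ : n.+1%:Z - 1 = n%:Z) ?intS ?(qexpD q0) ?expr1z; [ring|lia].
  + rewrite WX_E2 !mulmxDr -!scalemxAr !inclE !(VX_E1 q0) !mulmxDr -!scalemxAr !scalerDr !scalerA.
    rewrite -(qexpD q0) -!addrA; congr (_ + _); first by congr (q ^ _ *: _); lia.
    case: n => [|n]; rewrite !predE.
      by rewrite !(mul0mx, mulmx0, scaler0, addr0).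
    rewrite (VX_E1 q0) mulmxDr -!scalemxAr [RHS]addrCA.
    congr (_ *: _ + (_ *: _ + _)).
    * by congr (q ^ _); lia.
    * by rewrite -[q in q^-1]expr1z -qexpN -(qexpD q0); congr (q ^ _); lia.
- apply: WX_eq => p x wx; rewrite -!mulmxA inclE.
  + rewrite (WX_F0 _ wx) (VX_F0 q0 _ (w0 _ _ _ _ wx erefl)) (VX_F0 q0 _ wx).
    rewrite !mulmxDr -!scalemxAr !inclE -!addrA; congr (_ + _).
    case: n => [|n]; rewrite !predE.
      by rewrite !(mul0mx, mulmx0, scaler0, addr0).
    rewrite (VX_F0 q0 _ wx) mulmxDr -scalemxAr !scalerDr !scalerA -!addrA.
    congr (_ + (_ *: _ + _)).
      by rewrite -[q in q^-1]expr1z -qexpN -(qexpD q0); congr (q ^ _); lia.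
    case: n => [|n]; rewrite !predE; first by rewrite !(mul0mx, mulmx0, scaler0).
    by rewrite -(qexpD q0); congr (q ^ _ *: _); lia.
  + rewrite (WX_F1 _ wx) !mulmxDr -!scalemxAr !inclE.
    rewrite (VX_F0 q0 _ (w1 _ _ _ _ wx erefl)) (VX_F1 q0) (VX_F1 q0) (VX_F0 q0 _ wx).
    rewrite mulmxDr scalerDr -[LHS]addrA -[RHS]addrA; congr (_ + _).
    rewrite [RHS]addrCA; congr (_ + _).
    case: n => [|n]; rewrite !predE; first by rewrite !(mul0mx, mulmx0, scaler0, addr0).
    rewrite (VX_F1 q0) -scalemxAr scalerA -scalerDl; congr (_ *: _).
    rewrite (_ : n.+1%:Z - 1 - (p - 1) = n.+1%:Z - 1 - p + 1); last by lia.
    by rewrite [q ^ (_ + 1)](qexpD q0) expr1z; ring.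
  + by rewrite (WX_F2 _ wx) !(VX_F1 q0) inclE.
Qed.

Hypothesis q2 : q + q^-1 != 0.

(** The left inverse of the inclusion whose kernel is spanned by the invariant
    of V (x) V, the image of [coev]. *)
Definition proj_WVV : 'M[k]_(3 * udim Y, 2 * (2 * udim Y)) :=
  j0 *m (p0 Y *m p0 (VX Y)) +
  (q + q^-1)^-1 *: (j1 *m (q *: (p1 Y *m p0 (VX Y)) + p0 Y *m p1 (VX Y))) +
  j2 *m (p1 Y *m p1 (VX Y)).

Lemma projE m (x : 'M_(udim Y, m)) :
  (proj_WVV *m (i0 (VX Y) *m (i0 Y *m x)) = j0 *m x) *
  (proj_WVV *m (i0 (VX Y) *m (i1 Y *m x)) = (q / (q + q^-1)) *: (j1 *m x)) *
  (proj_WVV *m (i1 (VX Y) *m (i0 Y *m x)) = (q + q^-1)^-1 *: (j1 *m x)) *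
  (proj_WVV *m (i1 (VX Y) *m (i1 Y *m x)) = j2 *m x).
Proof.
rewrite !mulmxDl -!scalemxAl -!mulmxA !mulmxDl -!scalemxAl -!mulmxA !(@prE k (VX Y)).
rewrite !prE !(mulmx0, scaler0, addr0, add0r) -scalemxAr scalerA.
by rewrite [_^-1 * q]mulrC.
Qed.

Lemma proj_inclK : proj_WVV *m incl_WVV = 1%:M.
Proof.
apply: WX_eq => p x _; rewrite -mulmxA inclE mul1mx ?projE //.
rewrite mulmxDr -scalemxAr !projE scalerA -scalerDl.
by rewrite [q^-1 * _]mulrC [q / _]mulrC -mulrDr mulVf // scale1r.
Qed.

Definition coev : 'M[k]_(2 * (2 * udim Y), udim Y) :=
  i1 (VX Y) *m i0 Y - q^-1 *: (i0 (VX Y) *m i1 Y).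

Lemma uhom_coev : uhom Y (VX (VX Y)) coev.
Proof.
have := uhom_coadj q0 (uhom_id (VX Y)); congr uhom.
by rewrite /coadj !mul1mx.
Qed.

Lemma coevE (x : 'cV_(udim Y)) : coev *m x =
  i1 (VX Y) *m (i0 Y *m x) - q^-1 *: (i0 (VX Y) *m (i1 Y *m x)).
Proof. by rewrite mulmxBl -scalemxAl -!mulmxA. Qed.

Lemma capE (x : 'cV_(udim Y)) :
  (cap q Y *m (i0 (VX Y) *m (i0 Y *m x)) = 0) *
  (cap q Y *m (i0 (VX Y) *m (i1 Y *m x)) = x) *
  (cap q Y *m (i1 (VX Y) *m (i0 Y *m x)) = - q *: x) *
  (cap q Y *m (i1 (VX Y) *m (i1 Y *m x)) = 0).
Proof.
rewrite !mulmxBl -!scalemxAl -!mulmxA !(@prE k (VX Y)) !prE !(mulmx0, scaler0).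
by rewrite !subr0 sub0r scaleNr.
Qed.

Lemma q_qq1 : (q != 0) && (q * q + 1 != 0).
Proof.
by rewrite q0 (_ : q * q + 1 = q * (q + q^-1)) ?mulf_neq0 // mulrDr divff.
Qed.

Lemma cap_coev : (- (q + q^-1)^-1 *: cap q Y) *m coev = 1%:M.
Proof.
apply: wv_mx_eq => p x _; rewrite -mulmxA coevE mulmxBr -!scalemxAl.
rewrite -scalemxAr !capE !scalerA -scalerBl mul1mx.
rewrite (_ : _ - _ = 1) ?scale1r //; field; exact: q_qq1.
Qed.

Lemma VV_sum : incl_WVV *m proj_WVV + coev *m (- (q + q^-1)^-1 *: cap q Y) = 1%:M.
Proof.
have Veq (A B : 'M[k]_(_, 2 * (2 * udim Y))) := @VX_eq _ q (VX Y) _ A B.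
have split2 (A : 'M[k]_(2 * (2 * udim Y))) :
  (forall x : 'cV_(udim Y), A *m (i0 (VX Y) *m (i0 Y *m x)) = i0 (VX Y) *m (i0 Y *m x)) ->
  (forall x : 'cV_(udim Y), A *m (i0 (VX Y) *m (i1 Y *m x)) = i0 (VX Y) *m (i1 Y *m x)) ->
  (forall x : 'cV_(udim Y), A *m (i1 (VX Y) *m (i0 Y *m x)) = i1 (VX Y) *m (i0 Y *m x)) ->
  (forall x : 'cV_(udim Y), A *m (i1 (VX Y) *m (i1 Y *m x)) = i1 (VX Y) *m (i1 Y *m x)) -> A = 1%:M.
  move=> A00 A01 A10 A11; apply: Veq => p x _; rewrite mul1mx [x]VX_sum !mulmxDr.
    by apply: congr2; [exact: A00|exact: A01].
  by apply: congr2; [exact: A10|exact: A11].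
apply: split2 => x; rewrite mulmxDl -!mulmxA -scalemxAl capE projE.
- by rewrite inclE scaler0 mulmx0 addr0.
- rewrite -!scalemxAr inclE coevE !(scalerDr, scalerN, scalerA) -!scaleNr.
  rewrite [X in _ + X]addrC addrACA -!scalerDl.
  apply: etrans (_ : 1 *: _ + 0 *: _ = _); last by rewrite scale0r scale1r addr0.
  by congr (_ *: _ + _ *: _); field; exact: q_qq1.
- rewrite -!scalemxAr inclE coevE !(scalerDr, scalerN, scalerA) -!scaleNr.
  rewrite [X in _ + X]addrC addrACA -!scalerDl.
  apply: etrans (_ : 0 *: _ + 1 *: _ = _); last by rewrite scale0r scale1r add0r.
  by congr (_ *: _ + _ *: _); field; exact: q_qq1.
- by rewrite inclE scaler0 mulmx0 addr0.
Qed.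

(** The composite with the injective homomorphism [incl_WVV] is 1 - c coev o cap
    for a scalar c, a homomorphism. *)
Lemma uhom_proj : uhom (VX (VX Y)) (WX Y) proj_WVV.
Proof.
have inj (x y : 'cV_(3 * udim Y)) : incl_WVV *m x = incl_WVV *m y -> x = y.
  by move=> /(congr1 (mulmx proj_WVV)); rewrite !mulmxA proj_inclK !mul1mx.
have he : uhom (VX (VX Y)) (VX (VX Y)) (incl_WVV *m proj_WVV).
  rewrite -[_ *m _](addrK (coev *m (- (q + q^-1)^-1 *: cap q Y))) VV_sum.
  apply: uhomB; first exact: uhom_id.
  by apply: uhom_comp uhom_coev _; apply: uhomZ; apply: uhom_cap.
have hi := uhom_incl; have ew := uhom_wv he.
split=> [p y wy|n|n].
- rewrite [y]VX_sum mulmxDr; move: (wv_p0 wy) (wv_p1 wy).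
  set a := p0 _ *m y; set b := p1 _ *m y => wa wb.
  rewrite [a]VX_sum [b]VX_sum !mulmxDr !projE.
  have wt (X : Uqmod k) r r' (z : 'cV_(udim X)) : r = r' -> wv X r z -> wv X r' z by move=> ->.
  have u0 r (z : 'cV_(udim Y)) : wv Y (r - 2) z -> wv (WX Y) r (j0 *m z).
    by move=> /(@wv_tin _ q (Wq q) Y _ (0 : 'I_3)); apply: wt; rewrite /=; lia.
  have u1 r (z : 'cV_(udim Y)) : wv Y r z -> wv (WX Y) r (j1 *m z).
    by move=> /(@wv_tin _ q (Wq q) Y _ (1 : 'I_3)); apply: wt; rewrite /=; lia.
  have u2 r (z : 'cV_(udim Y)) : wv Y (r + 2) z -> wv (WX Y) r (j2 *m z).
    by move=> /(@wv_tin _ q (Wq q) Y _ (lift ord0 (1 : 'I_2))); apply: wt; rewrite [uwt _](_ : _ = -2) //; lia.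
  apply: wvD; apply: wvD.
  + by apply: u0; apply: wt (wv_p0 wa); lia.
  + by apply: wvZ; apply: u1; apply: wt (wv_p1 wa); lia.
  + by apply: wvZ; apply: u1; apply: wt (wv_p0 wb); lia.
  + by apply: u2; apply: wt (wv_p1 wb); lia.
- apply: (@wv_mx_eq _ (VX (VX Y))) => p x _; rewrite -!mulmxA; apply: inj.
  rewrite (uhom_Ev _ _ hi) [LHS]mulmxA [X in _ = _ *m X]mulmxA.
  exact: (uhom_Ev _ _ he).
- apply: (@wv_mx_eq _ (VX (VX Y))) => p x _; rewrite -!mulmxA; apply: inj.
  rewrite (uhom_Fv _ _ hi) [LHS]mulmxA [X in _ = _ *m X]mulmxA.
  exact: (uhom_Fv _ _ he).
Qed.

Lemma bip_VV : biproduct (VX (VX Y)) (WX Y) Y.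
Proof.
apply: (Biproduct uhom_incl uhom_proj uhom_coev _ proj_inclK cap_coev VV_sum).
by apply: uhomZ; apply: uhom_cap.
Qed.

End WV.

Lemma biunobstructed_WX Y : q + q^-1 != 0 -> biunobstructed q Y -> biunobstructed q (WX Y).
Proof.
move=> q2 tY; have [i p j r hi hp _ _ pi1 _ _] := bip_VV Y q2.
exact: (biunobstructed_retract q0 hi hp pi1 (biunobstructed_VX q0 (biunobstructed_VX q0 tY))).
Qed.

Lemma biunobstructed_Wpow r : q + q^-1 != 0 -> biunobstructed q (Wpow q r).
Proof.
move=> q2; elim: r => [|r IHr]; first exact: (biunobstructed_Vpow q0 0).
exact: biunobstructed_WX.
Qed.

End Biproducts.

(** * Tilting modules are unobstructed *)

Section Filtrations.
Variables (k : fieldType) (q : k).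
Hypothesis q0 : q != 0.
Implicit Types M N X P Y A B D : Uqmod k.

Definition wproj M p (x : 'cV[k]_(udim M)) : 'cV[k]_(udim M) :=
  \col_i if @uwt k M i == p then x i 0 else 0.
Arguments wproj : clear implicits.

Lemma wv_wproj M p x : wv M p (wproj M p x).
Proof. by move=> i; rewrite mxE; have [->|_] := eqVneq (uwt i) p; rewrite ?eqxx. Qed.

Lemma wproj_id M p x : wv M p x -> wproj M p x = x.
Proof.
move=> wx; apply/colP => i; rewrite mxE; case: eqP => // ne.
by have [->|/wx] := eqVneq (x i 0) 0.
Qed.

Lemma wproj_mulmx M N (f : 'M[k]_(udim N, udim M)) p x :
  (forall p x, wv M p x -> wv N p (f *m x)) ->
  f *m wproj M p x = wproj N p (f *m x).
Proof.
move=> fw; have /wv_mulmx wf : forall p x, wv M p x -> wv N (p + 0) (f *m x).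
  by move=> r y /fw; rewrite addr0.
apply/colP => i; rewrite !mxE; case: eqP => [wi|nwi].
  apply: eq_bigr => j _; rewrite mxE; case: eqP => // nwj.
  have [->|/wf E] := eqVneq (f i j) 0; first by rewrite !mul0r.
  by case: nwj; rewrite -wi E addr0.
rewrite big1 // => j _; rewrite mxE; case: eqP => [wj|]; last by rewrite mulr0.
have [->|/wf E] := eqVneq (f i j) 0; first by rewrite mul0r.
by case: nwi; rewrite E wj addr0.
Qed.

Definition EErel D := forall a b (x : 'cV_(udim D)),
  uE D a *m (uE D b *m x) = qbin q (a + b) a *: (uE D (a + b) *m x).
Definition Ewt D := forall n p (x : 'cV_(udim D)),
  wv D p x -> wv D (p + n.*2%:Z) (uE D n *m x).

(** Solve in the quotient D', lift the solution to w in D, and correct it by a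
    solution in D'' for the remainder, which lies in the image of D''. The
    maps A' and B' are mere linear splittings. *)
Lemma H1_exact D' D D'' (B : 'M[k]_(udim D, udim D'')) (A : 'M[k]_(udim D', udim D))
    (A' : 'M[k]_(udim D, udim D')) (B' : 'M[k]_(udim D'', udim D)) :
  (forall p x, wv D'' p x -> wv D p (B *m x)) ->
  (forall p x, wv D p x -> wv D' p (A *m x)) ->
  (forall n, B *m uE D'' n = uE D n *m B) ->
  (forall n, A *m uE D n = uE D' n *m A) ->
  A *m A' = 1%:M -> B' *m B = 1%:M ->
  (forall z : 'cV_(udim D), A *m z = 0 -> B *m (B' *m z) = z) ->
  EErel D -> Ewt D -> H1 q D' -> H1 q D'' -> H1 q D.
Proof.
move=> Bw Aw BE AE AA' B'B ker EE wE HD' HD'' p lep x [wx Ex].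
have [|w' ww' Ew'] := HD' p lep (fun n => A *m x n).
  split=> [n|a n]; first exact: Aw.
  by rewrite mulmxA -AE -mulmxA Ex scalemxAr.
pose w := wproj D p (A' *m w').
have ww : wv D p w by apply: wv_wproj.
have Aw' : A *m w = w' by rewrite wproj_mulmx // mulmxA AA' mul1mx wproj_id.
pose z n := x n - uE D n *m w.
have wz n : wv D (p + n.+1.*2%:Z) (z n.+1) by apply: wvB => //; apply: wE.
have zB n : B *m (B' *m z n.+1) = z n.+1.
  by apply: ker; rewrite mulmxBr mulmxA AE -mulmxA Aw' Ew' subrr.
have Binj (u v : 'cV_(udim D'')) : B *m u = B *m v -> u = v.
  by move/(congr1 (mulmx B')); rewrite !mulmxA B'B !mul1mx.
have [|u wu Eu] := HD'' p lep (fun n => B' *m z n).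
  split=> [n|a n].
    have <- : wproj D'' (p + n.+1.*2%:Z) (B' *m z n.+1) = B' *m z n.+1.
      by apply: Binj; rewrite wproj_mulmx // zB wproj_id.
    exact: wv_wproj.
  apply: Binj; rewrite -scalemxAr mulmxA BE -mulmxA zB !addnS zB -!addnS.
  by rewrite /z mulmxBr Ex EE scalerBr.
exists (w + B *m u) => [|n]; first by apply: wvD => //; apply: Bw.
rewrite mulmxDr [X in _ + X]mulmxA -BE -mulmxA Eu zB /z addrC subrK //.
Qed.

(** Rescaling E^(n) in weight p by c n p is compensated by rescaling x_n by the
    inverse, which is compatible with the relations as c is multiplicative. *)
Lemma H1_twist M (wt' : 'I_(udim M) -> int) e' f' (c : nat -> int -> k) :
  (forall i, wt' i = @uwt k M i) ->
  (forall n p x, wv M p x -> e' n *m x = c n p *: (uE M n *m x)) ->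
  (forall n p, c n p != 0) ->
  (forall a n p, c (a + n)%N p = c a (p + n.*2%:Z) * c n p) ->
  H1 q M -> H1 q (@MkUqmod k (udim M) wt' e' f').
Proof.
move=> wtE eE c0 cM HM p lep x [wx Ex].
have wvE r y : wv (@MkUqmod k (udim M) wt' e' f') r y <-> wv M r y.
  by split=> wy i /wy <-; rewrite -wtE.
have wx' n := (wvE _ _).1 (wx n).
have [|w ww Ew] := HM p lep (fun n => (c n p)^-1 *: x n).
  split=> [n|a n]; first exact/wvZ/wx'.
  have := Ex a n; rewrite /= (eE _ _ _ (wx' n)) => /(canRL (scalerK (c0 _ _))) E.
  by rewrite -scalemxAr E !scalerA cM invfM; congr (_ *: _); ring.
exists w => [|n]; first exact/wvE.
by rewrite /= (eE _ _ _ ww) Ew scalerA divff // scale1r.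
Qed.

(** A module with one-dimensional weight spaces m, m-2, ..., -m all of whose
    vectors reach the highest weight line: the dual of a Weyl module. *)
Lemma H1_chain D m (sigma : nat -> 'I_(udim D)) :
  (forall n, (n <= m)%N -> @uwt k D (sigma n) = m%:Z - n.*2%:Z) ->
  (forall i, exists2 n, (n <= m)%N & i = sigma n) ->
  (forall n (x : 'cV_(udim D)), (n <= m)%N -> (uE D n *m x) (sigma 0) 0 = x (sigma n) 0) ->
  EErel D -> Ewt D -> H1 q D.
Proof.
move=> wsig surj top EE wE p lep x [wx Ex].
have small r (y : 'cV_(udim D)) : wv D r y ->
    (forall n, (n <= m)%N -> r = m%:Z - n.*2%:Z -> y = 0) -> y = 0.
  move=> wy h; apply/colP => i; have [n len ->] := surj i; rewrite mxE.
  have [//|nz] := eqVneq (y (sigma n) 0) 0.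
  by rewrite (h n len) ?mxE // -(wy _ nz) wsig.
have inj n (y : 'cV_(udim D)) : (n <= m)%N -> wv D (m%:Z - n.*2%:Z) y ->
    uE D n *m y = 0 -> y = 0.
  move=> len wy y0; apply/colP => i; have [n' len' ->] := surj i; rewrite mxE.
  have [//|nz] := eqVneq (y (sigma n') 0) 0.
  have en : n' = n by have := wy _ nz; rewrite wsig //; lia.
  by rewrite en -(top n y len) y0 mxE.
have [[n0 le0 pE]|none] := pselect (exists2 n, (0 < n <= m)%N & p = m%:Z - n.*2%:Z); last first.
  exists 0 => [|n]; [exact: wv0|rewrite mulmx0; apply/esym].
  apply: (small _ _ (wx n)) => n' len' E; case: none; exists (n.+1 + n')%N; lia.
case: n0 le0 pE => // n0 /andP[_ le0] pE.
pose w := x n0.+1 (sigma 0%N) 0 *: (delta_mx (sigma n0.+1) 0 : 'cV_(udim D)).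
have ww : wv D p w.
  by rewrite pE -wsig //; apply: wvZ; apply: wv_delta.
have Ew : uE D n0.+1 *m w = x n0.+1.
  have wm : wv D m%:Z (uE D n0.+1 *m w - x n0.+1).
    have <- : p + n0.+1.*2%:Z = m%:Z by rewrite pE subrK.
    by apply: wvB => //; apply: wE.
  apply/eqP; rewrite -subr_eq0; apply/eqP/colP => i; rewrite [RHS]mxE.
  have [n' len' ->] := surj i.
  have [//|nz] := eqVneq ((uE D n0.+1 *m w - x n0.+1) (sigma n') 0) 0.
  have -> : n' = 0%N by have := wm _ nz; rewrite wsig //; lia.
  by rewrite mxE (top _ _ le0) !mxE !eqxx mulr1 subrr.
exists w => // n; apply/eqP; rewrite -subr_eq0; apply/eqP.
have wz : wv D (p + n.+1.*2%:Z) (uE D n.+1 *m w - x n.+1) by apply: wvB => //; apply: wE.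
case: (leqP n n0) => [le_n|lt_n].
  apply: (@inj (n0 - n)%N); [lia| |].
    have <- : p + n.+1.*2%:Z = m%:Z - (n0 - n)%N.*2%:Z by rewrite pE; lia.
    exact: wz.
  rewrite mulmxBr EE Ex (_ : (n0 - n + n.+1 = n0.+1)%N); last by lia.
  by rewrite Ew subrr.
by apply: (small _ _ wz) => n' len' E; exfalso; lia.
Qed.

(** The two duals as far as the vanishing of the obstruction is concerned: the
    transposes of the F^(n), and those of the E^(n) with weights reversed. The
    signs and powers of q of the actual duals come in by [H1_twist]. *)
Definition dualF M : Uqmod k := MkUqmod (@uwt k M) (fun n => (uF M n)^T) (fun _ => 0).
Definition dualE M : Uqmod k :=
  MkUqmod (fun i => - @uwt k M i) (fun n => (uE M n)^T) (fun _ => 0).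

Lemma wv_opp M wt' e f p (x : 'cV_(udim M)) :
  (forall i, wt' i = - @uwt k M i) ->
  wv (@MkUqmod k (udim M) wt' e f) p x <-> wv M (- p) x.
Proof. by move=> wtE; split=> wx i /wx; rewrite /= wtE => E; lia. Qed.

Lemma dualF_rel M : (forall a b, uF M a *m uF M b = qbin q (a + b) a *: uF M (a + b)) ->
  EErel (dualF M).
Proof.
move=> FF a b x; rewrite /= mulmxA -trmx_mul FF trmx_Z -scalemxAl addnC.
by rewrite qbin_sym.
Qed.

Lemma dualE_rel M : (forall a b, uE M a *m uE M b = qbin q (a + b) a *: uE M (a + b)) ->
  EErel (dualE M).
Proof.
move=> EE a b x; rewrite /= mulmxA -trmx_mul EE trmx_Z -scalemxAl addnC.
by rewrite qbin_sym.
Qed.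

Lemma dualF_wt M :
  (forall n i j, uF M n i j != 0 -> @uwt k M i = @uwt k M j - n.*2%:Z) -> Ewt (dualF M).
Proof.
move=> wF n; apply/wv_mulmx => i j; rewrite /= mxE => /wF ->; lia.
Qed.

Lemma dualE_wt M :
  (forall n i j, uE M n i j != 0 -> @uwt k M i = @uwt k M j + n.*2%:Z) -> Ewt (dualE M).
Proof.
move=> wE n; apply/wv_mulmx => i j; rewrite /= mxE => /wE ->; lia.
Qed.

Lemma weyl_wt m n (i j : 'I_m.+1) :
  (uE (weyl q m) n i j != 0 -> @uwt k (weyl q m) i = @uwt k (weyl q m) j + n.*2%:Z) /\
  (uF (weyl q m) n i j != 0 -> @uwt k (weyl q m) i = @uwt k (weyl q m) j - n.*2%:Z).
Proof.
by split; rewrite mxE /=; case: ifP => [/eqP ->|_]; rewrite ?eqxx // => _; lia.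
Qed.

Lemma H1_dualF_weyl m : EErel (dualF (weyl q m)) -> H1 q (dualF (weyl q m)).
Proof.
move=> EE; have wE := @dualF_wt (weyl q m) (fun n (i j : 'I_(udim (weyl q m))) => (@weyl_wt m n i j).2).
apply: (@H1_chain (dualF (weyl q m)) m (fun n => inord n : 'I_m.+1)) => // [n len|i|n x len].
- by rewrite /= inordK.
- by exists i; rewrite ?inord_val // -ltnS.
rewrite mxE (bigD1 (inord n)) //= big1 ?addr0 => [|j ne].
  by rewrite !mxE !inordK // eqxx (qbinnn q0) mul1r.
rewrite !mxE inordK // add0n; case: eqP => [E|]; last by rewrite mul0r.
by case/eqP: ne; apply: val_inj; rewrite /= inordK.
Qed.

Lemma H1_dualE_weyl m : EErel (dualE (weyl q m)) -> H1 q (dualE (weyl q m)).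
Proof.
move=> EE; have wE := @dualE_wt (weyl q m) (fun n (i j : 'I_(udim (weyl q m))) => (@weyl_wt m n i j).1).
apply: (@H1_chain (dualE (weyl q m)) m (fun n => inord (m - n) : 'I_m.+1)) => // [n len|i|n x len].
- by rewrite /= inordK; lia.
- exists (m - i)%N; first lia.
  by rewrite subKn ?inord_val // -ltnS.
rewrite mxE (bigD1 (inord (m - n))) //= big1 ?addr0 => [|j ne].
  by rewrite !mxE !inordK ?subn0 ?subnK ?subKn // ?eqxx ?(qbinnn q0) ?mul1r //; lia.
rewrite !mxE inordK ?subn0 //; case: eqP => [E|]; last by rewrite mul0r.
by case/eqP: ne; apply: val_inj; rewrite /= inordK; lia.
Qed.

Lemma H1_udim0 D : udim D = 0%N -> H1 q D.
Proof.
move=> d0 p lep x _.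
have no (i : 'I_(udim D)) : False by have := ltn_ord i; rewrite {2}d0.
by exists 0 => [|n]; [exact: wv0|apply/colP => i; case: (no i)].
Qed.

(** Dualizing an extension of Delta(m) by M' gives an extension of the dual of
    M' by the dual of Delta(m), to which [H1_chain] applies. *)
Lemma weyl_filtered_H1 N : weyl_filtered q N -> H1 q (dualF N) /\ H1 q (dualE N).
Proof.
elim=> [M _ d0|M' M m f g _ [IHF IHE] modM hf hg rf rg gf0 dM].
  by split; apply: H1_udim0.
have {}hf := (uhomP q0 f).1 hf; have {}hg := (uhomP q0 g).1 hg.
have [_ wEF EE FF _] := modM.
have [g' gg'] : exists g', g *m g' = 1%:M by apply/row_freeP; rewrite /row_free rg.
have [f' f'f] : exists f', f' *m f = 1%:M by apply/row_fullP; rewrite /row_full rf.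
have kerE : (kermx f <= g)%MS.
  have /sub_kermxP sgf := gf0.
  by rewrite -(geq_leqif (mxrank_leqif_sup sgf)) mxrank_ker rf rg dM addKn.
have exact_dual (z : 'cV_(udim M)) : f^T *m z = 0 -> g^T *m (g'^T *m z) = z.
  move=> /(congr1 trmx); rewrite trmx_mul trmxK trmx0 => /sub_kermxP zk.
  have /submxP[u zE] := submx_trans zk kerE.
  by rewrite -[z in LHS]trmxK zE -!trmx_mul -(mulmxA u g g') gg' mulmx1 -zE trmxK.
have quotrel (u : nat -> 'M[k]_(udim M)) (v : nat -> 'M[k]_m.+1) :
    (forall n, g *m u n = v n *m g) ->
    (forall a b, u a *m u b = qbin q (a + b) a *: u (a + b)%N) ->
    (forall a b, v a *m v b = qbin q (a + b) a *: v (a + b)%N).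
  move=> uv uu a b; have ginj (A B : 'M[k]_m.+1) : A *m g = B *m g -> A = B.
    by move=> /(congr1 (mulmx^~ g')); rewrite -!mulmxA gg' !mulmx1.
  apply: ginj; rewrite -mulmxA -uv mulmxA -uv.
  by rewrite -mulmxA uu -scalemxAr uv scalemxAl.
split.
- apply: (@H1_exact (dualF M') (dualF M) (dualF (weyl q m)) g^T f^T f'^T g'^T) => //.
  + by move=> p x wx; rewrite -[p]subr0; apply: wv_trmx wx => r y; rewrite addr0; apply: (uhom_wv hg).
  + by move=> p x wx; rewrite -[p]subr0; apply: wv_trmx wx => r y; rewrite addr0; apply: (uhom_wv hf).
  + by move=> n; rewrite /= -!trmx_mul (uhom_F hg).
  + by move=> n; rewrite /= -!trmx_mul (uhom_F hf).
  + by rewrite -trmx_mul f'f trmx1.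
  + by rewrite -trmx_mul gg' trmx1.
  + exact: dualF_rel.
  + by apply: dualF_wt => n i j; apply: (wEF n i j).2.
  + by apply/H1_dualF_weyl/dualF_rel/(quotrel _ _ (uhom_F hg)).
- apply: (@H1_exact (dualE M') (dualE M) (dualE (weyl q m)) g^T f^T f'^T g'^T) => //.
  + move=> p x /wv_opp wx; apply/wv_opp => //; move: (wx (fun=> erefl)) => {}wx.
    by rewrite -[- p]subr0; apply: wv_trmx wx => r y; rewrite addr0; apply: (uhom_wv hg).
  + move=> p x /wv_opp wx; apply/wv_opp => //; move: (wx (fun=> erefl)) => {}wx.
    by rewrite -[- p]subr0; apply: wv_trmx wx => r y; rewrite addr0; apply: (uhom_wv hf).
  + by move=> n; rewrite /= -!trmx_mul (uhom_E hg).
  + by move=> n; rewrite /= -!trmx_mul (uhom_E hf).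
  + by rewrite -trmx_mul f'f trmx1.
  + by rewrite -trmx_mul gg' trmx1.
  + exact: dualE_rel.
  + by apply: dualE_wt => n i j; apply: (wEF n i j).1.
  + by apply/H1_dualE_weyl/dualE_rel/(quotrel _ _ (uhom_E hg)).
Qed.

(** A module is unobstructed when its antipode dual has a Weyl filtration, and
    its other dual is unobstructed when it has a Weyl filtration itself. *)
Lemma tilting_biunobstructed T : is_Uqmod q T -> tilting q T -> biunobstructed q T.
Proof.
move=> /(umodP q0) modT [fT fT'].
split; split=> //; last 2 first.
- exact: umod_rho.
- have [HF _] := weyl_filtered_H1 fT.
  apply: (@H1_twist (dualF T) _ _ _ (fun n p => q ^ (n%:Z * (n%:Z + p)))) HF => //.
  + by move=> n p x wx; apply: (@rho_E _ _ q0 T n p x wx).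
  + by move=> n p; apply: expfz_neq0.
  + by move=> a n p; rewrite -(qexpD q0) PoszD -muln2 PoszM; congr (q ^ _); ring.
have [_] := weyl_filtered_H1 fT'; case: T modT {fT fT'} => d wt E F modT HE.
apply: (@H1_twist (dualE (udual q (MkUqmod wt E F))) _ _ _
  (fun n p => (-1) ^+ n * q ^ (n%:Z * (n%:Z + p + 1)))) HE => //.
- by move=> i; rewrite /= opprK.
- move=> n p x wx'; rewrite /= trmxK -scalemxAl -mulmxA.
  have wx : wv (MkUqmod wt E F) p x by move=> i /wx'; rewrite /= opprK.
  have wE := @umod_wvE _ _ _ modT n p x wx.
  rewrite (@uK_wv _ q (MkUqmod wt E F) (- n%:Z) _ _ wE) !scalerA.
  rewrite mulrACA -expr2 sqrr_sign mul1r exprnP -!(qexpD q0).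
  rewrite (_ : _ + _ = 0) ?expr0z ?scale1r //.
  by case: n {wE} => [|n]; rewrite -?muln2 ?PoszM ?intS /=; [rewrite !mul0r addr0|ring].
- by move=> n p; rewrite mulf_neq0 ?signr_eq0 ?expfz_neq0.
- move=> a n p; rewrite exprD mulrACA -(qexpD q0) PoszD -muln2 PoszM.
  by congr (_ * q ^ _); ring.
Qed.

End Filtrations.

(** * Direct summands and endomorphisms *)

Arguments wproj {k} M p x.

Section Summands.
Variables (k : fieldType) (q : k).
Hypothesis q0 : q != 0.
Implicit Types M N X P Y A B T : Uqmod k.

Lemma wv_usum A B p (x : 'cV_(udim A)) (y : 'cV_(udim B)) :
  wv (usum A B) p (col_mx x y) <-> wv A p x /\ wv B p y.
Proof.
split=> [w|[wx wy] i].
  split=> i nz.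
    have := w (lshift _ i); rewrite col_mxEu => /(_ nz).
    by rewrite {1}/uwt /usum (unsplitK (inl i)).
  have := w (rshift _ i); rewrite col_mxEd => /(_ nz).
  by rewrite {1}/uwt /usum (unsplitK (inr i)).
by rewrite mxE /=; case: splitP => j _; [exact: wx|exact: wy].
Qed.

Lemma uhom_inl A B : uhom A (usum A B) (col_mx 1%:M 0).
Proof.
split=> [p x wx|n|n] /=.
- by rewrite mul_col_mx mul1mx mul0mx; apply/wv_usum; split=> //; apply: wv0.
- by rewrite mul_block_col mul_col_mx !mulmx1 !mulmx0 !mul0mx mul1mx !addr0.
- by rewrite mul_block_col mul_col_mx !mulmx1 !mulmx0 !mul0mx mul1mx !addr0.
Qed.

Lemma uhom_inr A B : uhom B (usum A B) (col_mx 0 1%:M).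
Proof.
split=> [p x wx|n|n] /=.
- by rewrite mul_col_mx mul1mx mul0mx; apply/wv_usum; split=> //; apply: wv0.
- by rewrite mul_block_col mul_col_mx !mulmx1 !mulmx0 !mul0mx mul1mx !add0r.
- by rewrite mul_block_col mul_col_mx !mulmx1 !mulmx0 !mul0mx mul1mx !add0r.
Qed.

Lemma uhom_prl A B : uhom (usum A B) A (row_mx 1%:M 0).
Proof.
split=> [p x|n|n] /=.
- rewrite -[x]vsubmxK => /wv_usum[wx _].
  by rewrite mul_row_col mul1mx mul0mx addr0.
- by rewrite mul_row_block mul_mx_row !mul1mx !mulmx0 !mul0mx mulmx1 !addr0.
- by rewrite mul_row_block mul_mx_row !mul1mx !mulmx0 !mul0mx mulmx1 !addr0.
Qed.

Lemma uhom_prr A B : uhom (usum A B) B (row_mx 0 1%:M).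
Proof.
split=> [p x|n|n] /=.
- rewrite -[x]vsubmxK => /wv_usum[_ wx].
  by rewrite mul_row_col mul1mx mul0mx add0r.
- by rewrite mul_row_block mul_mx_row !mul1mx !mulmx0 !mul0mx mulmx1 !add0r.
- by rewrite mul_row_block mul_mx_row !mul1mx !mulmx0 !mul0mx mulmx1 !add0r.
Qed.

Lemma bip_usum A B : biproduct (usum A B) A B.
Proof.
apply: (Biproduct (uhom_inl A B) (uhom_prl A B) (uhom_inr A B) (uhom_prr A B)).
- by rewrite mul_row_col mul1mx mulmx0 addr0.
- by rewrite mul_row_col mul1mx mulmx0 add0r.
rewrite !mul_col_row !mul1mx !mul0mx add_block_mx !addr0 !add0r.
by rewrite -scalar_mx_block.
Qed.

Lemma bip0 m n d (i : 'M[k]_(d, m)) (p : 'M_(m, d)) (j : 'M_(d, n)) (r : 'M_(n, d)) :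
  p *m i = 1%:M -> r *m j = 1%:M -> i *m p + j *m r = 1%:M -> r *m i = 0 /\ p *m j = 0.
Proof.
move=> pi1 rj1 s1; split.
  have := congr1 (mulmx^~ i) s1; rewrite mulmxDl -!mulmxA pi1 mulmx1 mul1mx => /eqP.
  by rewrite -subr_eq0 addrAC subrr add0r => /eqP/(congr1 (mulmx r));
     rewrite mulmxA rj1 mul1mx mulmx0.
have := congr1 (mulmx^~ j) s1; rewrite mulmxDl -!mulmxA rj1 mulmx1 mul1mx => /eqP.
by rewrite -subr_eq0 addrK => /eqP/(congr1 (mulmx p)); rewrite mulmxA pi1 mul1mx mulmx0.
Qed.

Lemma bip_iso X A B : biproduct X A B <-> Uqiso q X (usum A B).
Proof.
split=> [[i p j r hi hp hj hr pi1 rj1 s1]|[f [g [hf hg gf fg]]]].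
  have [ri pj] := bip0 pi1 rj1 s1.
  exists (col_mx p r), (row_mx i j); split; last 2 first.
  - by rewrite mul_row_col.
  - by rewrite mul_col_row pi1 rj1 ri pj -scalar_mx_block.
  - apply/(uhomP q0).
    have -> : col_mx p r = col_mx 1%:M 0 *m p + col_mx 0 1%:M *m r.
      by rewrite !mul_col_mx !mul1mx !mul0mx add_col_mx addr0 add0r.
    by apply: uhomD; [apply: uhom_comp hp; exact: uhom_inl|apply: uhom_comp hr; exact: uhom_inr].
  apply/(uhomP q0).
  have -> : row_mx i j = i *m row_mx 1%:M 0 + j *m row_mx 0 1%:M.
    by rewrite !mul_mx_row !mulmx1 !mulmx0 add_row_mx addr0 add0r.
  by apply: uhomD; [apply: uhom_comp hi _; exact: uhom_prl|apply: uhom_comp hj _; exact: uhom_prr].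
have {}hf := (uhomP q0 f).1 hf; have {}hg := (uhomP q0 g).1 hg.
have [i p j r hi hp hj hr pi1 rj1 s1] := bip_usum A B.
apply: (Biproduct (uhom_comp hg hi) (uhom_comp hp hf) (uhom_comp hg hj) (uhom_comp hr hf)).
- by rewrite mulmxA -[p *m f *m g]mulmxA fg mulmx1.
- by rewrite mulmxA -[r *m f *m g]mulmxA fg mulmx1.
by rewrite -!mulmxA -mulmxDr [i *m _]mulmxA [j *m _]mulmxA -mulmxDl s1 mul1mx.
Qed.

Lemma bip_assoc X A X' B C : biproduct X A X' -> biproduct X' B C -> biproduct X (usum A B) C.
Proof.
move=> [i p j r hi hp hj hr pi1 rj1 s1] [i' p' j' r' hi' hp' hj' hr' pi1' rj1' s1'].
have [ri pj] := bip0 pi1 rj1 s1; have [ri' pj'] := bip0 pi1' rj1' s1'.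
have hI : uhom (usum A B) X (i *m row_mx 1%:M 0 + j *m i' *m row_mx 0 1%:M).
  apply: uhomD; first by apply: uhom_comp hi _; exact: uhom_prl.
  by apply: uhom_comp (uhom_comp hj hi') _; exact: uhom_prr.
have hP : uhom X (usum A B) (col_mx 1%:M 0 *m p + col_mx 0 1%:M *m (p' *m r)).
  apply: uhomD; first by apply: uhom_comp hp; exact: uhom_inl.
  by apply: uhom_comp (uhom_comp hp' hr); exact: uhom_inr.
apply: (Biproduct hI hP (uhom_comp hj hj') (uhom_comp hr' hr)).
- rewrite !mul_mx_row !mul_col_mx !mulmx1 !mulmx0 !mul1mx !mul0mx.
  rewrite add_row_mx add_col_mx !addr0 !add0r mul_col_row pi1.
  rewrite -[p' *m r *m i]mulmxA ri mulmx0 [p *m (j *m _)]mulmxA pj mul0mx.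
  by rewrite -mulmxA [r *m (j *m _)]mulmxA rj1 mul1mx pi1' -scalar_mx_block.
- by rewrite -mulmxA [r *m (j *m _)]mulmxA rj1 mul1mx.
rewrite !mul_mx_row !mul_col_mx !mulmx1 !mulmx0 !mul1mx !mul0mx.
rewrite add_row_mx add_col_mx !addr0 !add0r mul_row_col -addrA.
by rewrite -!mulmxA -mulmxDr [i' *m _]mulmxA [j' *m _]mulmxA -mulmxDl s1' mul1mx.
Qed.

(** The image of an idempotent endomorphism. A weight basis of it is found
    among the columns of its matrix. *)
Lemma split_idempotent M e : uhom M M e -> e *m e = e ->
  exists N (i : 'M_(udim M, udim N)) p,
    [/\ uhom N M i, uhom M N p, p *m i = 1%:M & i *m p = e].
Proof.
move=> he ee; pose f := maxrankfun e^T; pose I := rowsub f e^T.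
have /submxP[P eP] : (e^T <= I)%MS by rewrite /I eq_maxrowsub.
have /row_freeP[I' II'] : row_free I by apply: maxrowsub_free.
pose i := I^T; pose p := P^T.
have ip : i *m p = e by rewrite /i /p -trmx_mul -eP trmxK.
have iinj m (x y : 'M_(_, m)) : i *m x = i *m y -> x = y.
  move=> /(congr1 (mulmx I'^T)); rewrite !mulmxA /i -!trmx_mul II' trmx1.
  by rewrite !mul1mx.
have iE : i = e *m colsub f 1%:M.
  apply/matrixP => a b; rewrite !mxE (bigD1 (f b)) //= big1 ?addr0 => [|c ne].
    by rewrite !mxE eqxx mulr1.
  by rewrite !mxE (negPf ne) mulr0.
have ei : e *m i = i by rewrite {1}iE mulmxA ee -iE.
have pi1 : p *m i = 1%:M by apply: iinj; rewrite mulmxA ip ei mulmx1.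
pose N := MkUqmod (fun b => @uwt k M (f b)) (fun n => p *m uE M n *m i)
  (fun n => p *m uF M n *m i).
have we : forall a b, e a b != 0 -> @uwt k M a = @uwt k M b + 0.
  by apply/(@wv_mulmx _ M M e) => r x wx; rewrite addr0; apply: (uhom_wv he).
have iw : forall r x, wv N r x -> wv M r (i *m x).
  move=> r x wx; rewrite -[r]addr0; apply: (@wv_mulmx _ N M i 0).1 wx => a b.
  by rewrite !mxE => /we.
exists N, i, p; split=> //.
- split=> // n /=; rewrite !mulmxA ip.
    by rewrite (uhom_E he) -mulmxA ei.
  by rewrite (uhom_F he) -mulmxA ei.
have ew := uhom_wv he.
split=> [r x wx|n|n].
- suff <- : wproj N r (p *m x) = p *m x by apply: wv_wproj.
  apply: iinj; rewrite (wproj_mulmx _ _ iw) mulmxA ip wproj_id //; exact: ew.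
- apply: iinj; rewrite /= !mulmxA ip -[_ *m i *m p]mulmxA ip.
  by rewrite (uhom_E he) -[_ *m e *m e]mulmxA ee.
apply: iinj; rewrite /= !mulmxA ip -[_ *m i *m p]mulmxA ip.
by rewrite (uhom_F he) -[_ *m e *m e]mulmxA ee.
Qed.

Lemma bip_idempotent M e : uhom M M e -> e *m e = e ->
  exists N N' i p j r, [/\ uhom N M i, uhom M N p, uhom N' M j & uhom M N' r] /\
    [/\ p *m i = 1%:M, r *m j = 1%:M, i *m p = e & j *m r = 1%:M - e].
Proof.
move=> he ee.
have [N [i [p [hi hp pi1 ip]]]] := split_idempotent he ee.
have he' : uhom M M (1%:M - e) by apply: uhomB he; exact: uhom_id.
have [|N' [j [r [hj hr rj1 jr]]]] := split_idempotent he'.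
  by rewrite mulmxBl !mulmxBr !mul1mx mulmx1 ee subrr subr0.
by exists N, N', i, p, j, r.
Qed.

(** Fitting's lemma, for an operator f together with everything commuting
    with it: among the powers of f pick one, A, of least rank. Then A and A^2
    have the same image and the same kernel, and e = A Y = Z A with A^2 Y = A
    = Z A^2 is the projection onto the image along the kernel. *)
Lemma fitting d (f : 'M[k]_d) : exists e : 'M[k]_d, exists n : nat,
  [/\ e *m e = e, forall B : 'M[k]_d, f *m B = B *m f -> e *m B = B *m e,
      e = 0 -> f ^+ n = 0 & e = 1%:M -> f \in unitmx].
Proof.
have exr : exists r, `[< exists n, \rank (f ^+ n.+1) = r >].
  by exists (\rank (f ^+ 1)); apply/asboolP; exists 0%N.
case: (ex_minnP exr) => r /asboolP[n rn] minr.
pose A := f ^+ n.+1.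
have rA2 : \rank (A *m A) = \rank A.
  apply/eqP; rewrite eqn_leq mxrankM_maxl /= [X in (X <= _)%N]rn; apply: minr.
  by apply/asboolP; exists (n.+1 + n)%N; rewrite -addnS exprD mulmxE.
have [Z ZA] : exists Z, A = Z *m (A *m A).
  apply/submxP; rewrite -(geq_leqif (mxrank_leqif_sup _)) ?rA2 //.
  exact: submxMl.
have [Y AY] : exists Y : 'M[k]_d, A = A *m A *m Y.
  have : (A^T <= (A *m A)^T)%MS.
    rewrite -(geq_leqif (mxrank_leqif_sup _)) ?mxrank_tr ?rA2 //.
    by rewrite trmx_mul submxMl.
  by move=> /submxP[D E]; exists D^T; rewrite -[LHS]trmxK E trmx_mul trmxK.
have [e eY] : exists e, e = A *m Y by exists (A *m Y).
have eZ : e = Z *m A by rewrite eY [in LHS]ZA -mulmxA -AY.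
have eA : e *m A = A by rewrite eZ -mulmxA -ZA.
have Ae : A *m e = A by rewrite eY mulmxA -AY.
exists e, n.+1; split=> [|B fB|e0|e1].
- by rewrite {1}eZ -mulmxA Ae eZ.
- have AB : A *m B = B *m A by rewrite mulmxE; apply/esym; apply: (@commrX _ B f n.+1); apply/esym; rewrite -mulmxE.
  have eB : e *m B *m e = e *m B.
    by rewrite {1}eZ -(mulmxA Z A B) AB -!mulmxA Ae -AB mulmxA -eZ.
  have Be : e *m B *m e = B *m e.
    rewrite {2}eY mulmxA -(mulmxA e B A) -AB mulmxA eA AB -mulmxA.
    by rewrite -eY.
  by rewrite -eB Be.
- by rewrite -/A -eA e0 mul0mx.
have /mulmx1_unit[] : Z *m f ^+ n *m f = 1%:M; last by [].
by rewrite -mulmxA mulmxE -exprSr -mulmxE -/A -eZ e1.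
Qed.

(** The idempotent of Fitting's lemma is a homomorphism, since it commutes with
    everything that commutes with f; so it is 0 or 1. *)
Lemma indecomposable_fitting T f : indecomposable q T -> uhom T T f ->
  f \in unitmx \/ exists n, f ^+ n = 0.
Proof.
move=> [/(umodP q0) modT _ indec] hf.
have [e [n [ee eB e0 e1]]] := fitting f.
have he : uhom T T e.
  apply/(uhomP q0); have [fK fb fE fF] := (uhomP q0 f).2 hf.
  by split=> *; apply: eB.
have [N [N' [i [p [j [r [[hi hp hj hr] [pi1 rj1 ip jr]]]]]]]] := bip_idempotent he ee.
have modN : umod q N := umod_retract hi hp pi1 modT.
have modN' : umod q N' := umod_retract hj hr rj1 modT.
have iso : Uqiso q T (usum N N').
  by apply/bip_iso; apply: (Biproduct hi hp hj hr pi1 rj1); rewrite ip jr addrC subrK.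
have [d0|d0] := indec _ _ ((umodP q0 N).2 modN) ((umodP q0 N').2 modN') iso.
  right; exists n; apply: e0; rewrite -ip; apply/matrixP => a b; rewrite !mxE.
  by rewrite big1 // => c; have := ltn_ord c; rewrite {2}d0.
left; apply: e1; apply/esym/eqP; rewrite -subr_eq0 -jr; apply/eqP/matrixP => a b.
by rewrite !mxE big1 // => c; have := ltn_ord c; rewrite {2}d0.
Qed.

(** The row space of largest dimension among those on which P holds. *)
Lemma subspace_basis n (P : 'rV[k]_n -> Prop) :
  P 0 -> (forall c u v, P u -> P v -> P (c *: u + v)) ->
  exists B : 'M[k]_n, forall v, P v <-> (v <= B)%MS.
Proof.
move=> P0 PD.
have exr : exists r, `[< exists2 B : 'M[k]_n, \rank B = r & forall v, (v <= B)%MS -> P v >].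
  exists 0%N; apply/asboolP; exists 0; first exact: mxrank0.
  by move=> v; rewrite submx0 => /eqP ->.
have bdr r : `[< exists2 B : 'M[k]_n, \rank B = r & forall v, (v <= B)%MS -> P v >] -> (r <= n)%N.
  by move/asboolP => [B <- _]; exact: rank_leq_col.
case: (ex_maxnP exr bdr) => r /asboolP[B rB PB] maxr.
exists B => v; split=> [Pv|]; last exact: PB.
suff : (\rank (B + v)%MS <= \rank B)%N.
  rewrite (geq_leqif (mxrank_leqif_sup (addsmxSl B v))); apply: submx_trans.
  exact: addsmxSr.
rewrite rB; apply: maxr; apply/asboolP; exists (B + v)%MS => // u /sub_addsmxP[[a c] ->] /=.
rewrite addrC [c]mx11_scalar mul_scalar_mx; apply: PD => //.
by apply: PB; apply: submxMl.
Qed.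

(** Highest weight vectors as rows, so that they form a row space; for the
    module [rho q X] they are the highest weight functionals on X. *)
Definition hw X s (v : 'rV[k]_(udim X)) := hwv X s v^T.
Arguments hw : clear implicits.

Lemma hw_basis X s : exists B : 'M[k]_(udim X), forall v, hw X s v <-> (v <= B)%MS.
Proof.
apply: subspace_basis => [|c u v [wu Eu] [wv' Ev]]; rewrite /hw.
  by rewrite trmx0; split=> [|n]; [exact: wv0|rewrite mulmx0].
rewrite trmx_D trmx_Z; split=> [|n]; first by apply: wvD => //; apply: wvZ.
by rewrite mulmxDr -scalemxAr Eu Ev scaler0 addr0.
Qed.

Lemma hwZ X s c u : hw X s u -> hw X s (c *: u).
Proof.
move=> [wu Eu]; rewrite /hw trmx_Z; split=> [|n]; first exact: wvZ.
by rewrite -scalemxAr Eu scaler0.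
Qed.

Lemma hwD X s u v : hw X s u -> hw X s v -> hw X s (u + v).
Proof.
move=> [wu Eu] [wv' Ev]; rewrite /hw trmx_D; split=> [|n]; first exact: wvD.
by rewrite mulmxDr Eu Ev addr0.
Qed.

Definition hwB X s := sval (cid (hw_basis X s)).

Lemma hwBP X s v : hw X s v <-> (v <= hwB X s)%MS.
Proof. exact: (svalP (cid (hw_basis X s))). Qed.

(** The rank of the pairing between the homomorphisms from Delta(s) to X and
    those from X to nabla(s). *)
Definition pairing_rank X s := \rank (hwB X s *m (hwB (rho q X) s)^T).

Lemma hwv_hom M N f s x : uhom M N f -> hwv M s x -> hwv N s (f *m x).
Proof.
move=> hf [wx Ex]; split=> [|n]; first exact: (uhom_wv hf).
by rewrite -(uhom_Ev _ _ hf) Ex mulmx0.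
Qed.

Lemma hw_hom M N f s x : uhom M N f -> hw M s x -> hw N s (x *m f^T).
Proof. by move=> hf hx; rewrite /hw trmx_mul trmxK; apply: hwv_hom. Qed.

Lemma hwf_hom M N f s x : uhom M N f -> hw (rho q N) s x -> hw (rho q M) s (x *m f).
Proof.
by move=> hf hx; have := hw_hom (uhom_trmx q0 hf) hx; rewrite trmxK.
Qed.

Lemma pairing_rank_eq X s m n (B : 'M[k]_(m, udim X)) (B' : 'M[k]_(n, udim X)) :
  (forall v, hw X s v <-> (v <= B)%MS) -> (forall v, hw (rho q X) s v <-> (v <= B')%MS) ->
  pairing_rank X s = \rank (B *m B'^T).
Proof.
move=> HB HB'.
have eqv m1 m2 (C : 'M[k]_(m1, udim X)) (D : 'M[k]_(m2, udim X)) :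
    (forall v : 'rV_(udim X), (v <= C)%MS <-> (v <= D)%MS) -> (C :=: D)%MS.
  move=> E; apply/eqmxP/andP; split; apply/row_subP => i; apply/E; exact: row_sub.
have E1 : (hwB X s :=: B)%MS by apply: eqv => v; rewrite -HB -hwBP.
have E2 : (hwB (rho q X) s :=: B')%MS by apply: eqv => v; rewrite -HB' -hwBP.
rewrite /pairing_rank (eqmxMr _ E1) -[in LHS]mxrank_tr -[in RHS]mxrank_tr !trmx_mul !trmxK.
by rewrite (eqmxMr _ E2).
Qed.

(** Vectors and functionals both decompose, and the mixed pairings vanish: the
    pairing matrix is block diagonal. *)
Lemma pairing_rank_bip X A B s : biproduct X A B ->
  pairing_rank X s = (pairing_rank A s + pairing_rank B s)%N.
Proof.
move=> [i p j r hi hp hj hr pi1 rj1 s1]; have [ri pj] := bip0 pi1 rj1 s1.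
pose C := col_mx (hwB A s *m i^T) (hwB B s *m j^T).
pose C' := col_mx (hwB (rho q A) s *m p) (hwB (rho q B) s *m r).
rewrite (@pairing_rank_eq X s _ _ C C').
- rewrite /C /C' tr_col_mx mul_col_row !trmx_mul.
  rewrite !mulmxA -!(mulmxA _ _ p^T) -!(mulmxA _ _ r^T) -!trmx_mul pi1 rj1 ri pj.
  by rewrite !trmx1 !trmx0 !mulmx1 !mulmx0 !mul0mx rank_diag_block_mx.
- move=> v; rewrite -addsmxE; split=> [hv|/sub_addsmxP[[a c] ->] /=].
    have -> : v = v *m p^T *m i^T + v *m r^T *m j^T.
      by rewrite -!mulmxA -!trmx_mul -mulmxDr -linearD /= s1 trmx1 mulmx1.
    apply: addmx_sub_adds; apply: submxMr; apply/hwBP; exact: hw_hom hv.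
  rewrite !mulmxA; apply: hwD; apply: hw_hom => //; apply/hwBP; exact: submxMl.
- move=> v; rewrite -addsmxE; split=> [hv|/sub_addsmxP[[a c] ->] /=].
    have -> : v = v *m i *m p + v *m j *m r by rewrite -!mulmxA -mulmxDr s1 mulmx1.
    apply: addmx_sub_adds; apply: submxMr; apply/hwBP; exact: hwf_hom hv.
  rewrite !mulmxA; apply: hwD; apply: hwf_hom => //; apply/hwBP; exact: submxMl.
Qed.

Lemma usum_pow_pairing_rank T s c : (c * pairing_rank T s <= pairing_rank (usum_pow T c) s)%N.
Proof.
elim: c => // c IHc; rewrite (pairing_rank_bip s (bip_usum T (usum_pow T c))).
by rewrite mulSn leq_add2l.
Qed.

(** Suppose x and xi are a highest weight vector and functional in the
    indecomposable tilting module T of highest weight m, with xi x = 1. As T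
    and its dual are unobstructed, x extends to V^m -> T and xi to T -> V^m;
    the composite T -> T fixes x and so is invertible. Hence the weight space
    of weight m in T is a line, and an endomorphism of T not killing it is
    invertible. *)
Lemma Tq_top m T : is_Tq q m T ->
  biunobstructed q T /\ exists x : 'cV_(udim T), exists xi : 'rV_(udim T),
  [/\ hwv T m%:Z x, hw (rho q T) m%:Z xi, xi *m x = 1%:M,
      forall y, wv T m%:Z y -> exists c, y = c *: x &
      forall f, uhom T T f -> xi *m f *m x != 0 -> f \in unitmx].
Proof.
move=> [indec tiltT [[i0 wti0] wtle]].
have isT : is_Uqmod q T by case: indec.
have modT := (umodP q0 T).1 isT.
have tT : biunobstructed q T by apply: tilting_biunobstructed.
split=> //; pose x : 'cV[k]_(udim T) := delta_mx i0 0.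
pose xi : 'rV[k]_(udim T) := delta_mx 0 i0; exists x, xi.
have top p (y : 'cV_(udim T)) : wv T p y -> m%:Z < p -> y = 0.
  move=> wy ltmp; apply/colP => i; rewrite mxE.
  have [//|/wy E] := eqVneq (y i 0) 0.
  by have := wtle i; rewrite E leNgt ltmp.
have wx : wv T m%:Z x by rewrite -wti0; apply: wv_delta.
have hx : hwv T m%:Z x.
  split=> // n; apply: (top _ _ (@umod_wvE _ _ _ modT n.+1 _ _ wx)); lia.
have hxi : hw (rho q T) m%:Z xi.
  have wxi : wv (rho q T) m%:Z xi^T by rewrite trmx_delta -wti0; apply: (@wv_delta _ (rho q T)).
  split=> // n; have [_ [modr _]] := tT.
  apply: (top _ _ (@umod_wvE _ _ _ modr n.+1 _ _ wxi)); lia.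
have xix : xi *m x = 1%:M.
  by apply/matrixP => a b; rewrite !ord1 /xi /x mul_delta_mx !mxE.
have [g hg gx] := hwv_extend q0 tT.1 hx.
have [h hh hxiE] := hwf_extend q0 tT hxi.
have hgx (y : 'cV_(udim T)) : wv T m%:Z y -> exists c, h *m y = c *: vtop q m.
  by move=> wy; apply: (Vpow_top q0); apply: (uhom_wv hh).
have hxtop : h *m x = vtop q m.
  have [c E] := hgx x wx; have := xix; rewrite -hxiE -mulmxA E -scalemxAr vtopT.
  by move=> /matrixP/(_ 0 0); rewrite !mxE mulr1 => ->; rewrite scale1r.
have notnil f c : f *m x = c *: x -> c != 0 -> forall n, f ^+ n != 0.
  move=> fx c0 n; have fnx : f ^+ n *m x = c ^+ n *: x.
    elim: n => [|n IHn]; first by rewrite expr0 mul1mx expr0 scale1r.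
    by rewrite exprS -mulmxE -mulmxA IHn -scalemxAr fx scalerA -exprSr.
  apply/eqP => fn0; have /matrixP/(_ i0 0) := fnx; rewrite fn0 mul0mx !mxE !eqxx.
  by rewrite mulr1 => /esym/eqP; rewrite (negPf (expf_neq0 _ c0)).
have unit1 f c : uhom T T f -> f *m x = c *: x -> c != 0 -> f \in unitmx.
  move=> hf fx c0; have [//|[n fn0]] := indecomposable_fitting indec hf.
  by have := notnil f c fx c0 n; rewrite fn0 eqxx.
have line y : wv T m%:Z y -> exists c, y = c *: x.
  move=> wy; have [c E] := hgx y wy; exists c.
  have gu : g *m h \in unitmx.
    by apply: (unit1 _ 1 (uhom_comp hg hh)); rewrite ?oner_neq0 // -mulmxA hxtop gx scale1r.
  apply: (can_inj (mulKmx gu)); rewrite -mulmxA E -!scalemxAr gx.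
  by rewrite -mulmxA hxtop gx.
split=> // f hf; have [c fx] := line _ (uhom_wv hf wx).
rewrite -mulmxA fx -scalemxAr xix => nz; apply: (unit1 _ c) => //.
by apply: contra nz => /eqP ->; rewrite scale0r.
Qed.

End Summands.

(** * Multiplicities of tilting summands *)

Arguments hw {k} X s v.

Section Multiplicity.
Variables (k : fieldType) (q : k).
Hypothesis q0 : q != 0.
Implicit Types M N X P Y A B T : Uqmod k.

Lemma wv_pair0 M p s (z : 'cV_(udim M)) (xi : 'rV_(udim M)) :
  wv M p z -> wv M s xi^T -> p != s -> xi *m z = 0.
Proof.
move=> wz wxi ne; apply/matrixP => i j; rewrite !ord1 !mxE big1 // => l _.
have [->|nz] := eqVneq (xi 0 l) 0; first by rewrite mul0r.
have [->|nz'] := eqVneq (z l 0) 0; first by rewrite mulr0.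
by case/eqP: ne; rewrite -(wz l nz') -(wxi l) ?mxE.
Qed.

Lemma vtop_functional m T (g : 'M_(udim T, udim (Vpow q m))) (xi : 'rV_(udim T)) :
  uhom (Vpow q m) T g -> wv T m%:Z xi^T -> xi *m g *m vtop q m = 1%:M ->
  xi *m g = (vtop q m)^T.
Proof.
move=> hg wxi xig; apply: (@wv_mx_eq _ (Vpow q m)) => p y wy.
have [pm|ne] := eqVneq p m%:Z.
  rewrite pm in wy; have [c ->] := Vpow_top q0 wy.
  by rewrite -!scalemxAr xig vtopT.
rewrite -mulmxA (wv_pair0 (uhom_wv hg wy) wxi ne) (wv_pair0 wy _ ne) // trmxK.
exact: wv_vtop.
Qed.

Lemma pairing_rank_pair X s : (0 < pairing_rank q X s)%N ->
  exists y : 'cV_(udim X), exists eta : 'rV_(udim X),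
    [/\ hwv X s y, hw (rho q X) s eta & eta *m y != 0].
Proof.
rewrite lt0n mxrank_eq0 => /matrix0Pn[i [j nij]].
exists (row i (hwB X s))^T, (row j (hwB (rho q X) s)); split.
- by have /hwBP := row_sub i (hwB X s).
- by apply/hwBP; exact: row_sub.
apply/eqP => /(congr1 trmx); rewrite trmx_mul trmxK trmx0 => /matrixP/(_ 0 0) E.
case/eqP: nij; move: E; rewrite !mxE => E; rewrite -[RHS]E.
by apply: eq_bigr => l _; rewrite !mxE.
Qed.

Lemma uhom_invmx M f : uhom M M f -> f \in unitmx -> uhom M M (invmx f).
Proof.
move=> hf uf; have fw := uhom_wv hf.
split=> [p y wy|n|n].
- suff <- : wproj M p (invmx f *m y) = invmx f *m y by apply: wv_wproj.
  by apply: (can_inj (mulKmx uf)); rewrite (wproj_mulmx _ _ fw) mulKVmx // wproj_id.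
- by apply: (can_inj (mulKmx uf)); rewrite (mulKVmx uf) mulmxA (uhom_E hf) mulmxK.
by apply: (can_inj (mulKmx uf)); rewrite (mulKVmx uf) mulmxA (uhom_F hf) mulmxK.
Qed.

Section FixT.
Variables (m : nat) (T : Uqmod k) (x : 'cV[k]_(udim T)) (xi : 'rV[k]_(udim T)).
Hypotheses (tT : biunobstructed q T) (hx : hwv T m%:Z x) (hxi : hw (rho q T) m%:Z xi).
Hypothesis xix : xi *m x = 1%:M.

(** Extend xi to T -> V^m and y to V^m -> X, and compose. *)
Lemma lift_hwv X y : biunobstructed q X -> hwv X m%:Z y -> exists2 a, uhom T X a & a *m x = y.
Proof.
move=> tX hy; have [h hh Eh] := hwf_extend q0 tT hxi.
have [f hf Ef] := hwv_extend q0 tX.1 hy.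
exists (f *m h); first exact: uhom_comp.
have [c E] := Vpow_top q0 (uhom_wv hh hx.1).
have := xix; rewrite -Eh -mulmxA E -scalemxAr vtopT => /matrixP/(_ 0 0).
by rewrite !mxE mulr1 -mulmxA E => ->; rewrite scale1r.
Qed.

Lemma lift_hwf X eta : biunobstructed q X -> hw (rho q X) m%:Z eta ->
  exists2 b, uhom X T b & xi *m b = eta.
Proof.
move=> tX heta; have [g hg Eg] := hwv_extend q0 tT.1 hx.
have [h hh Eh] := hwf_extend q0 tX heta.
exists (g *m h); first exact: uhom_comp.
by rewrite mulmxA (vtop_functional hg hxi.1) // -mulmxA Eg.
Qed.

Hypothesis line : forall y, wv T m%:Z y -> exists c, y = c *: x.
Hypothesis unitT : forall f, uhom T T f -> xi *m f *m x != 0 -> f \in unitmx.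

Lemma pairing_rank_top : pairing_rank q T m%:Z = 1%N.
Proof.
apply/eqP; rewrite eqn_leq; apply/andP; split.
  apply: leq_trans (mxrankM_maxl _ _) _; apply: leq_trans (rank_leq_row x^T).
  apply: mxrankS; apply/row_subP => i.
  have [wr _] : hw T m%:Z (row i (hwB T m%:Z)) by apply/hwBP; exact: row_sub.
  by have [c E] := line wr; rewrite -[row i _]trmxK E trmx_Z scalemx_sub.
rewrite lt0n mxrank_eq0; apply/eqP => z.
have hx' : hw T m%:Z x^T by rewrite /hw trmxK.
have /hwBP/submxP[u Eu] := hx'; have /hwBP/submxP[v Ev] := hxi.
have : x^T *m xi^T = 0 by rewrite Eu Ev trmx_mul -mulmxA [_ *m (_ *m v^T)]mulmxA z mul0mx mulmx0.
by rewrite -trmx_mul xix trmx1 => /matrixP/(_ 0 0)/eqP; rewrite !mxE oner_eq0.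
Qed.

(** A vector and a functional on X with nonzero pairing lift to T -> X -> T; the
    composite does not kill the highest weight space, so it is invertible. *)
Lemma split_top X : biunobstructed q X -> (0 < pairing_rank q X m%:Z)%N ->
  exists2 X', biproduct X T X' & biunobstructed q X'.
Proof.
move=> tX /pairing_rank_pair[y [eta [hy heta nz]]].
have [a ha ax] := lift_hwv tX hy; have [b hb xib] := lift_hwf tX heta.
have hba : uhom T T (b *m a) by apply: uhom_comp.
have uba : b *m a \in unitmx.
  by apply: unitT => //; rewrite mulmxA xib -mulmxA ax.
pose p := invmx (b *m a) *m b.
have hp : uhom X T p by apply: uhom_comp hb; apply: uhom_invmx.
have pa : p *m a = 1%:M by rewrite -mulmxA mulVmx.
have he : uhom X X (1%:M - a *m p) by apply: uhomB; [exact: uhom_id|exact: uhom_comp].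
have ee : (1%:M - a *m p) *m (1%:M - a *m p) = 1%:M - a *m p.
  rewrite mulmxBl !mulmxBr !mul1mx mulmx1 -[a *m p *m _]mulmxA [p *m (a *m p)]mulmxA.
  by rewrite pa mul1mx subrr subr0.
have [X' [j [r [hj hr rj1 jr]]]] := split_idempotent he ee.
exists X'; last exact: (biunobstructed_retract q0 hj hr rj1 tX).
by apply: (Biproduct ha hp hj hr pa rj1); rewrite jr addrC subrK.
Qed.

Lemma split_pow X n : biunobstructed q X -> pairing_rank q X m%:Z = n ->
  exists2 X', biproduct X (usum_pow T n) X' & umod q X'.
Proof.
elim: n X => [|n IHn] X tX rX.
  exists X; last exact: tX.1.1.
  have no (i : 'I_0) : False by case: i.
  apply: (@Biproduct _ X (uzero k) X 0 0 1%:M 1%:M).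
  - by split=> [p z _|n|n]; rewrite ?mul0mx ?mulmx0 //; exact: wv0.
  - by split=> [p z _|n|n]; rewrite ?mul0mx ?mulmx0 //; exact: wv0.
  - exact: uhom_id.
  - exact: uhom_id.
  - by apply/matrixP => i; case: (no i).
  - by rewrite mulmx1.
  - by rewrite mulmx1 mul0mx add0r.
have [|X' bX tX'] := split_top tX; first by rewrite rX.
have rX' : pairing_rank q X' m%:Z = n.
  by have := pairing_rank_bip q0 m%:Z bX; rewrite rX pairing_rank_top add1n => -[].
have [X'' bX' mX''] := IHn _ tX' rX'.
by exists X'' => //; exact: bip_assoc bX bX'.
Qed.

End FixT.

(** Each summand T contributes 1 to the rank by [pairing_rank_top], and T can be
    split off until the rank is 0. *)
Lemma summand_mult_pairing_rank m T X : is_Tq q m T -> biunobstructed q X ->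
  summand_mult q X T = pairing_rank q X m%:Z.
Proof.
move=> isT tX; have [tT [x [xi [hx hxi xix line unitT]]]] := Tq_top q0 isT.
apply/eqP; rewrite eqn_leq; apply/andP; split.
  apply/bigmax_leqP => c /asboolP[X' [_ /(bip_iso q0) bX]].
  rewrite (pairing_rank_bip q0 _ bX); apply: leq_trans (leq_addr _ _).
  by have := usum_pow_pairing_rank q0 T m%:Z c; rewrite (pairing_rank_top hx hxi xix line) muln1.
have le_n : (pairing_rank q X m%:Z < (udim X).+1)%N by rewrite ltnS; exact: rank_leq_row.
apply: (@leq_bigmax_cond _ _ (fun c : 'I_(udim X).+1 => c : nat) (Ordinal le_n)).
have [X' bX mX'] := split_pow tT hx hxi xix line unitT tX erefl.
by apply/asboolP; exists X'; split; [exact/(umodP q0)|exact/(bip_iso q0)].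
Qed.

(** Interpolates between V^2r and W^r, two factors V being replaced by one W
    at a time. *)
Fixpoint WV i j := if i is i'.+1 then utens q (Wq q) (WV i' j) else Vpow q j.*2.

Lemma WV_bip i j : q + q^-1 != 0 -> biproduct (WV i j.+1) (WV i.+1 j) (WV i j).
Proof.
move=> q2; elim: i => [|i IHi]; first exact: (bip_VV q0 _ q2).
exact: bip_tensr.
Qed.

(** By [WV_bip] the ranks D i j for W^i (x) V^2j satisfy
    D (i+1) j = D i (j+1) - D i j; the formula is the i-th iterated
    difference. *)
Lemma pairing_rank_Wpow r s : q + q^-1 != 0 ->
  (pairing_rank q (Wpow q r) s)%:Z =
  \sum_(i < r.+1) (-1) ^+ i * ('C(r, i) * pairing_rank q (Vpow q (r - i).*2) s)%:Z.
Proof.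
move=> q2; pose D i j := (pairing_rank q (WV i j) s)%:Z.
have DD i j : D i.+1 j = D i j.+1 - D i j.
  by rewrite /D (pairing_rank_bip q0 s (WV_bip i j q2)) PoszD addrK.
have sol i j : D i j = \sum_(l < i.+1) (-1) ^+ l * 'C(i, l)%:Z * D 0%N (j + (i - l))%N.
  elim: i j => [|i IHi] j; first by rewrite big_ord1 bin0 expr0 !mul1r addn0.
  rewrite DD !IHi big_ord_recl [RHS]big_ord_recl !bin0 !subn0 -addrA addSnnS; congr (_ + _).
  rewrite [X in X - _](_ : _ =
    \sum_(l < i.+1) (-1) ^+ l.+1 * 'C(i, l.+1)%:Z * D 0%N (j + (i - l))%N); last first.
    rewrite big_ord_recr /= bin_small // mulr0 mul0r addr0; apply: eq_bigr => l _.
    by rewrite /bump /= add1n addSnnS subnSK.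
  rewrite -sumrN -big_split; apply: eq_bigr => l _ /=.
  by rewrite /bump /= add1n subSS binS PoszD exprS; ring.
have <- : WV r 0 = Wpow q r by elim: (r) => //= r' ->.
rewrite -[LHS]/(D r 0%N) sol; apply: eq_bigr => i _.
by rewrite add0n -mulrA.
Qed.

End Multiplicity.

(** * Homomorphisms from Weyl modules and to their duals *)

Section WeylHoms.
Variables (k : fieldType) (q : k).
Hypothesis q0 : q != 0.
Implicit Types M N X : Uqmod k.

Definition e0 s : 'cV[k]_s.+1 := delta_mx ord0 0.

Lemma weyl_F_e0 s (j : 'I_s.+1) : uF (weyl q s) j *m e0 s = delta_mx j 0.
Proof.
rewrite /e0 -colE; apply/matrixP => i c; rewrite !mxE /= add0n val_eqE.
by case: eqP => [->|_]; rewrite ?(qbinnn q0) ord1 //= eqxx.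
Qed.

Lemma weyl_hom_eq s m (f g : 'M[k]_(m, s.+1)) :
  (forall j : 'I_s.+1, f *m (uF (weyl q s) j *m e0 s) = g *m (uF (weyl q s) j *m e0 s)) ->
  f = g.
Proof.
move=> E; apply/matrixP => i j; have := E j; rewrite weyl_F_e0 -!colE.
by move=> /matrixP/(_ i 0); rewrite !mxE.
Qed.

Lemma weyl_hom_inj s X f g : uhom (weyl q s) X f -> uhom (weyl q s) X g ->
  f *m e0 s = g *m e0 s -> f = g.
Proof.
move=> hf hg E; apply: weyl_hom_eq => j.
by rewrite !mulmxA (uhom_F hf) (uhom_F hg) -!mulmxA E.
Qed.

Lemma hwv_e0 s : hwv (weyl q s) s%:Z (e0 s).
Proof.
split=> [|n].
  by have := @wv_delta k (weyl q s) ord0; rewrite /= subr0.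
by rewrite /e0 -colE; apply/matrixP => i c; rewrite !mxE /= addnS.
Qed.

(** The universal property of Weyl modules. The map F^(j) v_0 |-> F^(j) x, j <= s,
    commutes with E by the commutation relation, and with F because
    F^(j) x = 0 for j > s. *)
Lemma weyl_hom s X x : umod q X -> hwv X s%:Z x ->
  exists2 f, uhom (weyl q s) X f & f *m e0 s = x.
Proof.
move=> modX hx; have [wx Ex] := hx.
pose f : 'M[k]_(udim X, s.+1) := \matrix_(a, j) (uF X j *m x) a 0.
have fe (j : 'I_s.+1) : f *m delta_mx j 0 = uF X j *m x.
  by rewrite -colE; apply/colP => a; rewrite !mxE.
have col_eq (A : 'M[k]_(udim X, s.+1)) j : A *m delta_mx j 0 = col j A.
  by rewrite colE.
exists f; last by rewrite /e0 fe /= (umod_F0 modX).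
split=> [p y wy|n|n].
- have wf : forall (i : 'I_(udim X)) (j : 'I_(udim (weyl q s))),
      f i j != 0 -> @uwt k X i = @uwt k (weyl q s) j + 0.
    move=> i j; rewrite mxE => nz; rewrite addr0.
    exact: (@umod_wvF _ _ _ modX j _ _ wx i).
  by rewrite -[p]addr0; apply: (@wv_mulmx _ (weyl q s) X f 0).1 wy.
- apply: (@weyl_hom_eq s) => j; rewrite weyl_F_e0 -!mulmxA fe.
  rewrite (@umod_EF _ _ _ modX _ _ _ _ wx) /EFsum.
  have -> : uE (weyl q s) n *m delta_mx j 0 =
      if (n <= j)%N then qbin q (s - j + n) n *: (delta_mx (inord (j - n)) 0 : 'cV_s.+1) else 0.
    rewrite -colE; apply/colP => i; rewrite !mxE /=.
    case: leqP => [le_nj|lt_jn]; last first.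
      by rewrite mxE; case: eqP => // E; exfalso; lia.
    have lt_s : (j - n < s.+1)%N by have := ltn_ord j; lia.
    rewrite !mxE andbT -val_eqE /= inordK //.
    have -> : (j == i + n :> nat)%N = (i == j - n :> nat)%N by apply/eqP/eqP; lia.
    case: eqP => [->|_]; last by rewrite mulr0.
    by rewrite mulr1; congr (qbin q _ _); have := ltn_ord j; lia.
  case: leqP => [le_nj|lt_jn]; last first.
    rewrite mulmx0 big1 // => t _.
    have -> : (n - t = (n - t).-1.+1)%N by have := ltn_ord t; lia.
    by rewrite Ex mulmx0 scaler0.
  have lt_s : (j - n < s.+1)%N by have := ltn_ord j; lia.
  rewrite -scalemxAr fe inordK // big_ord_recr /= big1 ?add0r.
    rewrite subnn (umod_E0 modX); congr (_ *: _).
    have -> : s%:Z + n%:Z - j%:Z = (s - j + n)%N%:Z by have := ltn_ord j; lia.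
    by [].
  move=> t _; have -> : (n - t = (n - t).-1.+1)%N by have := ltn_ord t; lia.
  by rewrite Ex mulmx0 scaler0.
apply: (@weyl_hom_eq s) => j; rewrite weyl_F_e0 -!mulmxA fe (umod_FF modX).
have -> : uF (weyl q s) n *m delta_mx j 0 =
    if (n + j <= s)%N then qbin q (n + j) n *: (delta_mx (inord (n + j)) 0 : 'cV_s.+1) else 0.
  rewrite -colE; apply/colP => i; rewrite !mxE /= addnC.
  case: leqP => [le_s|lt_s]; last first.
    rewrite mxE; case: eqP => // E.
    have lt_nj : (n + j < s.+1)%N by rewrite -E; exact: (ltn_ord i).
    by exfalso; lia.
  rewrite !mxE andbT -val_eqE /= inordK //; case: eqP => [->|_]; last by rewrite mulr0.
  by rewrite mulr1.
case: leqP => [le_s|lt_s]; first by rewrite -scalemxAr fe inordK.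
by rewrite mulmx0 (hwv_F q0 modX hx) ?scaler0 //; lia.
Qed.

(** The dual Weyl module formed with the antipode is the one formed with rho:
    reverse the basis and rescale it by powers of -q. *)
Definition rho_coweyl s : 'M[k]_s.+1 :=
  \matrix_(a, b) (if a == (s - b)%N :> nat then (- q) ^+ b else 0).

Lemma rho_coweylM s (A : 'M[k]_s.+1) (a b : 'I_s.+1) :
  (rho_coweyl s *m A) a b = (- q) ^+ (s - a) * A (inord (s - a)) b.
Proof.
have lt_s : (s - a < s.+1)%N by lia.
have := ltn_ord a => lt_a.
rewrite mxE (bigD1 (inord (s - a))) //= big1 ?addr0 => [|c ne].
  by rewrite !mxE inordK // subKn ?eqxx // -ltnS.
rewrite mxE; case: eqP => [E|]; last by rewrite mul0r.
by case/eqP: ne; apply: val_inj; rewrite /= inordK //; have := ltn_ord c; lia.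
Qed.

Lemma mul_rho_coweyl s (A : 'M[k]_s.+1) (a b : 'I_s.+1) :
  (A *m rho_coweyl s) a b = A a (inord (s - b)) * (- q) ^+ b.
Proof.
have lt_s : (s - b < s.+1)%N by lia.
rewrite mxE (bigD1 (inord (s - b))) //= big1 ?addr0 => [|c ne].
  by rewrite !mxE inordK // eqxx.
rewrite mxE; case: eqP => [E|]; last by rewrite mulr0.
by case/eqP: ne; apply: val_inj; rewrite /= inordK.
Qed.

Lemma rho_E_entry M n a b :
  uE (rho q M) n a b = q ^+ (n * n) * (q ^ (n%:Z * @uwt k M b) * uF M n b a).
Proof. by rewrite mxE mxE /uK mul_diag_mx mxE mxE. Qed.

Lemma rho_F_entry M n a b :
  uF (rho q M) n a b = q ^+ (n * n) * (q ^ (- n%:Z * @uwt k M b) * uE M n b a).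
Proof. by rewrite mxE mxE /uK mul_diag_mx mxE mxE. Qed.

Lemma udual_E_entry M n a b : uE (udual q M) n a b =
  (-1) ^+ n * q ^+ (n * n.-1) * (q ^ (- n%:Z * @uwt k M b) * uE M n b a).
Proof. by rewrite mxE mxE /uK mul_diag_mx mxE mxE. Qed.

Lemma udual_F_entry M n a b : uF (udual q M) n a b =
  (-1) ^+ n * q ^- (n * n.-1) * (uF M n b a * q ^ (n%:Z * @uwt k M a)).
Proof. by rewrite mxE mxE /uK mul_mx_diag mxE mxE. Qed.

Lemma uhom_rho_coweyl s : uhom (rho q (weyl q s)) (coweyl q s) (rho_coweyl s).
Proof.
have lt_s (a : 'I_s.+1) : (s - a < s.+1)%N by lia.
split=> [p x wx|n|n].
- have wf : forall (i : 'I_(udim (coweyl q s))) (j : 'I_(udim (rho q (weyl q s)))),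
      rho_coweyl s i j != 0 -> @uwt k (coweyl q s) i = @uwt k (rho q (weyl q s)) j + 0.
    move=> [i lt_i] [j lt_j]; rewrite mxE /=; case: ifP => [/eqP E _|]; last by rewrite eqxx.
    by rewrite /= in lt_j; lia.
  by rewrite -[p]addr0; apply: (@wv_mulmx _ _ _ _ 0).1 wx.
- apply/matrixP => -[a lt_a] [b lt_b]; rewrite rho_coweylM mul_rho_coweyl.
  have lt_sa : (s - a < s.+1)%N by lia.
  have lt_sb : (s - b < s.+1)%N by lia.
  have [lt_a' lt_b'] : (a < s.+1)%N /\ (b < s.+1)%N by [].
  rewrite (@rho_E_entry (weyl q s)) (@udual_E_entry (weyl q s)) !mxE /= !inordK //.
  have -> : (b == s - a + n)%N = (a == s - b + n)%N by apply/eqP/eqP; lia.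
  case: eqP => [E|_]; last by rewrite !(mulr0, mul0r).
  have -> : (s - (s - b) = b)%N by lia.
  have -> : b = (s - a + n)%N by lia.
  rewrite exprD [(- q) ^+ n]exprNn.
  have -> : (n * n = n * n.-1 + n)%N by case: (n) => // m; rewrite -mulnSr.
  rewrite [q ^+ (_ + _)]exprD.
  have -> : - n%:Z * (s%:Z - (s - (s - a + n)).*2%:Z) = n%:Z * (s%:Z - (s - a + n).*2%:Z).
    by rewrite mulNr -mulrN; congr (_ * _); lia.
  have S : (-1) ^+ n * (-1) ^+ n = 1 :> k by rewrite -expr2 sqrr_sign.
  move: S; set e := (-1) ^+ n => S; rewrite -[LHS]mul1r -{1}S; ring.
- apply/matrixP => -[a lt_a] [b lt_b]; rewrite rho_coweylM mul_rho_coweyl.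
  have lt_sa : (s - a < s.+1)%N by lia.
  have lt_sb : (s - b < s.+1)%N by lia.
  have [lt_a' lt_b'] : (a < s.+1)%N /\ (b < s.+1)%N by [].
  rewrite (@rho_F_entry (weyl q s)) (@udual_F_entry (weyl q s)) !mxE /= !inordK //.
  have -> : (s - a == b + n)%N = (s - b == a + n)%N by apply/eqP/eqP; lia.
  case: eqP => [E|_]; last by rewrite !(mulr0, mul0r).
  have -> : (s - a = b + n)%N by lia.
  rewrite exprD [(- q) ^+ n]exprNn.
  have -> : q ^+ (n * n) * (q ^ (- n%:Z * (s%:Z - b.*2%:Z)) * qbin q (s - b) n) =
      (q ^- (n * n.-1) * q ^ (n%:Z * (s%:Z - a.*2%:Z)) * q ^ (- n%:Z)) * qbin q (s - b) n.
    rewrite mulrA; congr (_ * _).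
    rewrite [q ^- _]exprnN exprnP -!(qexpD q0); congr (q ^ _).
    have -> : (n * n.-1)%N%:Z = n%:Z * n%:Z - n%:Z.
      by case: (n) => // m; rewrite PoszM intS /=; ring.
    have -> : s%:Z = b%:Z + a%:Z + n%:Z by lia.
    by rewrite -!muln2 !PoszM; ring.
  rewrite qexpN -exprnP; have := expf_neq0 n q0; set Q := q ^+ n => Q0.
  have := expf_neq0 (n * n.-1) q0; set Q2 := q ^+ (n * n.-1) => Q20.
  by field; rewrite Q0 Q20.
Qed.

Lemma coweyl_hom s X xi : umod q X -> hw (rho q X) s%:Z xi ->
  exists2 h, uhom X (coweyl q s) h & row ord_max h = xi.
Proof.
move=> modX hxi; have [f hf fe] := weyl_hom (umod_rho q0 modX) hxi.
exists (rho_coweyl s *m (f^T *m 1%:M)).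
  apply: uhom_comp (uhom_rho_coweyl s) _.
  by apply: uhom_comp (uhom_trmx q0 hf) (uhom_rho_rho q0 modX).2.
rewrite mulmx1 row_mul; apply/rowP => j.
rewrite !mxE (bigD1 ord0) //= big1 ?addr0 => [|c ne].
  rewrite !mxE /= subn0 eqxx expr0 mul1r.
  by have /colP/(_ j) := fe; rewrite /e0 -colE !mxE.
rewrite !mxE /=; case: eqP => [E|]; last by rewrite mul0r.
by case/eqP: ne; apply: val_inj => /=; have := ltn_ord c; lia.
Qed.

(** The last basis vector of nabla(s) is dual to the lowest weight vector of
    Delta(s), and spans the highest weight space of nabla(s). *)
Lemma coweyl_top s X h : uhom X (coweyl q s) h -> hw (rho q X) s%:Z (row ord_max h).
Proof.
move=> hh; pose e : 'rV[k]_s.+1 := delta_mx 0 ord_max.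
have he : hw (rho q (coweyl q s)) s%:Z e.
  rewrite /hw /e trmx_delta; split=> [|n].
    have := @wv_delta k (rho q (coweyl q s)) ord_max; congr wv; rewrite /=; lia.
  rewrite -colE; apply/matrixP => i c.
  rewrite mxE (@rho_E_entry (coweyl q s)) (@udual_F_entry (weyl q s)) !mxE /=.
  case: eqP => [E|_]; last by rewrite !(mul0r, mulr0).
  by have : (i < s.+1)%N := ltn_ord i; rewrite E; lia.
have := hwf_hom q0 hh he.
by rewrite /e -rowE.
Qed.

(** A composite Delta(s) -> X -> nabla(s) is determined by the image of the
    highest weight vector, which lies in the line of weight s of nabla(s);
    hence it vanishes as soon as the last coordinate does, and the last
    coordinates of the maps X -> nabla(s) are the highest weight functionals. *)
Lemma coweyl_pairing s X f : umod q X -> uhom (weyl q s) X f ->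
  (forall h, uhom X (coweyl q s) h -> h *m f = 0) <->
  (forall xi, hw (rho q X) s%:Z xi -> xi *m (f *m e0 s) = 0).
Proof.
move=> modX hf; split=> [zero xi hxi|zero h hh].
  have [h hh <-] := coweyl_hom modX hxi.
  by rewrite -row_mul mulmxA (zero h hh) mul0mx row0.
have hhf : uhom (weyl q s) (coweyl q s) (h *m f) by apply: uhom_comp.
apply: (weyl_hom_inj hhf (uhom0 _ _)); rewrite mul0mx -mulmxA.
have wtop : wv (coweyl q s) s%:Z (h *m (f *m e0 s)).
  by apply/(uhom_wv hh)/(uhom_wv hf); exact: (hwv_e0 s).1.
have := zero _ (coweyl_top hh); rewrite -row_mul => /rowP/(_ 0); rewrite !mxE => top0.
apply/colP => i; rewrite [RHS]mxE.
have [//|nz] := eqVneq ((h *m (f *m e0 s)) i 0) 0.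
have := wtop i nz => /= E.
have -> : i = ord_max; last by rewrite mxE.
by apply: val_inj => /=; have : (i < s.+1)%N := ltn_ord i; move: E; case: (i) => /= m _; lia.
Qed.

End WeylHoms.

(** * Simple modules over the endomorphism algebra *)

Arguments thru {k} P M N f.

Section EndoModules.
Variables (k : fieldType) (q : k) (r : nat).
Hypothesis q0 : q != 0.
Hypothesis q2 : q + q^-1 != 0.

Notation X := (Wpow q r).
Let tX : biunobstructed q X := biunobstructed_Wpow q0 r q2.
Let modX : umod q X := tX.1.1.

Lemma Uqhom_uhom M N (f : Uqhom q M N) : uhom M N (val f).
Proof. by case: f => f /= /Uqhom_predP/(uhomP q0). Qed.

Lemma uhom_Uqhom M N f : uhom M N f -> exists g : Uqhom q M N, val g = f.
Proof. by move=> /(uhomP q0)/Uqhom_predP pf; exists (Sub f pf); rewrite SubK. Qed.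

(** The highest weight vector of X corresponding to Delta(s) -> X. *)
Definition top s (f : C_W q r s) : 'cV[k]_(udim X) :=
  val (f : Uqhom q (weyl q s) X) *m e0 k s.

Lemma hwv_top s (f : C_W q r s) : hwv X s%:Z (top f).
Proof. exact: hwv_hom (Uqhom_uhom f) (hwv_e0 q s). Qed.

Lemma top_surj s x : hwv X s%:Z x -> exists f : C_W q r s, top f = x.
Proof.
move=> hx; have [f hf fe] := weyl_hom q0 modX hx.
by have [g gf] := uhom_Uqhom hf; exists g; rewrite /top gf.
Qed.

Lemma top_inj s (f g : C_W q r s) : top f = top g -> f = g.
Proof.
by move=> fg; apply: val_inj; apply: (weyl_hom_inj q0 (Uqhom_uhom f) (Uqhom_uhom g)).
Qed.

Lemma topZ s (a : Eq_W q r) (f : C_W q r s) : top (a *: f) = val a *m top f.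
Proof. by rewrite /top /= mulmxA. Qed.

Lemma topD s (f g : C_W q r s) : top (f + g) = top f + top g.
Proof. by rewrite /top /= mulmxDl. Qed.

Lemma top0 s : top (0 : C_W q r s) = 0.
Proof. by rewrite /top /= mul0mx. Qed.

Lemma C_W_radP s (f : C_W q r s) :
  C_W_rad f <-> forall xi, hw (rho q X) s%:Z xi -> xi *m top f = 0.
Proof.
rewrite -(coweyl_pairing q0 modX (Uqhom_uhom f)); split=> [rad h hh|zero h].
  by have [h' <-] := uhom_Uqhom hh; have /(congr1 val) := rad h'.
by apply: val_inj => /=; apply: zero; apply: Uqhom_uhom.
Qed.

Notation cls s := (@quotmod_class _ _ _ (C_W_rad_submodule q r s)).

Lemma L_W_ind s (P : L_W q r s -> Prop) : (forall f, P (cls s f)) -> forall x, P x.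
Proof. by move=> Pc x; rewrite -[x]quotmod_classK. Qed.

Lemma cls_eq0 s (f : C_W q r s) : cls s f = 0 <-> C_W_rad f.
Proof. by rewrite -(quotmod_class0 (C_W_rad_submodule q r s)) quotmod_classP subr0. Qed.

Lemma clsZ s (a : Eq_W q r) (f : C_W q r s) : a *: cls s f = cls s (a *: f).
Proof. exact: quotmod_classZ. Qed.

Lemma cls_neq0 s (f : C_W q r s) : cls s f != 0 ->
  exists2 xi, hw (rho q X) s%:Z xi & (xi *m top f) 0 0 = 1.
Proof.
move=> nz; have [xi hxi nz'] : exists2 xi, hw (rho q X) s%:Z xi & xi *m top f != 0.
  apply: contrapT => none; case/eqP: nz; apply/cls_eq0/C_W_radP => xi hxi.
  by apply/eqP/negPn/negP => nz; case: none; exists xi.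
have nz0 : (xi *m top f) 0 0 != 0.
  by apply: contra nz' => /eqP z; apply/eqP/matrixP => i j; rewrite !ord1 z mxE.
exists (((xi *m top f) 0 0)^-1 *: xi); last by rewrite -scalemxAl mxE mulVf.
exact: hwZ.
Qed.

(** Some highest weight functional takes the value 1 at f. Lift it to X -> V^s,
    lift the vector of g to V^s -> X, and compose. If s < s' then V^s has no
    vectors of weight s', so that the composite vanishes on C_W^r(s'). *)
Lemma transport s (f g : C_W q r s) : cls s f != 0 ->
  exists2 a : Eq_W q r, a *: f = g &
    forall s' (h : C_W q r s'), (s < s')%N -> a *: h = 0.
Proof.
move=> /cls_neq0[xi hxi xf].
have [u hu uE] := hwv_extend q0 tX.1 (hwv_top g).
have [v hv vE] := hwf_extend q0 tX hxi.
have [a aE] := uhom_Uqhom (uhom_comp hu hv).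
exists a => [|s' h lt_ss'].
  apply: top_inj; rewrite topZ aE -mulmxA.
  have [c vf] := Vpow_top q0 (uhom_wv hv (hwv_top f).1).
  move: xf; rewrite -vE -mulmxA vf -scalemxAr vtopT !mxE mulr1 => ->.
  by rewrite scale1r.
apply: top_inj; rewrite topZ aE top0 -mulmxA.
by rewrite (Vpow_wt q0 (uhom_wv hv (hwv_top h).1)) ?mulmx0.
Qed.

(** Two factors V at a time retract onto W by [WV_bip]. *)
Lemma WV_retract i j : exists u v, [/\ uhom (WV q i j) (Vpow q (i + j).*2) u,
  uhom (Vpow q (i + j).*2) (WV q i j) v & v *m u = 1%:M].
Proof.
elim: i j => [|i IHi] j.
  by exists 1%:M, 1%:M; split; [exact: uhom_id|exact: uhom_id|rewrite mulmx1].
have [u [v [hu hv vu]]] := IHi j.+1; rewrite addnS in u v hu hv vu.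
have [u' v' _ _ hu' hv' _ _ vu' _ _] := WV_bip q0 i j q2.
exists (u *m u'), (v' *m v); split; [exact: uhom_comp|exact: uhom_comp|].
by rewrite -mulmxA [v *m _]mulmxA vu mul1mx.
Qed.

Lemma Wpow_retract : exists u v, [/\ uhom X (Vpow q r.*2) u,
  uhom (Vpow q r.*2) X v & v *m u = 1%:M].
Proof.
have := WV_retract r 0; rewrite addn0 (_ : WV q r 0 = X) //.
by elim: (r) => //= r' ->.
Qed.

End EndoModules.

Lemma module_iso_inv (A : pzRingType) (M N : lmodType A) (g : N -> M) :
  (forall a x y, g (a *: x + y) = a *: g x + g y) -> injective g ->
  (forall y, exists x, g x = y) -> module_iso M N.
Proof.
move=> glin ginj gsurj; pose f y := sval (cid (gsurj y)).
have fK y : g (f y) = y by exact: svalP (cid (gsurj y)).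
have flin : linear f by move=> a x y; apply: ginj; rewrite fK glin !fK.
pose mf := GRing.isLinear.Build A M N *:%R f flin.
pose F : {linear M -> N} := HB.pack f mf.
by exists F; exists g => [x|x]; [exact: fK|apply: ginj; exact: fK].
Qed.

Section SimpleModules.
Variables (k : fieldType) (q : k) (r : nat).
Hypothesis q0 : q != 0.
Hypothesis q2 : q + q^-1 != 0.
Variables (A : pzRingType) (phi : {rmorphism A -> Eq_W q r}).
Hypothesis phi_surj : forall y, exists x, phi x = y.

Notation X := (Wpow q r).
Notation cls s := (@quotmod_class _ _ _ (C_W_rad_submodule q r s)).
Notation L s := (restr (L_W q r s) phi : lmodType A).
Notation top := (@top k q r _).

Lemma L_scale s (b : A) (f : C_W q r s) : b *: (cls s f : L s) = cls s (phi b *: f).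
Proof. exact: clsZ. Qed.

Lemma L_ind s (P : L s -> Prop) : (forall f, P (cls s f)) -> forall x, P x.
Proof. exact: L_W_ind. Qed.

Lemma L_simple s : (exists x : L s, x != 0) -> simple_module (L s).
Proof.
move=> nz; split=> // P [P0 PD PZ].
have [[x [Px xn0]]|none] := pselect (exists x, P x /\ x != 0); last first.
  by left=> x Px; apply/eqP/negPn/negP => xn0; case: none; exists x.
right=> y; elim/L_ind: x => f in Px xn0 *; elim/L_ind: y => g.
have [a ag _] := transport q0 q2 g xn0; have [b phib] := phi_surj a.
by rewrite -ag -phib -L_scale; apply: PZ.
Qed.

Lemma L_annihilated s : annihilated (fun x => phi x = 0) (L s).
Proof.
move=> a pa; apply: L_ind => f; rewrite L_scale pa scale0r.
exact: quotmod_class0.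
Qed.

(** By [transport] with f = g. This is not symmetric in s and s', but one of the
    two directions suffices to distinguish L(s) from L(s'). *)
Lemma L_separate s : (exists x : L s, x != 0) ->
  exists b : A, (exists2 x : L s, x != 0 & b *: x = x) /\
    forall s' (y : L s'), (s < s')%N -> b *: y = 0.
Proof.
move=> [x]; elim/L_ind: x => f nz.
have [a af a0] := transport q0 q2 f nz; have [b phib] := phi_surj a.
exists b; split=> [|s' y lt_ss'].
  by exists (cls s f : L s) => //; rewrite L_scale phib af.
by elim/L_ind: y => h; rewrite L_scale phib a0 // quotmod_class0.
Qed.

Lemma L_noniso s s' : (exists x : L s, x != 0) -> module_iso (L s) (L s') -> s = s'.
Proof.
move=> nz [f [g fK gK]].
have finj : injective f := can_inj fK.
have nz' : exists x : L s', x != 0.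
  by have [x xn0] := nz; exists (f x); rewrite -(raddf0 f) (inj_eq finj).
have [lt|lt|//] := ltngtP s s'.
- have [b [[x xn0 bx] b0]] := L_separate nz.
  case/eqP: xn0; apply: finj; rewrite raddf0 -bx linearZ /=.
  exact: b0.
have [b [[x xn0 bx] b0]] := L_separate nz'.
case/eqP: xn0; rewrite -bx -[x]gK -linearZ /=.
by rewrite (b0 _ (g x) lt) raddf0.
Qed.

Section Completeness.
Variable M : lmodType A.
Hypothesis simM : simple_module M.
Hypothesis annM : annihilated (fun x => phi x = 0) M.

Lemma lift_act (f : 'M[k]_(udim X)) : uhom X X f -> exists b : A, val (phi b) = f.
Proof.
move=> hf; have [a af] := uhom_Uqhom q0 hf; have [b phib] := phi_surj a.
by exists b; rewrite phib.
Qed.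

Lemma uhom_act b : uhom X X (val (phi b)).
Proof. exact: Uqhom_uhom. Qed.

Lemma thru_act P f :
  (forall g h b, uhom P X g -> uhom X P h -> val (phi b) = g *m h -> forall v : M, b *: v = 0) ->
  thru P X X f -> forall b, val (phi b) = f -> forall v : M, b *: v = 0.
Proof.
move=> one tf; elim: tf => [|g h {}f hg hh _ IH] b bE v.
  by apply: annM; apply: val_inj.
have [b1 b1E] := lift_act (uhom_comp hg hh).
have e1 : b1 *: v = 0 := one g h b1 hg hh b1E v.
have : (b - b1) *: v = 0.
  by apply: IH; rewrite rmorphB /= bE b1E addrC addKr.
by rewrite scalerBl e1 subr0.
Qed.

(** The layer m = r qualifies because the identity of X factors through V^2r. *)
Lemma minimal_layer : exists2 m, (m <= r)%N &
  (exists g h b (v : M), [/\ uhom (Vpow q m.*2) X g, uhom X (Vpow q m.*2) h,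
     val (phi b) = g *m h & b *: v != 0]) /\
  (forall m' f, (m' < m)%N -> thru (Vpow q m'.*2) X X f ->
     forall b, val (phi b) = f -> forall v : M, b *: v = 0).
Proof.
pose Q m := `[< exists g h b (v : M), [/\ uhom (Vpow q m.*2) X g, uhom X (Vpow q m.*2) h,
     val (phi b) = g *m h & b *: v != 0] >].
have Qr : Q r.
  apply/asboolP; have [u [v [hu hv vu]]] := Wpow_retract r q0 q2.
  have [[x xn0] _] := simM; exists v, u, 1, x; split=> //.
    by rewrite rmorph1 vu.
  by rewrite scale1r.
case: (ex_minnP (ex_intro Q r Qr)) => m /asboolP Qm minm.
exists m; first exact: minm.
split=> // m' f lt_m' tf b bE v; apply: (thru_act _ tf bE) => g h b' hg hh b'E v'.
apply/eqP/negPn/negP => nz.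
have /minm : Q m' by apply/asboolP; exists g, h, b', v'.
by rewrite leqNgt lt_m'.
Qed.

(** By [kill_vtop_thru] the map d is a sum of maps factoring through V^(2m-2),
    and endomorphisms factoring through this act as zero. *)
Lemma layer_kill m d h b (v : M) :
  (forall m' f, (m' < m)%N -> thru (Vpow q m'.*2) X X f ->
     forall b, val (phi b) = f -> forall v : M, b *: v = 0) ->
  uhom (Vpow q m.*2) X d -> d *m vtop q m.*2 = 0 ->
  uhom X (Vpow q m.*2) h -> val (phi b) = d *m h -> b *: v = 0.
Proof.
move=> small hd d0 hh bE.
have := kill_vtop_thru q0 (biunobstructed_Wpow q0 r q2).1 hd d0.
case: m small d hd d0 h hh bE => [|m'] small d hd d0 h hh bE /= td.
  by apply: annM; apply: val_inj; rewrite bE td mul0mx.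
apply: (small m' (d *m h)) bE _ => //.
by rewrite -[d]mul1mx; apply: thru_comp td (uhom_id _) hh.
Qed.

(** The isomorphism is induced by Theta f = d h0 u, for d : V^2m -> X extending
    the highest weight vector of f; by [layer_kill] the choice of d does not
    matter, which makes Theta linear. It is onto since its image contains
    g0 h0 u <> 0. An f outside the radical generates C_W^r(2m) by [transport],
    so it is not in the kernel. If f is in the radical and Theta f <> 0 then,
    M being simple, u = b Theta f for some b, whence
    0 <> g0 h0 u = g0 (h0 b d) h0 u; but h0 b d maps the highest weight vector
    of V^2m to a multiple of itself, and the factor is the value of a highest
    weight functional on the vector of b f, that is 0: a contradiction with
    [layer_kill]. *)
Lemma complete : exists2 m, (m <= r)%N & module_iso M (L m.*2).
Proof.
have [m le_mr [[g0 [h0 [b0 [u [hg0 hh0 b0E nz]]]]] small]] := minimal_layer.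
exists m => //; set s := m.*2 in hg0 hh0 small *.
have zero d h b (v : M) : uhom (Vpow q s) X d -> d *m vtop q s = 0 ->
    uhom X (Vpow q s) h -> val (phi b) = d *m h -> b *: v = 0.
  exact: (layer_kill v small).
have ext (f : C_W q r s) : exists2 d, uhom (Vpow q s) X d & d *m vtop q s = top f.
  by have [d hd dE] := hwv_extend q0 (biunobstructed_Wpow q0 r q2).1 (hwv_top q0 f); exists d.
pose dd f := sval (cid2 (ext f)).
have hdd f : uhom (Vpow q s) X (dd f) by rewrite /dd; case: (cid2 _).
have ddt f : dd f *m vtop q s = top f by rewrite /dd; case: (cid2 _).
pose bb f := sval (cid (lift_act (uhom_comp (hdd f) hh0))).
have bbE f : val (phi (bb f)) = dd f *m h0 by exact: svalP (cid (lift_act _)).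
pose Theta f : M := bb f *: u.
have ThetaE f d b : uhom (Vpow q s) X d -> d *m vtop q s = top f ->
    val (phi b) = d *m h0 -> Theta f = b *: u.
  move=> hd dt bE; apply/eqP; rewrite -subr_eq0 -scalerBl; apply/eqP.
  apply: (zero (dd f - d) h0) => //; first exact: uhomB.
    by rewrite mulmxBl ddt dt subrr.
  by rewrite rmorphB /= bbE bE mulmxBl.
have ThetaL a f g : Theta (phi a *: f + g) = a *: Theta f + Theta g.
  rewrite /Theta scalerA -scalerDl; apply: (ThetaE _ (val (phi a) *m dd f + dd g)).
  - by apply: uhomD => //; apply: uhom_comp (hdd f); exact: uhom_act.
  - by rewrite mulmxDl -mulmxA !ddt topD topZ.
  - by rewrite rmorphD rmorphM /= !bbE mulmxDl mulmxA.
have Theta0 : Theta 0 = 0.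
  by rewrite (ThetaE 0 0 0) ?scale0r ?mul0mx ?top0 ?rmorph0 //; exact: uhom0.
have ThetaZ a f : Theta (phi a *: f) = a *: Theta f.
  by rewrite -[phi a *: f]addr0 ThetaL Theta0 addr0.
have [f0 f0E] : exists f0 : C_W q r s, Theta f0 = b0 *: u.
  have [f0 f0t] := top_surj q0 q2 (hwv_hom hg0 (hwv_vtop q0 s)).
  by exists f0; apply: (ThetaE _ g0).
have Theta_rad f : C_W_rad f -> Theta f = 0.
  move=> rad; apply: contrapT => /eqP nzf.
  have [b ub] : exists b : A, u = b *: Theta f.
    have subT : is_submodule (fun x => exists b : A, x = b *: Theta f).
      split=> [|_ _ [b ->] [c ->]|c _ [b ->]].
      - by exists 0; rewrite scale0r.
      - by exists (b + c); rewrite scalerDl.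
      - by exists (c * b); rewrite scalerA.
    have [z|//] := simM.2 _ subT.
    by case/eqP: nzf; apply: z; exists 1; rewrite scale1r.
  case/eqP: nz; rewrite ub /Theta !scalerA.
  have hb := uhom_act b.
  have hd := uhom_comp hh0 (uhom_comp hb (hdd f)).
  have hx := hwv_hom hd (hwv_vtop q0 s).
  apply: (zero (g0 *m (h0 *m (val (phi b) *m dd f))) h0) => //.
  - exact: uhom_comp.
  - have vr : hw (rho q (Vpow q s)) s%:Z (vtop q s)^T.
      by rewrite /hw trmxK -[vtop q s]mul1mx; apply: hwv_hom (uhom_rho_Vpow q0 s).2 (hwv_vtop q0 s).
    have radb : C_W_rad (phi b *: f).
      by have [_ _ radZ] := C_W_rad_submodule q r s; apply: radZ.
    have := (C_W_radP q0 q2 _).1 radb _ (hwf_hom q0 hh0 vr).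
    rewrite topZ -ddt => z.
    have [c cE] := Vpow_top q0 hx.1.
    have c0 : c = 0.
      have := congr1 (mulmx (vtop q s)^T) cE.
      rewrite !mulmxA in z *; rewrite z -scalemxAr vtopT.
      by move=> /esym/matrixP/(_ 0 0); rewrite !mxE mulr1.
    by rewrite -mulmxA cE c0 scale0r mulmx0.
  - by rewrite !rmorphM /= b0E bbE !mulmxA.
have Theta_kernel f : Theta f = 0 -> C_W_rad f.
  move=> z; apply: contrapT => nrad.
  have nzc : cls s f != 0 by apply/eqP => /cls_eq0.
  have [a af _] := transport q0 q2 f0 nzc; have [b bE] := phi_surj a.
  by case/eqP: nz; rewrite -f0E -af -bE ThetaZ z scaler0.
have Theta_surj x : exists f, Theta f = x.
  have subT : is_submodule (fun x => exists f, Theta f = x).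
    split=> [|_ _ [f <-] [g <-]|b _ [f <-]].
    - by exists 0.
    - by exists (phi 1 *: f + g); rewrite ThetaL scale1r.
    - by exists (phi b *: f).
  have [z|//] := simM.2 _ subT.
  by case/eqP: nz; apply: z; exists f0.
have ThetaB f g : Theta (f - g) = Theta f - Theta g.
  by rewrite addrC -scaleN1r -(rmorphN1 phi) ThetaL scaleN1r addrC.
have Theta_cls f : Theta (repr (cls s f : quotmod _)) = Theta f.
  apply/eqP; rewrite -subr_eq0 -ThetaB; apply/eqP/Theta_rad/(quotmod_classP (C_W_rad_submodule q r s)).
  exact: quotmod_classK.
pose g (x : L s) : M := Theta (repr (x : quotmod _)).
apply: (@module_iso_inv _ _ _ g).
- move=> b; elim/L_ind=> f; elim/L_ind=> f'.
  rewrite L_scale -quotmod_classD /g !Theta_cls; exact: ThetaL.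
- elim/L_ind=> f; elim/L_ind=> f'; rewrite /g !Theta_cls => e.
  by apply/(quotmod_classP (C_W_rad_submodule q r s))/Theta_kernel; rewrite ThetaB e subrr.
- move=> y; have [f <-] := Theta_surj y.
  by exists (cls s f); rewrite /g Theta_cls.
Qed.

End Completeness.
End SimpleModules.

(** * Dimensions, and the main theorem *)

Lemma annihilator_ideal (A : pzRingType) (M : lmodType A) :
  two_sided_ideal (fun a : A => forall x : M, a *: x = 0).
Proof.
split=> [x|a b aM bM x|a b bM x|a b bM x].
- exact: scale0r.
- by rewrite scalerBl aM bM subrr.
- by rewrite -scalerA bM scaler0.
- by rewrite -scalerA bM.
Qed.

Lemma annihilated_gen (A : pzRingType) (N : A -> Prop) (Phi : A) (M : lmodType A) :
  (forall x, N x <-> ideal_gen (fun y => y = Phi) x) ->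
  annihilated N M <-> forall x : M, Phi *: x = 0.
Proof.
move=> genN; split=> [annM x|PhiM a /genN Na].
  by apply: annM; apply/genN => I _; apply.
by apply: Na (annihilator_ideal M) _ => s ->.
Qed.

Lemma kdim_inv (k : pzRingType) (A : lalgType k) (M : lmodType A) n (f : M -> 'rV[k]_n) :
  {morph f : x y / x - y} -> (forall c x, f (c%:A *: x) = c *: f x) ->
  (forall x, f x = 0 -> x = 0) -> (forall y, exists x, f x = y) -> kdim M n.
Proof.
move=> fB fZ finj fsurj; pose g y := sval (cid (fsurj y)).
have gK y : f (g y) = y by exact: svalP (cid (fsurj y)).
pose mf := GRing.isZmodMorphism.Build M 'rV[k]_n f fB.
pose F : {additive M -> 'rV[k]_n} := HB.pack f mf.
exists F; split; last exact: fZ.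
exists g => x; last exact: gK.
by apply/eqP; rewrite -subr_eq0; apply/eqP/finj; rewrite fB gK subrr.
Qed.

Section Dimension.
Variables (k : fieldType) (q : k) (r : nat).
Hypothesis q0 : q != 0.
Hypothesis q2 : q + q^-1 != 0.
Variables (A : algType k) (phi : {lrmorphism A -> Eq_W q r}).

Notation X := (Wpow q r).
Notation cls s := (@quotmod_class _ _ _ (C_W_rad_submodule q r s)).
Notation L s := (restr (L_W q r s) phi : lmodType A).
Notation top := (@top k q r _).

(** Sending f to its pairings with a spanning set of functionals identifies
    L_W^r(s) with the row space of the Gram matrix; coordinates are taken with
    respect to a basis of that row space. *)
Lemma L_kdim s : kdim (L s) (pairing_rank q X s%:Z).
Proof.
rewrite /pairing_rank; set B := hwB X _; set B' := hwB (rho q X) _; set G := B *m B'^T.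
pose pair (f : C_W q r s) := (top f)^T *m B'^T.
have pairG f : (pair f <= row_base G)%MS.
  have : ((top f)^T <= B)%MS by apply/hwBP; rewrite /hw trmxK; apply: hwv_top.
  by rewrite eq_row_base => /(submxMr B'^T).
pose Psi f := pair f *m pinvmx (row_base G).
have PsiK f : Psi f *m row_base G = pair f by rewrite mulmxKpV.
have PsiB f g : Psi (f - g) = Psi f - Psi g.
  have -> : Psi (f - g) = ((top f - top g)^T *m B'^T) *m pinvmx (row_base G).
    by rewrite /Psi /pair /top /= mulmxBl.
  by rewrite linearB /= !mulmxBl.
have Psi_rad f : Psi f = 0 <-> C_W_rad f.
  rewrite (C_W_radP q0 q2); split=> [z xi hxi|rad].
    have : pair f = 0 by rewrite -PsiK z mul0mx.
    have /submxP[D ->] : (xi <= B')%MS by apply/hwBP.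
    move=> /(congr1 trmx); rewrite /pair trmx_mul !trmxK trmx0 => z'.
    by rewrite -mulmxA z' mulmx0.
  rewrite /Psi (_ : pair f = 0) ?mul0mx //.
  apply: trmx_inj; rewrite /pair trmx_mul !trmxK trmx0.
  apply/row_matrixP => i; rewrite row_mul row0; apply: rad.
  by apply/hwBP; exact: row_sub.
have Psi_cls f : Psi (repr (cls s f : quotmod _)) = Psi f.
  apply/eqP; rewrite -subr_eq0 -PsiB; apply/eqP/Psi_rad.
  by apply/(quotmod_classP (C_W_rad_submodule q r s)); exact: quotmod_classK.
apply: (@kdim_inv _ _ _ _ (fun x : L s => Psi (repr (x : quotmod _)))).
- elim/L_ind=> f; elim/L_ind=> g.
  have -> : cls s f - cls s g = cls s (f - g)
    by apply/eqP; rewrite subr_eq; apply/eqP; rewrite -{1}[f](subrK g); exact: quotmod_classD.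
  by rewrite !Psi_cls.
- move=> c; elim/L_ind=> f. rewrite L_scale !Psi_cls.
  have phic : val (phi c%:A) = c%:M by rewrite linearZ rmorph1 /= scalemx1.
  by rewrite /Psi /pair topZ phic mul_scalar_mx trmx_Z -!scalemxAl.
- elim/L_ind=> f; rewrite Psi_cls => /Psi_rad rad.
  by rewrite -(quotmod_class0 (C_W_rad_submodule q r s)); apply/(quotmod_classP (C_W_rad_submodule q r s)); rewrite subr0.
move=> y.
have /submxP[D yE] : (y *m row_base G <= G)%MS.
  by rewrite -(eq_row_base G); exact: submxMl.
have [f fE] : exists f : C_W q r s, top f = (D *m B)^T.
  have hDB : hw X s%:Z (D *m B) by apply/hwBP; exact: submxMl.
  exact: (top_surj q0 q2 hDB).
exists (cls s f); rewrite Psi_cls.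
by apply: (row_free_inj (row_base_free G)); rewrite PsiK /pair fE trmxK yE mulmxA.
Qed.

End Dimension.

(** Otherwise q^2 = -1 has order dividing 2. *)
Lemma quantum_two_neq0 (k : fieldType) (q : k) (l : nat) :
  q != 0 -> l.-primitive_root (q ^+ 2) -> (2 < l)%N -> q + q^-1 != 0.
Proof.
move=> q0 hl l2; apply/eqP => e.
have q2 : q ^+ 2 = -1.
  by apply/eqP; rewrite -addr_eq0 expr2 -(mulfV q0) -mulrDr e mulr0.
have : (l %| 2)%N by rewrite (prim_order_dvd hl) q2 sqrrN expr1n.
by move/(dvdn_leq (isT : 0 < 2)%N); rewrite leqNgt l2.
Qed.

Theorem corollary9p2 (k : fieldType) (q : k) (l r : nat)
    (hchar : 2%N \notin [pchar k])
    (hq : exists2 n, (0 < n)%N & q ^+ n = 1)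
    (hl : l.-primitive_root (q ^+ 2)) (hl2 : (2 < l)%N)
    (hl6 : l != 6%N) (hq6 : q ^+ 6 != 1)
    (hr : (1 <= r)%N)
    (phi : {lrmorphism BMW q r -> Eq_W q r})
    (hphi : forall i : 'I_r.-1, val (phi (bmw_g q i)) = Ract q r i)
    (hsurj : forall y : Eq_W q r, exists x : BMW q r, phi x = y) :
  let N : BMW q r -> Prop := fun x => phi x = 0 in
  let L (m : nat) : lmodType (BMW q r) := L_BMW m.*2 phi in
  [/\ (* the nonzero L(2m) are simple, annihilated by N, pairwise
         non-isomorphic *)
      forall m, (m <= r)%N -> (exists x : L m, x != 0) ->
        simple_module (L m) /\ annihilated N (L m),
      forall m m', (m <= r)%N -> (m' <= r)%N -> (exists x : L m, x != 0) ->
        module_iso (L m) (L m') -> m = m',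
      (* every simple module annihilated by N is one of them *)
      forall M : lmodType (BMW q r), simple_module M -> annihilated N M ->
        exists2 m, (m <= r)%N & module_iso M (L m),
      (* for any generator of N as a two-sided ideal, being annihilated by N
         amounts to being killed by the generator *)
      forall Phi : BMW q r,
        (forall x, N x <-> ideal_gen (fun y => y = Phi) x) ->
        forall M : lmodType (BMW q r), simple_module M ->
          (annihilated N M <-> forall x : M, Phi *: x = 0) &
      (* dimensions *)
      forall m, (m <= r)%N ->
      forall T : Uqmod k, is_Tq q m.*2 T ->
        exists2 d : nat, kdim (L m) d &
          d%:Z = \sum_(i < r.+1) (-1) ^+ i *
            ('C(r, i) * summand_mult q (utens_pow q (Vq q) (r - i).*2) T)%:Z].
Proof.
have q0 : q != 0.
  have [[//|n] _ qn] := hq; apply/eqP => q0.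
  by move: qn; rewrite q0 expr0n => /esym/eqP; rewrite oner_eq0.
have q2 := quantum_two_neq0 q0 hl hl2.
move=> N L; split.
- move=> m _ nz; split; first exact: (L_simple q0 q2 hsurj nz).
  exact: L_annihilated.
- move=> m m' _ _ nz iso; apply: double_inj.
  exact: (L_noniso q0 q2 hsurj nz iso).
- by move=> M simM annM; exact: (complete q0 q2 hsurj simM annM).
- by move=> Phi genN M _; exact: annihilated_gen.
move=> m _ T hT; exists (pairing_rank q (Wpow q r) m.*2%:Z).
  exact: (L_kdim q0 q2).
rewrite pairing_rank_Wpow //; apply: eq_bigr => i _.
by rewrite (summand_mult_pairing_rank q0 hT (biunobstructed_Vpow q0 _)).
Qed.
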